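(* Let $d=2$, i.e. $\Omega\subset\mathbb R^2$. Let $(\bar{\mathbf y},\bar p,\bar{\mathbf z},\bar r,\bar{\mathbf u})\in \mathbf H_0^1(\Omega)\times L^2(\Omega)/\mathbb R\times \mathbf H_0^1(\rho,\Omega)\times L^2(\rho,\Omega)/\mathbb R\times\mathbb U_{ad}$ be the solution of the continuous optimality system (OS) of the context, and, for $\mathscr T\in\mathbb T$, let $(\bar{\mathbf y}_{\mathscr T},\bar p_{\mathscr T},\bar{\mathbf z}_{\mathscr T},\bar r_{\mathscr T},\bar{\mathbf u}_{\mathscr T})\in \mathbf V(\mathscr T)\times Q(\mathscr T)\times \mathbf V(\mathscr T)\times Q(\mathscr T)\times\mathbb U_{ad}(\mathscr T)$ be its numerical approximation, i.e. the solution of the discrete optimality system (DOS) of the context. Put $\mathbf e_{\mathbf y}=\bar{\mathbf y}-\bar{\mathbf y}_{\mathscr T}$, $e_p=\bar p-\bar p_{\mathscr T}$, $\mathbf e_{\mathbf u}=\bar{\mathbf u}-\bar{\mathbf u}_{\mathscr T}$. Then, for every $T\in\mathscr T$, the local indicator $$\mathcal E_{st,T}=h_T^2\|\bar{\mathbf u}_{\mathscr T}+\Delta\bar{\mathbf y}_{\mathscr T}-\nabla\bar p_{\mathscr T}\|_{\mathbf L^\infty(T)}+\tfrac{h_T}2\|[\![\nabla\bar{\mathbf y}_{\mathscr T}\cdot\boldsymbol\nu]\!]\|_{\mathbf L^\infty(\partial T\setminus\partial\Omega)}+h_T\|\mathrm{div}\,\bar{\mathbf y}_{\mathscr T}\|_{L^\infty(T)}$$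 satisfies $$\mathcal E_{st,T}\le C\left(\|\mathbf e_{\mathbf y}\|_{\mathbf L^\infty(\mathcal N_T)}+h_T^{1-\frac d2}\|e_p\|_{L^2(\mathcal N_T)}+h_T^{2-\frac d2}\|\mathbf e_{\mathbf u}\|_{\mathbf L^2(\mathcal N_T)}\right),$$ where $\mathcal N_T$ is the union of the elements $T'\in\mathscr T$ such that $T$ and $T'$ have an interior side in common, and the constant $C>0$ is independent of the continuous and discrete solutions, of the size of the elements of $\mathscr T$ and of $\#\mathscr T$.
   Context: **Continuous problem.** $\Omega\subset\mathbb R^d$ is an open bounded polytopal domain with Lipschitz boundary; $\mathcal D\subset\Omega$ is a finite set with $m=\#\mathcal D\ge 1$; $\mathbf y_t\in\mathbb R^d$ ($t\in\mathcal D$) are given; $\lambda>0$; $\mathbf a,\mathbf b\in\mathbb R^d$ with $\mathbf a<\mathbf b$ (vector inequalities are componentwise). Bold spaces are $d$-fold products. $\mathbb U_{ad}=\{\mathbf v\in\mathbf L^2(\Omega):\mathbf a\le\mathbf v\le\mathbf b\text{ a.e. in }\Omega\}$. Write $a(\mathbf w,\mathbf v)=\int_\Omega\nabla\mathbf w:\nabla\mathbf v$ and $b(\mathbf v,q)=-\int_\Omega q\,\mathrm{div}\,\mathbf v$ (used whenever the integrals make sense). **Weights.** For a weight $\omega$ in the Muckenhoupt class $A_2(\mathbb R^d)$ and $G\subseteq\Omega$ open, $L^2(\omega,G)$ has norm $(\int_G|v|^2\omega)^{1/2}$, $H^1(\omega,G)=\{v\in L^2(\omega,G):|\nabla v|\in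 L^2(\omega,G)\}$, and $H_0^1(\omega,G)$ is the closure of $C_0^\infty(G)$ in $H^1(\omega,G)$. $L^2(\omega,\Omega)/\mathbb R$ is $L^2(\omega,\Omega)$ modulo constants, identified with the functions having zero integral. Fix $\alpha\in(d-2,2)$. Let $d_{\mathcal D}=\mathrm{dist}(\mathcal D,\partial\Omega)$ if $m=1$ and $d_{\mathcal D}=\min\{\mathrm{dist}(\mathcal D,\partial\Omega),\min\{|t-t'|:t\ne t'\in\mathcal D\}\}$ otherwise. The weight is $\rho(x)=|x-t|^\alpha$ if $\mathcal D=\{t\}$; if $m\ge2$, $\rho(x)=|x-t|^\alpha$ when $|x-t|<d_{\mathcal D}/2$ for some $t\in\mathcal D$, and $\rho(x)=1$ otherwise. Then $\rho\in A_2(\mathbb R^d)$ and $\delta_t\in H_0^1(\rho^{-1},\Omega)'$ for $t\in\mathcal D$; $\langle\cdot,\cdot\rangle$ is the duality pairing, and $\langle(\mathbf y-\mathbf y_t)\delta_t,\mathbf w\rangle=(\mathbf y(t)-\mathbf y_t)\cdot\langle\delta_t,\mathbf w\rangle$ (componentwise). **(OS)**: - $a(\bar{\mathbf y},\mathbf v)+b(\mathbf v,\bar p)=(\bar{\mathbf u},\mathbf v)_{\mathbf L^2(\Omega)}$ for all $\mathbf v\in\mathbf H_0^1(\Omega)$, $b(\bar{\mathbf y},q)=0$ for all $q\in L^2(\Omega)/\mathbb R$; - $a(\mathbf w,\bar{\mathbf z})-b(\mathbf w,\bar r)=\sum_{t\in\mathcal D}\langle(\bar{\mathbf y}-\mathbf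 y_t)\delta_t,\mathbf w\rangle$ for all $\mathbf w\in\mathbf H_0^1(\rho^{-1},\Omega)$, $b(\bar{\mathbf z},s)=0$ for all $s\in L^2(\rho^{-1},\Omega)/\mathbb R$; - $(\bar{\mathbf z}+\lambda\bar{\mathbf u},\mathbf u-\bar{\mathbf u})_{\mathbf L^2(\Omega)}\ge0$ for all $\mathbf u\in\mathbb U_{ad}$. **Meshes.** $\mathbb T$ is a family of conforming, shape regular simplicial meshes $\mathscr T=\{T\}$ of $\bar\Omega$ that are refinements of an initial mesh $\mathscr T_0$; $h_T=\mathrm{diam}(T)$. On an interior side $S$ shared by $T^\pm$, $[\![\mathbf V\cdot\boldsymbol\nu]\!]=\mathbf V|_{T^+}\cdot\boldsymbol\nu^++\mathbf V|_{T^-}\cdot\boldsymbol\nu^-$, with $\boldsymbol\nu^\pm$ the unit normals on $S$ pointing towards $T^\pm$. Note $T\subset\mathcal N_T$. $Q(\mathscr T)=\{q\in C(\bar\Omega):q|_T\in\mathbb P_1(T)\ \forall T\}\cap L^2(\Omega)/\mathbb R$, $\mathbf V(\mathscr T)=\{\mathbf v\in\mathbf C(\bar\Omega):\mathbf v|_T\in\mathbb P_2(T)^d\ \forall T\}\cap\mathbf H_0^1(\Omega)$, $\mathbb U_{ad}(\mathscr T)=\{\mathbf u\in\mathbf C(\bar\Omega):\mathbf u|_T\in\mathbb P_2(T)^d\ \forall T\}\cap\mathbb U_{ad}$. **(DOS)**: - $a(\bar{\mathbf y}_{\mathscr T},\mathbf v)+b(\mathbf v,\bar p_{\mathscr T})=(\bar{\mathbf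 u}_{\mathscr T},\mathbf v)_{\mathbf L^2(\Omega)}$ for all $\mathbf v\in\mathbf V(\mathscr T)$, $b(\bar{\mathbf y}_{\mathscr T},q)=0$ for all $q\in Q(\mathscr T)$; - $a(\mathbf w,\bar{\mathbf z}_{\mathscr T})-b(\mathbf w,\bar r_{\mathscr T})=\sum_{t\in\mathcal D}(\bar{\mathbf y}_{\mathscr T}(t)-\mathbf y_t)\cdot\mathbf w(t)$ for all $\mathbf w\in\mathbf V(\mathscr T)$, $b(\bar{\mathbf z}_{\mathscr T},s)=0$ for all $s\in Q(\mathscr T)$; - $(\bar{\mathbf z}_{\mathscr T}+\lambda\bar{\mathbf u}_{\mathscr T},\mathbf u-\bar{\mathbf u}_{\mathscr T})_{\mathbf L^2(\Omega)}\ge0$ for all $\mathbf u\in\mathbb U_{ad}(\mathscr T)$. *)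

(* Defs.v *)
From HB Require Import structures.
From mathcomp Require Import all_boot all_order all_algebra.
From mathcomp Require Import all_classical all_reals all_analysis.

Set Implicit Arguments.
Unset Strict Implicit.
Unset Printing Implicit Defensive.

Import Order.TTheory GRing.Theory Num.Theory.
Import numFieldNormedType.Exports.

Local Open Scope classical_set_scope.
Local Open Scope ring_scope.

(* The plane is [R * R].  Its library norm is the max norm, so Euclidean
   quantities are defined explicitly.  A vector field is the family
   ['I_2 -> R * R -> R] of its components.  Functions on a set [G] are total
   functions on the plane of which only the values on [G] matter. *)

Definition space_dim {R : realType} : R := 2.

Section Geometry.
Context {R : realType}.
Implicit Types (x y A B C : R * R) (G T S Om : set (R * R)).

Definition crd (i : 'I_2) x : R := if i == ord0 then x.1 else x.2.
Definition dir (i : 'I_2) : R * R := if i == ord0 then (1, 0) else (0, 1).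
Definition dot x y : R := \sum_(i < 2) crd i x * crd i y.
Definition eucl_dist x y : R := Num.sqrt (dot (x - y) (x - y)).
Definition perp x : R * R := (- x.2, x.1).
Definition vnorm (w : 'I_2 -> R) : R := Num.sqrt (\sum_(i < 2) w i ^+ 2).

Definition boundary G : set (R * R) := closure G `\` interior G.
Definition segment A B : set (R * R) :=
  [set A + s *: (B - A) | s in `[0, 1]].

(* Near each boundary point, in the orthonormal frame [(perp e, e)], the set
   is exactly the part of the plane strictly above a Lipschitz graph. *)
Definition lipschitz_boundary Om :=
  forall x, boundary Om x ->
  exists (e : R * R) (r L : R) (g : R -> R),
    [/\ dot e e = 1, 0 < r, L.-lipschitz g &
      forall y, eucl_dist y x < r -> (Om y <-> g (dot y (perp e)) < dot y e)].

Definition polygonal Om :=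
  exists s : seq ((R * R) * (R * R)),
    boundary Om = \bigcup_(e in [set` s]) segment e.1 e.2.

Definition polytopal_lipschitz_domain Om :=
  [/\ open Om, connected Om, Om !=set0, bounded_set Om &
      polygonal Om /\ lipschitz_boundary Om].

(* [simplex T A B C]: [T] is the nondegenerate closed triangle [ABC]. *)
Definition simplex T A B C :=
  dot (B - A) (perp (C - A)) != 0 /\
  T = [set x | exists s t : R, [/\ 0 <= s, 0 <= t, s + t <= 1 &
                                x = A + s *: (B - A) + t *: (C - A)]].

Definition vertex T A := exists B C, simplex T A B C.
Definition side T S := exists A B C, simplex T A B C /\ S = segment A B.

Definition conforming (Th : set (set (R * R))) :=
  forall T T', Th T -> Th T' -> T <> T' ->
  [\/ T `&` T' = set0,
      exists v, [/\ vertex T v, vertex T' v & T `&` T' = [set v]] |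
      exists S, [/\ side T S, side T' S & T `&` T' = S]].

Definition mesh Om (Th : set (set (R * R))) :=
  [/\ finite_set Th,
      forall T, Th T -> exists A B C, simplex T A B C,
      \bigcup_(T in Th) T = closure Om & conforming Th].

Definition refines (Th Th0 : set (set (R * R))) :=
  forall T, Th T -> exists2 T0, Th0 T0 & T `<=` T0.

Definition diam T : R := sup [set eucl_dist z.1 z.2 | z in T `*` T].
Definition inball_diam T : R :=
  sup [set 2 * r | r in [set r | 0 <= r /\
         exists x, [set y | eucl_dist y x <= r] `<=` T]].

Definition shape_regular (TT : set (set (set (R * R)))) :=
  exists sigma : R, forall Th T, TT Th -> Th T ->
    diam T <= sigma * inball_diam T.

Definition mesh_family Om Th0 (TT : set (set (set (R * R)))) :=
  [/\ mesh Om Th0,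
      forall Th, TT Th -> mesh Om Th /\ refines Th Th0 &
      shape_regular TT].

(* An interior side is one shared by two distinct elements.  [T] itself
   belongs to its patch even when it has no interior side. *)
Definition patch_of (Th : set (set (R * R))) T : set (R * R) :=
  \bigcup_(T' in [set T' | Th T' /\
     (T' = T \/ exists S, side T S /\ side T' S)]) T'.

(* Unit normal to the segment [AB] pointing towards [C]. *)
Definition normal_towards A B C : R * R :=
  let nu := (eucl_dist A B)^-1 *: perp (B - A) in
  Num.sg (dot nu (C - A)) *: nu.

End Geometry.

Section Functions.
Context {R : realType}.
Implicit Types (x t : R * R) (G K Om : set (R * R)).
Implicit Types (om f g p q r s : R * R -> R) (u v w y z : 'I_2 -> R * R -> R).

Definition mu2 := ((@lebesgue_measure R) \x (@lebesgue_measure R))%E.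

Definition partial (i : 'I_2) f : R * R -> R := fun x => 'D_(dir i) f x.

Definition smooth f := forall l : seq 'I_2,
  let g := foldr partial f l in
  continuous g /\ forall i x, derivable g x (dir i).

Definition test_fun G f :=
  smooth f /\ exists K, [/\ compact K, K `<=` G & forall x, ~ K x -> f x = 0].

Definition loc_integrable G f := measurable_fun G f /\
  forall K, compact K -> K `<=` G -> (\int[mu2]_(x in K) `|f x|%:E < +oo)%E.

Definition is_wpartial G (i : 'I_2) f g :=
  [/\ loc_integrable G f, loc_integrable G g &
      forall phi, test_fun G phi ->
        \int[mu2]_(x in G) (f x * partial i phi x) =
        - \int[mu2]_(x in G) (g x * phi x)].

(* The weak derivative, [0] when there is none. *)
Definition wpartial G (i : 'I_2) f : R * R -> R :=
  xget (fun=> 0) [set g | is_wpartial G i f g].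

(* Weighted spaces; the unweighted ones are those of [unit_weight]. *)
Definition unit_weight : R * R -> R := fun=> 1.

Definition L2 om G f := measurable_fun G f /\
  (\int[mu2]_(x in G) (f x ^+ 2 * om x)%:E < +oo)%E.

Definition L2mod om G f := L2 om G f /\ \int[mu2]_(x in G) f x = 0.

Definition H1 om G f := L2 om G f /\
  forall i, exists2 g, is_wpartial G i f g & L2 om G g.

Definition H1sqnorm om G f : \bar R :=
  (\int[mu2]_(x in G)
     ((f x ^+ 2 + \sum_(i < 2) wpartial G i f x ^+ 2) * om x)%:E)%E.

Definition H10 om G f := H1 om G f /\
  forall eps : R, 0 < eps -> exists2 phi, test_fun G phi &
    (H1sqnorm om G (fun x => f x - phi x)%R < eps%:E)%E.

Definition aform G w v : R :=
  \int[mu2]_(x in G) (\sum_(j < 2) \sum_(i < 2)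
    wpartial G i (w j) x * wpartial G i (v j) x).

Definition bform G v q : R :=
  - \int[mu2]_(x in G) (q x * \sum_(i < 2) wpartial G i (v i) x).

Definition L2dot G u v : R :=
  \int[mu2]_(x in G) (\sum_(i < 2) u i x * v i x).

(* Point value of the continuous representative of the class of [f]. *)
Definition point_value G f t : R :=
  xget f [set g | {in G, continuous g} /\
                  {ae mu2, forall x, G x -> f x = g x}] t.

(* The value at [w] of the continuous extension to [H10 om G] of the
   evaluation of test functions at [t]. *)
Definition dirac_pairing om G t f : R :=
  xget 0 [set c | forall phi : nat -> R * R -> R,
    (forall n, test_fun G (phi n)) ->
    H1sqnorm om G (fun x => f x - phi n x) @[n --> \oo] --> 0%E ->
    phi n t @[n --> \oo] --> c].

(* When [D] is a singleton the second set is empty. *)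
Definition dist_D Om (D : set (R * R)) : R :=
  inf ([set eucl_dist z.1 z.2 | z in D `*` boundary Om] `|`
       [set eucl_dist z.1 z.2 | z in [set z | [/\ D z.1, D z.2 & z.1 <> z.2]]]).

Definition weight Om D (alpha : R) : R * R -> R := fun x =>
  let near := [set t | D t /\
                (D = [set t] \/ eucl_dist x t < dist_D Om D / 2)] in
  if `[< near !=set0 >] then eucl_dist x (xget 0 near) `^ alpha else 1.

Definition Uad Om (a b : 'I_2 -> R) u :=
  forall i, L2 unit_weight Om (u i) /\
    {ae mu2, forall x, Om x -> a i <= u i x <= b i}.

Definition OS Om D (yd : R * R -> 'I_2 -> R) (lam : R) (a b : 'I_2 -> R)
    (alpha : R) y p z r u :=
  let rho := weight Om D alpha in
  let rhoV := fun x => (rho x)^-1 in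
  [/\ [/\ forall i, H10 unit_weight Om (y i), L2mod unit_weight Om p,
          forall i, H10 rho Om (z i), L2mod rho Om r & Uad Om a b u],
      (forall v, (forall i, H10 unit_weight Om (v i)) ->
         aform Om y v + bform Om v p = L2dot Om u v) /\
      (forall q, L2mod unit_weight Om q -> bform Om y q = 0),
      (forall w, (forall i, H10 rhoV Om (w i)) ->
         aform Om w z - bform Om w r =
         \sum_(t \in D) \sum_(i < 2)
           (point_value Om (y i) t - yd t i) * dirac_pairing rhoV Om t (w i)) /\
      (forall s, L2mod rhoV Om s -> bform Om z s = 0) &
      forall v, Uad Om a b v ->
        0 <= L2dot Om (fun i x => z i x + lam * u i x)
                      (fun i x => v i x - u i x)].

End Functions.

Section Discrete.
Context {R : realType}.
Implicit Types (x t A B C : R * R) (T Om : set (R * R)).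
Implicit Types (Th : set (set (R * R))).
Implicit Types (f g p q r s : R * R -> R) (u v w y z : 'I_2 -> R * R -> R).

Definition polynomial_fun (k : nat) f := exists c : nat -> nat -> R,
  forall x, f x = \sum_(i < k.+1) \sum_(j < k.+1 | (i + j <= k)%N)
                    c i j * x.1 ^+ i * x.2 ^+ j.

Definition is_local (k : nat) T f g :=
  polynomial_fun k g /\ forall x, T x -> f x = g x.

(* The polynomial that coincides with [f] on [T], as a function on the whole
   plane, so that its classical derivatives make sense on [T] up to its
   boundary. *)
Definition local_poly (k : nat) T f : R * R -> R :=
  xget (fun=> 0) [set g | is_local k T f g].

Definition fe_space (k : nat) Om Th f :=
  {within closure Om, continuous f} /\
  forall T, Th T -> exists g, is_local k T f g.

Definition Qh Om Th q := fe_space 1 Om Th q /\ L2mod unit_weight Om q.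
Definition Vh Om Th v :=
  forall i, fe_space 2 Om Th (v i) /\ H10 unit_weight Om (v i).
Definition Uadh Om Th (a b : 'I_2 -> R) u :=
  (forall i, fe_space 2 Om Th (u i)) /\ Uad Om a b u.

Definition DOS Om D (yd : R * R -> 'I_2 -> R) (lam : R) (a b : 'I_2 -> R)
    Th y p z r u :=
  [/\ [/\ Vh Om Th y, Qh Om Th p, Vh Om Th z, Qh Om Th r &
          Uadh Om Th a b u],
      (forall v, Vh Om Th v ->
         aform Om y v + bform Om v p = L2dot Om u v) /\
      (forall q, Qh Om Th q -> bform Om y q = 0),
      (forall w, Vh Om Th w ->
         aform Om w z - bform Om w r =
         \sum_(t \in D) \sum_(i < 2) (y i t - yd t i) * w i t) /\
      (forall s, Qh Om Th s -> bform Om z s = 0) &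
      forall v, Uadh Om Th a b v ->
        0 <= L2dot Om (fun i x => z i x + lam * u i x)
                      (fun i x => v i x - u i x)].

Definition Lp_norm (e : \bar R) T f : \bar R :=
  'N[mu2]_e[EFin \o (f \_ T)]%E.
Definition Lp_vnorm (e : \bar R) T v : \bar R :=
  Lp_norm e T (fun x => vnorm (fun i => v i x)).

Definition normal_derivative T v (nu : R * R) x (j : 'I_2) : R :=
  \sum_(i < 2) partial i (local_poly 2 T (v j)) x * crd i nu.

Definition jump T T' v A B C C' x (j : 'I_2) : R :=
  normal_derivative T v (normal_towards A B C) x j +
  normal_derivative T' v (normal_towards A B C') x j.

(* [L^oo] norm of the jump over the interior sides [AB] of [T], each being
   parametrized affinely by the unit interval; it is [0] when [T] has no
   interior side. *)
Definition jump_norm Th T v : \bar R :=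
  ereal_sup ([set 0%E] `|` [set e : \bar R | exists A B C T' C',
    [/\ simplex T A B C, Th T', T' <> T, simplex T' A B C' &
        e = let f := fun k : R =>
                     vnorm (jump T T' v A B C C' (A + k *: (B - A))) in
            'N[@lebesgue_measure R]_+oo[EFin \o (f \_ `[0%R, 1%R])]%E]]).

(* Differential operators act on the restrictions to [T]. *)
Definition E_st Th T u y p : \bar R :=
  let h := diam T in
  let resid := fun j x => local_poly 2 T (u j) x
    + \sum_(i < 2) partial i (partial i (local_poly 2 T (y j))) x
    - partial j (local_poly 1 T p) x in
  let div_y := fun x => \sum_(i < 2) partial i (local_poly 2 T (y i)) x in
  ((h ^+ 2)%:E * Lp_vnorm +oo T resid + (h / 2)%:E * jump_norm Th T y
   + h%:E * Lp_norm +oo T div_y)%E.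

End Discrete.

(* Main.v *)
(* The state equations are tested only with smooth functions
   [phi = psi (xi) chi (ta)], where [(xi, ta)] are affine coordinates of length
   scale comparable to [h_T] and [phi] is supported in the patch of [T].  Both
   derivatives of the Laplacian are put on [phi], so that
     [int yT_j Lap phi + pT d_j phi + uT_j phi]
   differs from zero by at most
     [C (|e_y|_oo + |e_p|_2 + h_T |e_u|_2)],
   and similarly for the divergence.  The discrete functions being piecewise
   quadratic, this integral is an explicit combination of moments of [psi] and
   [chi].  Inside [T], taking [psi] and [chi] dual to [1, t, t^2] recovers every
   coefficient of the element residual and of the divergence.  Across an
   interior side, given by [ta = 0], taking [chi] with [chi 0 = 1] and vanishing
   moments on both half lines kills every contribution but that of the jump of
   the normal derivative.  The supports fit by shape regularity; they lie in
   [Om], and not only in its closure, since the boundary is Lipschitz, and in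
   the union of the two triangles at a side since conformity puts these on
   opposite sides of it. *)
Require Import Defs.
From HB Require Import structures.
From mathcomp Require Import all_boot all_order all_algebra.
From mathcomp Require Import all_classical all_reals all_analysis.
From mathcomp Require Import measurable_realfun ring lra.
Set Implicit Arguments.
Unset Strict Implicit.
Unset Printing Implicit Defensive.
Import Order.TTheory GRing.Theory Num.Theory.
Import numFieldNormedType.Exports.
Local Open Scope classical_set_scope.
Local Open Scope ring_scope.

(** The right-hand side controls the error of the velocity only in the maximum norm, with no norm of
    its gradient. This is why no derivative may stay on that error, and why the test functions need
    two bounded derivatives at the scale of the element. The profiles [psi] and [chi] are chosen
    once and for all; an element enters only through an affine frame whose slope is at most 1. All
    constants therefore come from one bound [L] on the jets of the profiles and from the shape
    regularity [sigma], and no equivalence of norms on polynomials is invoked. As [chi] hides the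
    interior of both triangles, the jump is bounded without going through their residuals. Another
    obstacle is that [wpartial] is an arbitrary choice among functions equal almost everywhere:
    before a smooth function can be inserted in the state equations, the chosen weak derivative has
    to be identified with the classical one, which takes the fundamental lemma of the calculus of
    variations. *)

Local Notation plane R := (measurableTypeR R * measurableTypeR R)%type.

(** * Smooth functions *)

Section DirectionalDerivatives.
Context {R : realType}.

(** Along [v] the map [l] is affine with slope [a], so the difference quotient of [f \o l] is
    literally that of [f] in the direction [a]; differentiability of [f] then extracts the factor
    [a]. *)
Lemma is_derive_comp_affine {V : normedModType R} (l : V -> R) (a : R)
    (f : R -> R) (x v : V) (d : R) :
  (forall h, l (h *: v + x) = h * a + l x) ->
  is_derive (l x) 1 f d -> is_derive x v (f \o l) (a * d).
Proof.
move=> lE [df dfE].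
have dif : differentiable f (l x) by exact/derivable1_diffP.
have [dfa dfaE] : is_derive (l x) a f (a * d).
  apply: DeriveDef; first exact: diff_derivable.
  rewrite deriveE// -[a in LHS]mulr1 -/(GRing.scale a (1 : R^o)) linearZ /=.
  by rewrite -deriveE// dfE.
have qE : (fun h => h^-1 *: (((f \o l) \o shift x) (h *: v) - (f \o l) x)) =
          (fun h => h^-1 *: ((f \o shift (l x)) (h *: a) - f (l x))).
  by apply/funext => h /=; rewrite lE.
by apply: DeriveDef; rewrite ?/derivable ?/derive qE.
Qed.

Lemma partialE (i : 'I_2) (f : R * R -> R) (x : R * R) (d : R) :
  is_derive x (dir i) f d -> partial i f x = d.
Proof. by case. Qed.

End DirectionalDerivatives.

Section SmoothLine.
Context {R : realType}.
Implicit Types f g : R -> R.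

(** Grading by the order of derivation lets closure under products go by induction: the derivative
    of a product is a sum of products of one order less. *)
Fixpoint Cline (n : nat) f : Prop :=
  if n is n'.+1 then (forall x, derivable f x 1) /\ Cline n' f^`()%classic
  else continuous f.

Definition line_smooth f := forall n, Cline n f.

Lemma derivable_line_continuous f :
  (forall x, derivable f x 1) -> continuous f.
Proof.
by move=> df x; apply: differentiable_continuous; apply/derivable1_diffP.
Qed.

Lemma line_smooth_derivable f (x : R) : line_smooth f -> derivable f x 1.
Proof. by move=> /(_ 1%N) [+ _]; exact. Qed.

Lemma line_smooth_is_derive f (x : R) : line_smooth f -> is_derive x 1 f (f^`()%classic x).
Proof.
move=> sf; rewrite derive1E; apply: derivableP.
exact: line_smooth_derivable.
Qed.

Lemma line_smooth_continuous f : line_smooth f -> continuous f.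
Proof. by move=> /(_ 0%N). Qed.

Lemma line_smooth_derive f : line_smooth f -> line_smooth f^`()%classic.
Proof. by move=> sf n; case: (sf n.+1). Qed.

Lemma Cline_le n f : Cline n.+1 f -> Cline n f.
Proof.
elim: n f => [|n IH] f; first by case=> /derivable_line_continuous.
by case=> df /IH.
Qed.

Lemma derive1_is f (g : R -> R) : (forall x : R, is_derive x 1 f (g x)) -> f^`()%classic = g.
Proof. by move=> h; apply/funext => x; rewrite derive1E; case: (h x). Qed.

Lemma ClineD n f g : Cline n f -> Cline n g -> Cline n (f \+ g).
Proof.
elim: n f g => [|n IH] f g; first by move=> cf cg x; apply: cvgD; [exact: cf|exact: cg].
move=> [df cf] [dg cg].
have D (x : R) : is_derive x 1 (f \+ g) ((f^`()%classic \+ g^`()%classic) x).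
  by rewrite /= !derive1E; apply: is_deriveD; exact/derivableP.
by split; [move=> x; case: (D x) | rewrite (derive1_is D); apply: IH].
Qed.

Lemma ClineM n f g : Cline n f -> Cline n g -> Cline n (fun x => f x * g x).
Proof.
elim: n f g => [|n IH] f g.
  by move=> cf cg x; apply: cvgM; [exact: cf|exact: cg].
move=> [df cf] [dg cg].
have D (x : R) : is_derive x 1 (fun x => f x * g x)
    (((fun x => f x * g^`()%classic x) \+ (fun x => g x * f^`()%classic x)) x).
  by rewrite /= !derive1E; apply: is_deriveM; exact/derivableP.
split; first by move=> x; case: (D x).
rewrite (derive1_is D); apply: ClineD; apply: IH => //; exact: Cline_le.
Qed.

Lemma Cline_cst n (c : R) : Cline n (fun=> c).
Proof.
elim: n c => [|n IH] c /=; first by move=> x; exact: cvg_cst.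
split=> [x|]; first exact: derivable_cst.
by rewrite (derive1_is (g := fun=> 0)) // => x; exact: is_derive_cst.
Qed.

Lemma Cline_affine n f (a b : R) : Cline n f -> Cline n (fun x => f (a * x + b)).
Proof.
elim: n f => [|n IH] f.
  move=> cf x; apply: continuous_comp; last exact: cf.
  by apply: cvgD; [apply: cvgM; [exact: cvg_cst|exact: cvg_id]|exact: cvg_cst].
move=> [df cf].
have D (x : R) : is_derive x 1 (fun x => f (a * x + b)) (a * f^`()%classic (a * x + b)).
  apply: (@is_derive_comp_affine _ _ (fun x => a * x + b) a f x 1).
    by move=> h; rewrite /GRing.scale/=; ring.
  by rewrite derive1E; exact/derivableP.
split; first by move=> x; case: (D x).
rewrite (derive1_is D); apply: ClineM; first exact: Cline_cst.
exact: IH.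
Qed.

Lemma line_smoothD f g : line_smooth f -> line_smooth g -> line_smooth (f \+ g).
Proof. by move=> sf sg n; apply: ClineD. Qed.

Lemma line_smoothM f g :
  line_smooth f -> line_smooth g -> line_smooth (fun x => f x * g x).
Proof. by move=> sf sg n; apply: ClineM. Qed.

Lemma line_smooth_cst (c : R) : line_smooth (fun=> c).
Proof. by move=> n; apply: Cline_cst. Qed.

Lemma line_smooth_affine f (a b : R) :
  line_smooth f -> line_smooth (fun x => f (a * x + b)).
Proof. by move=> sf n; apply: Cline_affine. Qed.

End SmoothLine.

(** * Flat functions and bumps on the line *)

Section FlatExponential.
Context {R : realType}.

(** The classical flat function exp(-1/x), with a factor p(1/x) that makes the family stable under
    differentiation. *)
Definition flat_exp (p : {poly R}) (x : R) : R :=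
  if 0 < x then p.[x^-1] * expR (- x^-1) else 0.

Lemma expR_ge_monomial (n : nat) (y : R) : 0 <= y -> y ^+ n / n`!%:R <= expR y.
Proof.
move=> y0; case: n => [|n].
  by rewrite expr0 fact0 divr1 -expR0 ler_expR.
by apply: le_trans (expR_ge1Dxn n y0); rewrite lerDr.
Qed.

(** The Taylor term of order i+1 of exp(1/x) beats x^-i with a factor x to spare. *)
Lemma flat_exp_le_linear (p : {poly R}) :
  exists2 K : R, 0 <= K & forall x, 0 < x -> `|flat_exp p x| <= K * x.
Proof.
exists (\sum_(i < size p) `|p`_i| * (i.+1)`!%:R).
  by apply: sumr_ge0 => i _; apply: mulr_ge0.
move=> x x0; rewrite /flat_exp x0 normrM horner_coef [`|expR _|]gtr0_norm ?expR_gt0//.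
apply: (@le_trans _ _ ((\sum_(i < size p) `|p`_i| * (x^-1) ^+ i) * expR (- x^-1))).
  rewrite ler_wpM2r ?expR_ge0//; apply: le_trans (ler_norm_sum _ _ _) _.
  apply: ler_sum => i _; rewrite normrM normrX.
  by rewrite (gtr0_norm (_ : 0 < x^-1)) ?invr_gt0.
rewrite !mulr_suml; apply: ler_sum => i _; rewrite -!mulrA ler_wpM2l//.
have y0 : 0 < x^-1 by rewrite invr_gt0.
have := expR_ge_monomial i.+1 (ltW y0).
rewrite expRN -[X in _ <= X * x]invrK.
rewrite ler_pdivrMr ?ltr0n ?fact_gt0// => h.
rewrite ler_pdivrMr ?expR_gt0//.
rewrite exprSr in h.
have := ler_wpM2r (ltW x0) h.
rewrite -mulrA mulVf ?gt_eqF// mulr1 => h2.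
by apply: (le_trans h2); rewrite invrK; lra.
Qed.

End FlatExponential.

Section FlatExponentialSmooth.
Context {R : realType}.

(** As 1/x has derivative -1/x^2, differentiating p(1/x) exp(-1/x) yields (p - p')(1/x) exp(-1/x) /
    x^2. *)
Let dflat (p : {poly R}) : {poly R} := 'X^2 * (p - (p^`())%R).

Lemma flat_exp_is_derive_pos (p : {poly R}) (x : R) : 0 < x ->
  is_derive x 1 (flat_exp p) (flat_exp (dflat p) x).
Proof.
move=> x0; rewrite {2}/flat_exp x0.
have x1 : x != 0 by rewrite gt_eqF.
have Di : is_derive x 1 (fun y : R => y^-1) (- x ^- 2).
  by have := @is_deriveV _ id x 1 1 x1 (is_derive_id x 1); rewrite /GRing.scale/= mulr1.
apply: (@near_eq_is_derive _ _ _
    ((horner p \o (fun y => y^-1)) * (expR \o (fun y => - y^-1)))).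
  near=> y; rewrite /flat_exp /=.
  have -> : 0 < y by near: y; apply: lt_nbhsr.
  by [].
have D1 := is_derive1_comp (is_derive_poly p x^-1) Di.
have D2 := @is_derive1_comp _ expR (fun y : R => - y^-1) x _ _ (is_derive_expR (- x^-1)) (is_deriveN Di).
apply: (is_derive_eq (is_deriveM D1 D2)).
rewrite /dflat hornerM hornerXn hornerD hornerN /GRing.scale /= -exprVn; ring.
Unshelve. all: by end_near. Qed.

Lemma flat_exp_is_derive_neg (p : {poly R}) (x : R) : x < 0 ->
  is_derive x 1 (flat_exp p) (flat_exp (dflat p) x).
Proof.
move=> x0; rewrite {2}/flat_exp ltNge (ltW x0) /=.
apply: (@near_eq_is_derive _ _ _ (cst 0)).
near=> y; rewrite /flat_exp /= ltNge.
by have -> : y <= 0 by apply: ltW; near: y; exact: lt_nbhsl.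
Unshelve. all: by end_near. Qed.

Lemma flat_exp_is_derive0 (p : {poly R}) :
  is_derive (0 : R) 1 (flat_exp p) (flat_exp (dflat p) 0).
Proof.
rewrite {2}/flat_exp ltxx.
(* The difference quotient at 0 is [flat_exp (p * 'X)], the division by h being absorbed in the
   polynomial. *)
have [K K0 HK] := flat_exp_le_linear (p * 'X).
have q0 : (fun h : R => h^-1 *: ((flat_exp p \o shift 0) (h *: 1) - flat_exp p 0))
    @ 0^' --> 0.
  apply/cvgr0Pnorm_le => e e0; near=> h.
  have h0 : h != 0 by near: h; exact: nbhs_dnbhs_neq.
  rewrite /= addr0 [h%:A]mulr1 {2}/flat_exp ltxx subr0 /GRing.scale/=.
  case: (ltP 0 h) => [hp|hn]; last first.
    by rewrite /flat_exp ltNge hn mulr0 normr0 ltW.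
  have -> : h^-1 * flat_exp p h = flat_exp (p * 'X) h.
    by rewrite /flat_exp hp hornerMX; ring.
  apply: le_trans (HK _ hp) _.
  have : `|h| < e / (K + 1).
    near: h; apply: dnbhs0_lt; apply: divr_gt0 => //; lra.
  rewrite gtr0_norm// ltr_pdivlMr; last lra.
  by move=> h1; nra.
apply: DeriveDef; first by apply/cvg_ex; exists 0.
exact: cvg_lim q0.
Unshelve. all: by end_near. Qed.

Lemma flat_exp_is_derive (p : {poly R}) (x : R) :
  is_derive x 1 (flat_exp p) (flat_exp (dflat p) x).
Proof.
case: (ltgtP x 0) => [|| ->]; [exact: flat_exp_is_derive_neg |
  exact: flat_exp_is_derive_pos | exact: flat_exp_is_derive0].
Qed.

Lemma flat_exp_smooth (p : {poly R}) : line_smooth (flat_exp p).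
Proof.
move=> n; elim: n p => [|n IH] p.
  by apply: derivable_line_continuous => x; case: (flat_exp_is_derive p x).
split; first by move=> x; case: (flat_exp_is_derive p x).
by rewrite (derive1_is (flat_exp_is_derive p)).
Qed.

Definition expbump (a b t : R) : R := flat_exp 1 (t - a) * flat_exp 1 (b - t).

Lemma expbump_smooth (a b : R) : line_smooth (expbump a b).
Proof.
have -> : expbump a b =
    (fun t => flat_exp 1 (1 * t + - a) * flat_exp 1 ((-1) * t + b)).
  by apply/funext => t; rewrite /expbump; congr (flat_exp _ _ * flat_exp _ _); ring.
by apply: line_smoothM; apply: line_smooth_affine; exact: flat_exp_smooth.
Qed.

Lemma flat_exp1_ge0 (x : R) : 0 <= flat_exp 1 x.
Proof. by rewrite /flat_exp; case: ifP => // _; rewrite hornerC mul1r expR_ge0. Qed.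

Lemma expbump_ge0 (a b t : R) : 0 <= expbump a b t.
Proof. by apply: mulr_ge0; exact: flat_exp1_ge0. Qed.

Lemma expbump_gt0 (a b t : R) : a < t < b -> 0 < expbump a b t.
Proof.
move=> /andP[at_ tb]; rewrite /expbump /flat_exp !subr_gt0 at_ tb.
by rewrite !hornerC !mul1r mulr_gt0 ?expR_gt0.
Qed.

Lemma expbump_out (a b t : R) : ~~ (a < t < b) -> expbump a b t = 0.
Proof.
rewrite negb_and -!leNgt /expbump /flat_exp !subr_gt0 => /orP[h|h].
  by rewrite ltNge h mul0r.
by rewrite [t < b]ltNge h mulr0.
Qed.

End FlatExponentialSmooth.

(** * Smooth functions of two variables *)

Section SmoothPlane.
Context {R : realType}.
Implicit Types f g : R * R -> R.

Fixpoint Cplane (n : nat) f : Prop :=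
  continuous f /\
  if n is n'.+1 then
    forall i, (forall x, derivable f x (dir i)) /\ Cplane n' (partial i f)
  else True.

(** [foldr] differentiates first in the last index of the list, while [Cplane] starts from [f]; so
    the lists are peeled off at their right end. *)
Lemma smoothP f : smooth f <-> forall n, Cplane n f.
Proof.
split=> [sf n|Cf l].
  have : smooth f by [].
  elim: n f {sf} => [|n IH] f sf; first by split=> //; case: (sf [::]).
  split; first by case: (sf [::]).
  move=> i; split; first by move=> x; case: (sf [::]) => _; apply.
  by apply: IH => l; have := sf (rcons l i); rewrite -cats1 foldr_cat.
have : forall n, Cplane n f by [].
elim/last_ind: l f {Cf} => [|l i IH] f Cf /=.
  split; first by case: (Cf 0%N).
  by move=> i x; case: (Cf 1%N) => _ /(_ i)[].
rewrite -cats1 foldr_cat /=; apply: IH => n.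
by case: (Cf n.+1) => _ /(_ i)[].
Qed.

Lemma smooth_continuous f : smooth f -> continuous f.
Proof. by move=> /(_ [::])[]. Qed.

Lemma smooth_derivable f i x : smooth f -> derivable f x (dir i).
Proof. by move=> /(_ [::])[_]; apply. Qed.

Lemma smooth_is_derive f i x : smooth f -> is_derive x (dir i) f (partial i f x).
Proof. by move=> sf; apply/derivableP; exact: smooth_derivable. Qed.

Lemma smooth_partial f i : smooth f -> smooth (partial i f).
Proof. by move=> sf l; have := sf (rcons l i); rewrite -cats1 foldr_cat. Qed.

Lemma partial_is i f g : (forall x, is_derive x (dir i) f (g x)) -> partial i f = g.
Proof. by move=> h; apply/funext => x; exact: partialE. Qed.

Lemma Cplane_le n f : Cplane n.+1 f -> Cplane n f.
Proof.
elim: n f => [|n IH] f; first by case.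
by case=> cf h; split=> // i; case: (h i) => df /IH.
Qed.

Lemma CplaneD n f g : Cplane n f -> Cplane n g -> Cplane n (f \+ g).
Proof.
elim: n f g => [|n IH] f g [cf hf] [cg hg].
  by split=> // x; apply: cvgD; [exact: cf|exact: cg].
split; first by move=> x; apply: cvgD; [exact: cf|exact: cg].
move=> i; have [df cdf] := hf i; have [dg cdg] := hg i.
have D x : is_derive x (dir i) (f \+ g) ((partial i f \+ partial i g) x).
  by apply: is_deriveD; exact/derivableP.
by split; [move=> x; case: (D x)|rewrite (partial_is D); exact: IH].
Qed.

Lemma CplaneM n f g : Cplane n f -> Cplane n g -> Cplane n (fun x => f x * g x).
Proof.
elim: n f g => [|n IH] f g hf hg; have := hf; have := hg => - [cg dg] [cf df].
  by split=> // x; apply: cvgM; [exact: cf|exact: cg].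
split; first by move=> x; apply: cvgM; [exact: cf|exact: cg].
move=> i; have [dfi cdf] := df i; have [dgi cdg] := dg i.
have D x : is_derive x (dir i) (fun x => f x * g x)
    (((fun x => f x * partial i g x) \+ (fun x => g x * partial i f x)) x).
  by apply: is_deriveM; exact/derivableP.
split; first by move=> x; case: (D x).
by rewrite (partial_is D); apply: CplaneD; apply: IH => //; exact: Cplane_le.
Qed.

Lemma smoothM f g : smooth f -> smooth g -> smooth (fun x => f x * g x).
Proof. by move=> /smoothP sf /smoothP sg; apply/smoothP => n; apply: CplaneM. Qed.

Lemma Cplane_cst n (c : R) : Cplane n (fun=> c).
Proof.
elim: n c => [|n IH] c /=; first by split=> // x; exact: cvg_cst.
split; first by move=> x; exact: cvg_cst.
move=> i; split=> [x|]; first exact: derivable_cst.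
by rewrite (partial_is (g := fun=> 0)) // => x; exact: is_derive_cst.
Qed.

Lemma smooth_cst (c : R) : smooth (fun=> c).
Proof. by apply/smoothP => n; exact: Cplane_cst. Qed.

Definition affine_grad (al : 'I_2 -> R) (l : R * R -> R) :=
  exists c, forall x, l x = al ord0 * x.1 + al ord_max * x.2 + c.

Lemma affine_grad_continuous al l : affine_grad al l -> continuous l.
Proof.
move=> [c lE]; have -> : l = fun x => al ord0 * x.1 + al ord_max * x.2 + c.
  exact/funext.
move=> x; apply: cvgD; last exact: cvg_cst.
by apply: cvgD; apply: cvgM; try exact: cvg_cst; [exact: cvg_fst|exact: cvg_snd].
Qed.

Lemma affine_grad_dir al l i x h : affine_grad al l ->
  l (h *: dir i + x) = h * al i + l x.
Proof.
move=> [c lE]; rewrite !lE /dir /= /GRing.scale /=.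
case: eqVneq => [->|i0] /=; first by rewrite /GRing.scale/=; ring.
have -> : i = ord_max by apply/val_inj; case: i i0 => -[|[|]].
by rewrite /GRing.scale/=; ring.
Qed.

Lemma line_smooth_comp_is_derive al l (f : R -> R) i (x : R * R) :
  affine_grad al l -> line_smooth f ->
  is_derive x (dir i) (f \o l) (al i * (f^`()%classic (l x))).
Proof.
move=> ll sf; apply: is_derive_comp_affine.
  by move=> h; exact: affine_grad_dir.
exact: line_smooth_is_derive.
Qed.

Lemma smooth_comp_affine al l (f : R -> R) :
  affine_grad al l -> line_smooth f -> smooth (f \o l).
Proof.
move=> ll; move=> sf; apply/smoothP => n; elim: n f sf => [|n IH] f sf.
  split=> // x; apply: continuous_comp; last exact: line_smooth_continuous.
  exact: affine_grad_continuous ll x.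
split; first move=> x.
  apply: continuous_comp; last exact: line_smooth_continuous.
  exact: affine_grad_continuous ll x.
move=> i; split=> [x|]; first by case: (line_smooth_comp_is_derive i x ll sf).
rewrite (partial_is (fun x => line_smooth_comp_is_derive i x ll sf)).
apply: CplaneM; first exact: Cplane_cst.
exact/IH/line_smooth_derive.
Qed.

End SmoothPlane.

(** * Moments on the line and on half lines *)

Lemma bounded_integrable {d} {T : measurableType d} {R : realType}
    (mu : {measure set T -> \bar R}) (A : set T) (f : T -> R) (K : R) :
  measurable A -> (mu A < +oo)%E -> measurable_fun setT f ->
  (forall x, A x -> `|f x| <= K) -> (forall x, ~ A x -> f x = 0) ->
  mu.-integrable setT (EFin \o f).
Proof.
move=> mA muA mf fK f0.
have -> : EFin \o f = (EFin \o f) \_ A.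
  apply/funext => x; rewrite patchE; case: ifPn => // /negP xA /=.
  by rewrite f0// => Ax; apply: xA; exact/mem_set.
apply: (integrable_mkcond _ mA).1; apply: (measurable_bounded_integrable mA muA).
  exact: measurable_funTS.
exists K; split; first exact: num_real.
by move=> x Kx y Ay; exact: le_trans (fK y Ay) (ltW Kx).
Qed.

Section LineIntegrals.
Context {R : realType}.
Implicit Types (f g : R -> R).
Local Notation leb := (@lebesgue_measure R).

Lemma measurable_affine (a b : R) :
  measurable_fun [set: R] (fun t : R => a * t + b).
Proof.
apply: continuous_measurable_fun => t.
by apply: cvgD; [apply: cvgM; [exact: cvg_cst|exact: cvg_id]|exact: cvg_cst].
Qed.

(** The image of Lebesgue measure under t -> a t + b, multiplied by a, gives every interval its
    length; by uniqueness it is Lebesgue measure. *)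
Lemma ge0_integral_affine (a b : R) (f : R -> \bar R) : 0 < a ->
  measurable_fun setT f -> (forall t, 0 <= f t)%E ->
  (\int[leb]_t f t = a%:E * \int[leb]_t f (a * t + b)%R)%E.
Proof.
move=> a0 mf f0.
pose phi : measurableTypeR R -> measurableTypeR R := fun t => a * t + b.
have mphi : measurable_fun [set: measurableTypeR R] phi.
  exact: (measurable_affine a b).
pose k : {nonneg R} := NngNum (ltW a0).
pose m0 := mscale k (pushforward (leb : {measure set (measurableTypeR R) -> \bar R}) phi).
pose m := m0 mphi.
have lm A : measurable A -> leb A = m A.
  apply: lebesgue_measure_unique => X [[x y] /= _ <-].
  rewrite /m /m0 /mscale/= /pushforward.
  have -> : (fun t : R => phi t) @^-1` `]x, y] = `](x - b) / a, (y - b) / a]%classic.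
    apply/seteqP; split => t /=; rewrite !in_itv /= /phi.
      rewrite ltr_pdivrMr// ler_pdivlMr// => /andP[h1 h2]; apply/andP; split; lra.
    rewrite ltr_pdivrMr// ler_pdivlMr// => /andP[h1 h2]; apply/andP; split; lra.
  rewrite !lebesgue_measure_itv /= !lte_fin ltr_pM2r ?invr_gt0// ltrD2r.
  case: ifP => _; last by rewrite mule0.
  by rewrite -!EFinD -EFinM; congr EFin; field; rewrite gt_eqF.
rewrite (@eq_measure_integral _ _ _ setT m leb f); last by move=> A mA _; exact: lm.
rewrite /m /m0 ge0_integral_mscale//=.
by rewrite ge0_integral_pushforward.
Qed.

Lemma integrable_affine (a b : R) f : 0 < a ->
  leb.-integrable setT (EFin \o f) ->
  leb.-integrable setT (EFin \o (fun t => f (a * t + b))).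
Proof.
move=> a0 /integrableP[mf fi]; apply/integrableP; split.
  by apply: (measurableT_comp mf); exact: measurable_affine.
have := @ge0_integral_affine a b (fun t => `|(f t)%:E|%E) a0.
move=> /(_ _ _) h; rewrite h in fi; last 2 first.
- exact: measurableT_comp.
- by move=> t; exact: abse_ge0.
have : (a^-1%:E * (a%:E * \int[leb]_x `|(f (a * x + b)%R)%:E|) < +oo)%E.
  by rewrite lte_mul_pinfty// ?lee_fin ?invr_ge0 ?ltW// fin_numE.
by rewrite muleA -EFinM mulVf ?gt_eqF// mul1e.
Qed.

Lemma Rintegral_affine (a b : R) f : 0 < a ->
  leb.-integrable setT (EFin \o f) ->
  \int[leb]_t f (a * t + b) = a^-1 * \int[leb]_t f t.
Proof.
move=> a0 fi.
have fi' := integrable_affine b a0 fi.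
have mf : measurable_fun setT (EFin \o f) by case/integrableP: fi.
rewrite /Rintegral [in LHS]integralE [in RHS]integralE.
have hp : (\int[leb]_t ((EFin \o f)^\+ t) = a%:E * \int[leb]_t ((EFin \o (fun t => f (a * t + b)%R))^\+ t))%E.
  rewrite (@ge0_integral_affine a b)//; last exact: measurable_funepos.
  by congr (_ * _)%E; apply: eq_integral => t _; rewrite !funeposE.
have hn : (\int[leb]_t ((EFin \o f)^\- t) = a%:E * \int[leb]_t ((EFin \o (fun t => f (a * t + b)%R))^\- t))%E.
  rewrite (@ge0_integral_affine a b)//; last exact: measurable_funeneg.
  by congr (_ * _)%E; apply: eq_integral => t _; rewrite !funenegE.
have -> : (EFin \o f)^\+%E = ((fun t => (f t)%:E)^\+)%E by [].
rewrite hp hn -muleBr//; last first.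
  apply: fin_num_adde_defr; exact: (integrable_pos_fin_num measurableT fi').
rewrite fineM//; last first.
  rewrite fin_numB; apply/andP; split.
    exact: (integrable_pos_fin_num measurableT fi').
  exact: (integrable_neg_fin_num measurableT fi').
by rewrite mulrA mulVf ?gt_eqF// mul1r.
Qed.

End LineIntegrals.

Section HasIntegral.
Context {d} {T : measurableType d} {R : realType} (mu : {measure set T -> \bar R}).
Implicit Types (f g : T -> R).

(** [Rintegral] has a value for any function; carrying integrability along with the value makes
    linear combinations computable without side conditions. *)
Definition has_int f (v : R) :=
  mu.-integrable setT (EFin \o f) /\ \int[mu]_x f x = v.

Lemma has_int_eq f g v w : f =1 g -> v = w -> has_int f v -> has_int g w.
Proof. by move=> fg <- [fi fv]; have <- : f = g by exact/funext. Qed.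

Lemma has_intD f g v w : has_int f v -> has_int g w -> has_int (f \+ g) (v + w).
Proof.
move=> [fi <-] [gi <-]; split; last by rewrite RintegralD.
by apply: (@eq_integrable _ _ _ mu setT measurableT _) (integrableD measurableT fi gi) => x _.
Qed.

Lemma has_intZ f v (c : R) : has_int f v -> has_int (fun x => c * f x) (c * v).
Proof.
move=> [fi <-]; split; last by rewrite RintegralZl.
by apply: (@eq_integrable _ _ _ mu setT measurableT _) (integrableZl measurableT c fi) => x _.
Qed.

Lemma has_intN f v : has_int f v -> has_int (fun x => - f x) (- v).
Proof. by move=> /(has_intZ (-1)); apply: has_int_eq => [x|]; rewrite mulN1r. Qed.

Lemma has_intB f g v w : has_int f v -> has_int g w -> has_int (f \- g) (v - w).
Proof. by move=> fv /has_intN gw; exact: has_intD fv gw. Qed.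

Lemma has_intE f v : has_int f v -> (\int[mu]_x (f x)%:E = v%:E)%E.
Proof.
by move=> [fi <-]; rewrite /Rintegral fineK//; exact: (integrable_fin_num measurableT fi).
Qed.

Lemma integrable_has_int f :
  mu.-integrable setT (EFin \o f) -> has_int f (\int[mu]_x f x).
Proof. by []. Qed.

End HasIntegral.

Section LineMoments.
Context {R : realType}.
Implicit Types (f g : R -> R).
Local Notation leb := (@lebesgue_measure R).

(** Just enough for moments to exist: unlike [line_test], this class is stable under restriction to
    a half line. *)
Definition boxfun f :=
  [/\ measurable_fun setT f, exists K, forall t, `|f t| <= K &
      forall t, 1 < `|t| -> f t = 0].

(** The origin belongs to the half line [true] only, so that the two restrictions add up to [f]
    everywhere. *)
Definition halfline (b : bool) f (t : R) : R := if (0 <= t) == b then f t else 0.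

Definition moment (k : nat) f : R := \int[leb]_t (t ^+ k * f t).

Definition line_test f := line_smooth f /\ forall t, 1 < `|t| -> f t = 0.

Lemma itv11P (t : R) : ~~ (1 < `|t|) = (t \in `[-1, 1]).
Proof. by rewrite -leNgt ler_norml in_itv. Qed.

Lemma boxfun_integrable f : boxfun f -> leb.-integrable setT (EFin \o f).
Proof.
move=> [mf [K fK] f0].
apply: (@bounded_integrable _ _ _ leb `[-1, 1]%classic f K) => //.
  by rewrite /= lebesgue_measure_itv /= lte_fin; case: ifP => _; rewrite ltry.
by move=> t /= /negP; rewrite -itv11P negbK; exact: f0.
Qed.

Lemma boxfun_expM k f : boxfun f -> boxfun (fun t => t ^+ k * f t).
Proof.
move=> [mf [K fK] f0]; split.
- by apply: measurable_funM => //; exact: measurable_funX.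
- exists K => t; case: (ltP 1 `|t|) => t1; first by rewrite f0// mulr0 normr0 (le_trans _ (fK t)).
  by rewrite normrM normrX -[leRHS]mul1r ler_pM// exprn_ile1.
- by move=> t t1; rewrite f0// mulr0.
Qed.

Lemma moment_has_int k f : boxfun f -> has_int leb (fun t => t ^+ k * f t) (moment k f).
Proof. by move=> bf; apply: integrable_has_int; apply: boxfun_integrable; exact: boxfun_expM. Qed.

Lemma boxfun_half b f : boxfun f -> boxfun (halfline b f).
Proof.
move=> [mf [K fK] f0]; split.
- apply: measurable_fun_ifT => //.
  case: b.
    rewrite (_ : (fun t : R => _) = (fun t => 0 <= t)); last by apply/funext => t; case: (0 <= t).
    by apply: measurable_fun_ler => //; exact: measurable_cst.
  rewrite (_ : (fun t : R => _) = (fun t => t < 0)); last by apply/funext => t; rewrite ltNge; case: (0 <= t).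
  by apply: measurable_fun_ltr => //; exact: measurable_cst.
- by exists K => t; rewrite /halfline; case: ifP => // _; rewrite normr0 (le_trans _ (fK t)).
- by move=> t t1; rewrite /halfline f0// if_same.
Qed.

Lemma line_test_boxfun f : line_test f -> boxfun f.
Proof.
move=> [sf f0]; have cf := line_smooth_continuous sf; split=> //.
- exact: continuous_measurable_fun.
- have cn : {within `[-1, 1], continuous (fun t => `|f t|)}.
    apply: continuous_subspaceT => t.
    by apply: continuous_comp; [exact: cf|exact: norm_continuous].
  have [|c _ hc] := @EVT_max R (fun t => `|f t|) (-1) 1 _ cn; first lra.
  exists `|f c| => t; case: (boolP (1 < `|t|)) => [t1|]; first by rewrite f0// normr0.
  by rewrite itv11P; exact: hc.
Qed.

Lemma line_test_derive f : line_test f -> line_test (f^`()%classic).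
Proof.
move=> [sf f0]; split; first exact: line_smooth_derive.
move=> t t1; rewrite derive1E.
have -> : 'D_1 f t = 'D_1 (cst (0:R)) t.
  have := @norm_continuous _ R t; move/cvgr_gt => /(_ _ t1) h.
  by apply: near_eq_derive; apply: filterS h => u; exact: f0.
by rewrite derive_cst.
Qed.

Lemma line_testD f g : line_test f -> line_test g -> line_test (f \+ g).
Proof.
move=> [sf f0] [sg g0]; split; first exact: line_smoothD.
by move=> t t1; rewrite /= f0// g0// addr0.
Qed.

Lemma line_testZ f (c : R) : line_test f -> line_test (fun t => c * f t).
Proof.
move=> [sf f0]; split; first by apply: line_smoothM => //; exact: line_smooth_cst.
by move=> t t1; rewrite f0// mulr0.
Qed.

Lemma line_test_dilate f (a : R) : 1 <= a -> line_test f -> line_test (fun t => f (a * t)).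
Proof.
move=> a1 [sf f0]; split.
  have -> : (fun t => f (a * t)) = (fun t => f (a * t + 0)) by apply/funext => t; rewrite addr0.
  exact: line_smooth_affine.
move=> t t1; apply: f0; rewrite normrM (ger0_norm (le_trans ler01 a1)).
by apply: (lt_le_trans t1); rewrite ler_peMl.
Qed.

Lemma line_test_exp f : line_test f -> line_test (fun t => t * f t).
Proof.
move=> [sf f0]; split; last by move=> t t1; rewrite f0// mulr0.
apply: line_smoothM => //.
move=> [|n]; first by move=> t; exact: cvg_id.
split; first by move=> t; exact: derivable_id.
have -> : (id : R -> R)^`()%classic = fun=> 1 by apply: derive1_is => t; exact: is_derive_id.
exact: Cline_cst.
Qed.

Lemma FTC_line f (a b : R) : a < b -> line_smooth f ->
  \int[leb]_(t in `[a, b]) f^`()%classic t = f b - f a.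
Proof.
move=> ab sf; have cf := line_smooth_continuous sf.
rewrite /Rintegral (@continuous_FTC2 _ _ f)//.
- by apply: continuous_subspaceT; exact/line_smooth_continuous/line_smooth_derive.
- split=> [x _||]; [exact: line_smooth_derivable|..].
  + exact: cvg_at_right_filter (cf a).
  + exact: cvg_at_left_filter (cf b).
Qed.

Lemma half_derive b f : line_test f ->
  has_int leb (halfline b f^`()%classic) (if b then - f 0 else f 0).
Proof.
move=> tf; have td := line_test_derive tf.
have [mf _ _] := line_test_boxfun td.
split; first by apply: boxfun_integrable; apply: boxfun_half; exact: line_test_boxfun.
case: (tf) (td) => sf f0 [sd d0].
case: b.
  (* A [line_test] function is known to vanish only beyond 1; the endpoint 2 lies outside its
     support and contributes nothing. *)
  have -> : halfline true f^`()%classic = f^`()%classic \_ `[0, 2].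
    apply/funext => t; rewrite patchE /halfline mem_setE in_itv /= eqb_id.
    case: (leP 0 t) => //= t0; case: (leP t 2) => // t2.
    by apply: d0; rewrite gtr0_norm; lra.
  rewrite -Rintegral_mkcond FTC_line//.
  have -> : f 2 = 0 by apply: f0; rewrite gtr0_norm; lra.
  by rewrite sub0r.
have -> : halfline false f^`()%classic = f^`()%classic \_ `[-2, 0[.
  apply/funext => t; rewrite patchE /halfline mem_setE in_itv /= eqbF_neg -ltNge.
  case: (ltP t 0) => t0; rewrite ?andbF// andbT; case: (leP (-2) t) => // t2.
  by apply: d0; rewrite ltr0_norm; lra.
rewrite -Rintegral_mkcond Rintegral_itv_bndo_bndc//; last first.
  apply: (integrableS measurableT) => //.
  by apply: boxfun_integrable; exact: line_test_boxfun.
rewrite FTC_line//.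
have -> : f (-2) = 0 by apply: f0; rewrite ltr0_norm; lra.
by rewrite subr0.
Qed.

End LineMoments.

Section MomentCalculus.
Context {R : realType}.
Implicit Types (f g : R -> R).
Local Notation leb := (@lebesgue_measure R).

Lemma line_test_expM k f : line_test f -> line_test (fun t => t ^+ k * f t).
Proof.
move=> tf; elim: k => [|k /line_test_exp].
  by have -> : (fun t => t ^+ 0 * f t) = f by apply/funext => t; rewrite expr0 mul1r.
by have -> : (fun t => t * (t ^+ k * f t)) = (fun t => t ^+ k.+1 * f t)
  by apply/funext => t; rewrite exprS mulrA.
Qed.

Lemma moment0_half_derive b f : line_test f ->
  moment 0 (halfline b f^`()%classic) = if b then - f 0 else f 0.
Proof.
move=> /(half_derive b)[_ <-]; rewrite /moment; apply: eq_Rintegral => t _.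
by rewrite expr0 mul1r.
Qed.

(** Integration by parts: [half_derive] is applied to t^(k+1) f, whose value at 0 vanishes. Hence
    among the half-line moments of f' only the one of order 0 has a boundary term. *)
Lemma momentS_half_derive k b f : line_test f ->
  moment k.+1 (halfline b f^`()%classic) = - (k.+1%:R * moment k (halfline b f)).
Proof.
move=> tf; have td := line_test_derive tf; have tk := line_test_expM k.+1 tf.
have D : (fun t => t ^+ k.+1 * f t)^`()%classic =
    (fun t => k.+1%:R * (t ^+ k * f t) + t ^+ k.+1 * f^`()%classic t).
  apply: derive1_is => t.
  have D1 : is_derive t 1 (fun t : R => t ^+ k.+1) (k.+1%:R * t ^+ k).
    apply: DeriveDef; first exact: exprn_derivable.
    by rewrite exp_derive /GRing.scale/= mulr1.
  have D2 := line_smooth_is_derive t tf.1.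
  have D3 : is_derive t 1 (fun t => t ^+ k.+1 * f t)
      (t ^+ k.+1 *: f^`()%classic t + f t *: (k.+1%:R * t ^+ k)) by exact: is_deriveM.
  by apply: (is_derive_eq D3); rewrite /GRing.scale/=; ring.
have [_] := half_derive b tk; rewrite D expr0n /= mul0r oppr0 if_same => H.
have h1 := has_intZ k.+1%:R (moment_has_int k (boxfun_half b (line_test_boxfun tf))).
have h2 := moment_has_int k.+1 (boxfun_half b (line_test_boxfun td)).
have [_ E] := has_intD h1 h2.
suff : k.+1%:R * moment k (halfline b f) + moment k.+1 (halfline b f^`()%classic) = 0.
  by move/eqP; rewrite addrC addr_eq0 => /eqP.
rewrite -{}E -[RHS]H; apply: eq_Rintegral => t _ /=.
by rewrite /halfline; case: ifP => // _; rewrite !mulr0 addr0.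
Qed.

Lemma moment_halves k f : boxfun f ->
  moment k f = moment k (halfline true f) + moment k (halfline false f).
Proof.
move=> bf; have h b := moment_has_int k (boxfun_half b bf).
have [_ <-] := has_intD (h true) (h false).
apply: eq_Rintegral => t _; rewrite /= /halfline.
by case: (0 <= t); rewrite /= ?mulr0 ?addr0 ?add0r.
Qed.

Lemma moment0_derive f : line_test f -> moment 0 f^`()%classic = 0.
Proof.
move=> tf; have bd := line_test_boxfun (line_test_derive tf).
by rewrite (moment_halves _ bd) !moment0_half_derive// addNr.
Qed.

Lemma momentS_derive k f : line_test f ->
  moment k.+1 f^`()%classic = - (k.+1%:R * moment k f).
Proof.
move=> tf; have bd := line_test_boxfun (line_test_derive tf).
rewrite (moment_halves _ bd) !momentS_half_derive// (moment_halves k (line_test_boxfun tf)).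
by ring.
Qed.

Lemma boxfun_dilate (a : R) f : 1 <= a -> boxfun f -> boxfun (fun t => f (a * t)).
Proof.
move=> a1 [mf [K fK] f0]; split.
- have -> : (fun t => f (a * t)) = f \o (fun t => a * t + 0).
    by apply/funext => t /=; rewrite addr0.
  by apply: (measurableT_comp mf); exact: measurable_affine.
- by exists K => t; exact: fK.
- move=> t t1; apply: f0; rewrite normrM (ger0_norm (le_trans ler01 a1)).
  by apply: (lt_le_trans t1); rewrite ler_peMl.
Qed.

Lemma moment_dilate k (a : R) f : 1 <= a -> boxfun f ->
  moment k (fun t => f (a * t)) = (a^-1) ^+ k.+1 * moment k f.
Proof.
move=> a1 bf; have a0 : 0 < a by lra.
have [i <-] := moment_has_int k bf.
have := Rintegral_affine 0 a0 i.
rewrite exprSr -mulrA => <-.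
have e t : (a * t + 0) ^+ k * f (a * t + 0) = a ^+ k * (t ^+ k * f (a * t)).
  by rewrite addr0 exprMn mulrA.
under eq_Rintegral do rewrite e.
have [_ ->] := has_intZ (a ^+ k) (moment_has_int k (boxfun_dilate a1 bf)).
by rewrite mulrA -exprMn mulVf ?gt_eqF// expr1n mul1r.
Qed.

(* A combination of dilations by powers of two; its [k]-th moment is that of
   [f] times the polynomial with coefficients [c] evaluated at [2 ^- k.+1]. *)
Definition dyadic (c : R * R * R * R) f (t : R) : R :=
  let: (c0, c1, c2, c3) := c in
  c0 * f t + c1 * f (2 * t) + c2 * f (4 * t) + c3 * f (8 * t).

(** Dilations by positive factors preserve both half lines, so a single choice of coefficients can
    serve on the two of them. *)
Lemma half_dyadic b c f : halfline b (dyadic c f) = dyadic c (halfline b f).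
Proof.
apply/funext => t; case: c => -[[c0 c1] c2] c3; rewrite /halfline /dyadic.
by rewrite !pmulr_rge0 //; case: ifP => // _; rewrite !mulr0 !addr0.
Qed.

Lemma dyadic_line_test c f : line_test f -> line_test (dyadic c f).
Proof.
case: c => -[[c0 c1] c2] c3 tf; rewrite /dyadic.
apply: line_testD; last by apply/line_testZ/line_test_dilate => //; lra.
apply: line_testD; last by apply/line_testZ/line_test_dilate => //; lra.
apply: line_testD; last by apply/line_testZ/line_test_dilate => //; lra.
exact: line_testZ.
Qed.

Lemma moment_dyadic k c0 c1 c2 c3 f : boxfun f ->
  moment k (dyadic (c0, c1, c2, c3) f) =
  (let x := (2^-1) ^+ k.+1 in c0 + c1 * x + c2 * x ^+ 2 + c3 * x ^+ 3) * moment k f.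
Proof.
move=> bf.
have h0 := has_intZ c0 (moment_has_int k bf).
have h (a : R) c (a1 : 1 <= a) := has_intZ c (moment_has_int k (boxfun_dilate a1 bf)).
have a2 : (1 : R) <= 2 by lra.
have a4 : (1 : R) <= 4 by lra.
have a8 : (1 : R) <= 8 by lra.
have [_] := has_intD (has_intD (has_intD h0 (h 2 c1 a2)) (h 4 c2 a4)) (h 8 c3 a8).
rewrite !moment_dilate// => e; transitivity (c0 * moment k f
    + c1 * (2^-1 ^+ k.+1 * moment k f) + c2 * (4^-1 ^+ k.+1 * moment k f)
    + c3 * (8^-1 ^+ k.+1 * moment k f)).
  by rewrite -e; apply: eq_Rintegral => t _ /=; ring.
rewrite /= -!exprM ![(k.+1 * _)%N]mulnC !exprM.
have -> : (4^-1 : R) = 2^-1 ^+ 2 by field.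
have -> : (8^-1 : R) = 2^-1 ^+ 3 by field.
by ring.
Qed.

Lemma expbump_line_test (a b : R) : -1 <= a -> b <= 1 -> line_test (expbump a b).
Proof.
move=> a1 b1; split; first exact: expbump_smooth.
move=> t t1; apply: expbump_out; apply/negP => /andP[h1 h2].
by move: t1; rewrite ltNge ler_norml => /negP; apply; apply/andP; split; lra.
Qed.

Lemma moment_expbump_gt0 k : 0 < moment k (expbump (0 : R) 1).
Proof.
(* On [1/4, 3/4] the factor t^k is at least 4^-k, and both 1/t and 1/(1-t) are at most 4. *)
pose m : R := (4^-1) ^+ k * (expR (- 4) * expR (- 4)).
have m0 : 0 < m by rewrite /m !mulr_gt0 ?expR_gt0 ?exprn_gt0.
have bb : boxfun (expbump (0 : R) 1) by apply: line_test_boxfun; apply: expbump_line_test; lra.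
have hI : has_int leb (fun t => m * \1_(`[4^-1, 3 / 4]) t) (m * 2^-1).
  apply: has_intZ; split; first exact: integrable_indic_itv.
  rewrite /Rintegral integral_indic// setIT /= lebesgue_measure_itv /= lte_fin.
  rewrite ifT /=; last by lra.
  by field.
have [i1 e1] := hI; have [i2 e2] := moment_has_int k bb.
apply: (@lt_le_trans _ _ (m * 2^-1)); first by rewrite mulr_gt0.
rewrite -e1 -e2; apply: le_Rintegral => // t _.
rewrite indicE mem_setE in_itv /=.
case: (boolP (_ <= t <= _)) => [/andP[t1 t2]|_].
  rewrite mulr1 /m; apply: ler_pM.
  - by rewrite exprn_ge0.
  - by rewrite mulr_ge0 ?expR_ge0.
  - rewrite lerXn2r// ?nnegrE; lra.
  rewrite /expbump /flat_exp subr0.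
  have -> : 0 < t by lra.
  have -> : 0 < 1 - t by lra.
  rewrite !hornerC !mul1r; apply: ler_pM; rewrite ?expR_ge0// ler_expR lerN2.
    by rewrite -[leRHS]invrK lef_pV2 ?posrE; lra.
  by rewrite -[leRHS]invrK lef_pV2 ?posrE; lra.
rewrite mulr0; case: (leP t 0) => t0.
  by rewrite expbump_out ?mulr0// negb_and -leNgt t0.
by rewrite mulr_ge0 ?expbump_ge0// exprn_ge0// ltW.
Qed.

(** The coefficients are those of the Lagrange polynomials at the nodes 1/2, 1/4, 1/8, divided by a
    moment of the bump. The bump lives on [0, 1] so that its odd moments are positive too. *)
Lemma dual_functions : exists psi : nat -> R -> R, forall l, (l <= 2)%N ->
  line_test (psi l) /\ forall k, (k <= 2)%N -> moment k (psi l) = (k == l)%:R.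
Proof.
pose eta := expbump (0 : R) 1.
have te : line_test eta by apply: expbump_line_test; lra.
have be := line_test_boxfun te.
pose mu k := moment k eta.
have mu0 k : mu k != 0 by rewrite gt_eqF// moment_expbump_gt0.
exists (fun l => match l with
  | 0%N => dyadic (3^-1 / mu 0%N, - 4 / mu 0%N, 32 / 3 / mu 0%N, 0) eta
  | 1%N => dyadic (- 2 / mu 1%N, 20 / mu 1%N, - 32 / mu 1%N, 0) eta
  | _ => dyadic (8 / 3 / mu 2%N, - 16 / mu 2%N, 64 / 3 / mu 2%N, 0) eta
  end).
move=> [|[|[|//]]] _; split; try exact: dyadic_line_test;
  move=> [|[|[|//]]] _; rewrite moment_dyadic//= -/(mu _) ?mulr0n ?mulr1n;
  field; rewrite ?mu0//.
Qed.

(* The coefficients solve the linear system given by [moment_dyadic]: with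
   [x = 2 ^- k.+1], the polynomial vanishes at [x = 1/2, 1/4, 1/8]. *)
Lemma cutoff_function : exists chi : R -> R, [/\ line_test chi, chi 0 = 1 &
  forall b k, (k <= 2)%N -> moment k (halfline b chi) = 0].
Proof.
pose eta := expbump (-1 : R) 1.
have te : line_test eta by apply: expbump_line_test; lra.
have e0 : eta 0 != 0 by rewrite gt_eqF// expbump_gt0//; apply/andP; split; lra.
(* At 0 all the dilations take the value [eta 0], so [chi 0 = 1] says that the polynomial is 1 at x
   = 1. With the three zeros this makes four conditions, whence a cubic. *)
exists (dyadic (- (3 * 7)^-1 / eta 0, 2 / 3 / eta 0, - 8 / 3 / eta 0, 64 / 21 / eta 0) eta).
split; first exact: dyadic_line_test.
  by rewrite /dyadic !mulr0; field.
move=> b k k2; have bh := boxfun_half b (line_test_boxfun te).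
rewrite half_dyadic moment_dyadic//=.
by case: k k2 => [|[|[|//]]] _; rewrite [X in X * _](_ : _ = 0) ?mul0r//; field.
Qed.

End MomentCalculus.

(** * Tensor products in affine frames *)

Section Frames.
Context {R : realType}.
Variables (b : bool) (s : R) (M : R * R) (r : R).
Implicit Types (g k : R -> R) (c : nat -> R) (x : R * R).

(* [ta] vanishes on the line through [M] whose slope with respect to the axis of
   [xi] is [s]; choosing that axis by [b] allows one to assume [`|s| <= 1]. *)
Definition frame_xi x : R := (if b then x.1 - M.1 else x.2 - M.2) / r.
Definition frame_ta x : R :=
  (if b then x.2 - M.2 - s * (x.1 - M.1) else x.1 - M.1 - s * (x.2 - M.2)) / r.
Definition grad_xi (i : 'I_2) : R := (if (i == ord0) == b then 1 else 0) / r.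
Definition grad_ta (i : 'I_2) : R := (if (i == ord0) == b then - s else 1) / r.

Definition frame_tensor g k x : R := g (frame_xi x) * k (frame_ta x).

Lemma frame_xi_affine : affine_grad grad_xi frame_xi.
Proof.
rewrite /affine_grad /grad_xi /frame_xi /=; case: b.
  by exists (- M.1 / r) => x /=; ring.
by exists (- M.2 / r) => x /=; ring.
Qed.

Lemma frame_ta_affine : affine_grad grad_ta frame_ta.
Proof.
rewrite /affine_grad /grad_ta /frame_ta /=; case: b.
  by exists ((s * M.1 - M.2) / r) => x /=; ring.
by exists ((s * M.2 - M.1) / r) => x /=; ring.
Qed.

Lemma frame_tensor_smooth g k :
  line_smooth g -> line_smooth k -> smooth (frame_tensor g k).
Proof.
move=> sg sk.
apply: (@smoothM _ (g \o frame_xi) (k \o frame_ta)); apply: smooth_comp_affine => //.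
  exact: frame_xi_affine.
exact: frame_ta_affine.
Qed.

Lemma partial_frame_tensor i g k : line_smooth g -> line_smooth k ->
  partial i (frame_tensor g k) = fun x =>
    grad_xi i * frame_tensor g^`()%classic k x + grad_ta i * frame_tensor g k^`()%classic x.
Proof.
move=> sg sk; apply: partial_is => x.
have D1 := line_smooth_comp_is_derive i x frame_xi_affine sg.
have D2 := line_smooth_comp_is_derive i x frame_ta_affine sk.
have D : is_derive x (dir i) (frame_tensor g k) _ := is_deriveM D1 D2.
by apply: (is_derive_eq D); rewrite /frame_tensor /GRing.scale /=; ring.
Qed.

Definition quad c (u v : R) : R :=
  c 0%N + c 1%N * u + c 2%N * v + c 3%N * u ^+ 2 + c 4%N * (u * v) + c 5%N * v ^+ 2.

Definition frame_quad c x : R := quad c (frame_xi x) (frame_ta x).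

Definition quad_dxi c (n : nat) : R :=
  match n with 0%N => c 1%N | 1%N => 2 * c 3%N | 2%N => c 4%N | _ => 0 end.
Definition quad_dta c (n : nat) : R :=
  match n with 0%N => c 2%N | 1%N => c 4%N | 2%N => 2 * c 5%N | _ => 0 end.

Lemma affine_grad_is_derive al l i x :
  affine_grad al l -> is_derive x (dir i) l (al i : R).
Proof.
move=> ll; have -> : l = id \o l by [].
apply: (is_derive_eq (df := al i) (f' := al i * 1)); last by rewrite mulr1.
apply: is_derive_comp_affine.
by move=> h; exact: affine_grad_dir.
Qed.

Lemma partial_frame_quad i c :
  partial i (frame_quad c) = fun x =>
    grad_xi i * frame_quad (quad_dxi c) x + grad_ta i * frame_quad (quad_dta c) x.
Proof.
apply: partial_is => x.
pose Dx := affine_grad_is_derive i x frame_xi_affine.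
pose Dt := affine_grad_is_derive i x frame_ta_affine.
have D : is_derive x (dir i) (cst (c 0%N) + cst (c 1%N) * frame_xi + cst (c 2%N) * frame_ta
  + cst (c 3%N) * (frame_xi * frame_xi) + cst (c 4%N) * (frame_xi * frame_ta)
  + cst (c 5%N) * (frame_ta * frame_ta)) _ :=
  is_deriveD (is_deriveD (is_deriveD (is_deriveD (is_deriveD
   (is_derive_cst _ _ _) (is_deriveM (is_derive_cst _ _ _) Dx))
   (is_deriveM (is_derive_cst _ _ _) Dt))
   (is_deriveM (is_derive_cst _ _ _) (is_deriveM Dx Dx)))
   (is_deriveM (is_derive_cst _ _ _) (is_deriveM Dx Dt)))
   (is_deriveM (is_derive_cst _ _ _) (is_deriveM Dt Dt)).
have E : frame_quad c = cst (c 0%N) + cst (c 1%N) * frame_xi + cst (c 2%N) * frame_ta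
  + cst (c 3%N) * (frame_xi * frame_xi) + cst (c 4%N) * (frame_xi * frame_ta)
  + cst (c 5%N) * (frame_ta * frame_ta).
  by apply/funext => y; rewrite /frame_quad /quad !fctE /=; ring.
rewrite E; apply: (is_derive_eq D).
by rewrite /frame_quad /quad /GRing.scale /=; ring.
Qed.

End Frames.

HB.instance Definition _ (R : realType) := Measure.copy (@mu2 R)
  ((@lebesgue_measure R) \x (@lebesgue_measure R))%E.

Section FrameIntegrals.
Context {R : realType}.
Implicit Types (g k : R -> R) (c : nat -> R) (x : R * R).
Local Notation leb := (@lebesgue_measure R).
Local Notation mu2 := (@mu2 R).

Definition square (M : R * R) (a : R) : set (R * R) :=
  `[M.1 - a, M.1 + a] `*` `[M.2 - a, M.2 + a].

Lemma squareP M a x : square M a x <-> `|x.1 - M.1| <= a /\ `|x.2 - M.2| <= a.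
Proof.
rewrite /square /= !in_itv /= !ler_distl.
by split=> -[].
Qed.

Lemma measurable_square M a : measurable (square M a : set (plane R)).
Proof. by rewrite /square; apply: measurableX; exact: measurable_itv. Qed.

Lemma mu2_square M a : 0 <= a -> mu2 (square M a) = ((2 * a) ^+ 2)%:E.
Proof.
move=> a0; rewrite /mu2 /square.
rewrite product_measure1E//= !lebesgue_measure_itv /= !lte_fin.
case: ltP => h1; case: ltP => h2; rewrite ?mule0 ?mul0e -?EFinB -?EFinM;
  try by congr EFin; ring.
all: by (have -> : a = 0 by lra); rewrite mulr0 expr0n.
Qed.

Lemma measurable_frame_tensor b s M r g k :
  measurable_fun setT g -> measurable_fun setT k ->
  measurable_fun setT (frame_tensor b s M r g k).
Proof.
have aff (al : 'I_2 -> R) l : affine_grad al l -> measurable_fun [set: R * R] l.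
  move=> [c lE]; have -> : l = fun x => al ord0 * x.1 + al ord_max * x.2 + c by exact/funext.
  have m1 : measurable_fun [set: R * R] fst by exact: measurable_fst.
  have m2 : measurable_fun [set: R * R] snd by exact: measurable_snd.
  by apply: measurable_funD => //; apply: measurable_funD; exact: measurable_funM.
move=> mg mk; apply: measurable_funM.
  by apply: (measurableT_comp mg); exact: aff (frame_xi_affine _ _ _).
by apply: (measurableT_comp mk); exact: aff (frame_ta_affine _ _ _ _).
Qed.

(** If u and v are the offsets from M along the axis of xi and the other axis, |u| <= r and |v - s
    u| <= r give |v| <= 2 r as |s| <= 1: one square contains the support for every slope. *)
Lemma frame_tensor_support b s M r g k x : 0 < r -> `|s| <= 1 ->
  (forall t, 1 < `|t| -> g t = 0) -> (forall t, 1 < `|t| -> k t = 0) ->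
  ~ square M (2 * r) x -> frame_tensor b s M r g k x = 0.
Proof.
move=> r0 s1 g0 k0 nx; rewrite /frame_tensor.
case: (ltP 1 `|frame_xi b M r x|) => [h|hx]; first by rewrite g0// mul0r.
case: (ltP 1 `|frame_ta b s M r x|) => [h|ht]; first by rewrite (k0 _ h) mulr0.
exfalso; apply/nx/squareP; move: hx ht; rewrite /frame_xi /frame_ta.
rewrite !normrM !normfV (gtr0_norm r0) !ler_pdivrMr// !mul1r.
have key (u v : R) : `|u| <= r -> `|v - s * u| <= r -> `|u| <= 2 * r /\ `|v| <= 2 * r.
  move=> hu hv; split; first lra.
  have := ler_normD (v - s * u) (s * u); rewrite subrK normrM.
  have : `|s| * `|u| <= 1 * r by apply: ler_pM.
  lra.
by case: b => hx ht; have [] := key _ _ hx ht; split.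
Qed.

Lemma frame_tensor_integrable b s M r g k : 0 < r -> `|s| <= 1 ->
  boxfun g -> boxfun k -> mu2.-integrable setT (EFin \o frame_tensor b s M r g k).
Proof.
move=> r0 s1 [mg [K gK] g0] [mk [L kL] k0].
apply: (@bounded_integrable _ _ _ mu2 (square M (2 * r)) (frame_tensor b s M r g k) (K * L)).
- exact: measurable_square.
- by rewrite [X in (X < _)%E]mu2_square ?ltry// mulr_ge0// ltW.
- exact: measurable_frame_tensor.
- by move=> x _; rewrite normrM ler_pM.
- by move=> x; exact: frame_tensor_support.
Qed.

Lemma affine_boxfun_int (g : R -> R) (r a : R) : 0 < r -> boxfun g ->
  has_int leb (fun t => g (t / r + a)) (r * \int[leb]_t g t).
Proof.
move=> r0 bg; have ig := boxfun_integrable bg.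
have r0' : 0 < r^-1 by rewrite invr_gt0.
have -> : (fun t => g (t / r + a)) = (fun t => g (r^-1 * t + a)).
  by apply/funext => t; rewrite mulrC.
by split; [exact: integrable_affine|rewrite Rintegral_affine// invrK].
Qed.

(** Fubini with xi as outer variable, hence the two orders of integration according to [b]. For
    fixed xi the coordinate ta is a dilation by 1/r up to a shift, which the inner integral ignores;
    so the Jacobian r^2 does not depend on s. *)
Lemma frame_tensor_has_int b s M r g k : 0 < r -> `|s| <= 1 ->
  boxfun g -> boxfun k ->
  has_int mu2 (frame_tensor b s M r g k)
    (r ^+ 2 * ((\int[leb]_t g t) * \int[leb]_t k t)).
Proof.
move=> r0 s1 bg bk.
have ii := frame_tensor_integrable b M r0 s1 bg bk; split=> //.
suff H : (\int[mu2]_x (frame_tensor b s M r g k x)%:E =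
    (r ^+ 2 * ((\int[leb]_t g t) * \int[leb]_t k t))%:E)%E by rewrite /Rintegral H.
case: b ii => ii.
  rewrite -(integral12_prod_meas1 ii) /fubini_F /=.
  transitivity (\int[leb]_u ((r * \int[leb]_t k t) * g (u / r + (- M.1 / r)))%:E)%E.
    apply: eq_integral => u _.
    rewrite /frame_tensor /frame_xi /frame_ta /=.
    have := has_intE (has_intZ (g (u / r + (- M.1 / r))) (affine_boxfun_int (- (M.2 + s * (u - M.1)) / r) r0 bk)).
    rewrite [in X in _ = X -> _]mulrC => <-; apply: eq_integral => v _.
    by congr (_ * _)%:E; [congr g|congr k]; ring.
  rewrite (has_intE (has_intZ _ (affine_boxfun_int _ r0 bg))); congr EFin; ring.
rewrite -(integral21_prod_meas1 ii) /fubini_G /=.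
transitivity (\int[leb]_u ((r * \int[leb]_t k t) * g (u / r + (- M.2 / r)))%:E)%E.
  apply: eq_integral => u _.
  rewrite /frame_tensor /frame_xi /frame_ta /=.
  have := has_intE (has_intZ (g (u / r + (- M.2 / r))) (affine_boxfun_int (- (M.1 + s * (u - M.2)) / r) r0 bk)).
  rewrite [in X in _ = X -> _]mulrC => <-; apply: eq_integral => v _.
  by congr (_ * _)%:E; [congr g|congr k]; ring.
rewrite (has_intE (has_intZ _ (affine_boxfun_int _ r0 bg))); congr EFin; ring.
Qed.

Definition quad_moment c g k : R :=
  c 0%N * (moment 0 g * moment 0 k) + c 1%N * (moment 1 g * moment 0 k)
  + c 2%N * (moment 0 g * moment 1 k) + c 3%N * (moment 2 g * moment 0 k)
  + c 4%N * (moment 1 g * moment 1 k) + c 5%N * (moment 0 g * moment 2 k).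

Lemma frame_quad_has_int b s M r c g k : 0 < r -> `|s| <= 1 ->
  boxfun g -> boxfun k ->
  has_int mu2 (fun x => frame_quad b s M r c x * frame_tensor b s M r g k x)
    (r ^+ 2 * quad_moment c g k).
Proof.
move=> r0 s1 bg bk.
have h i j a := has_intZ a (frame_tensor_has_int b M r0 s1 (boxfun_expM i bg) (boxfun_expM j bk)).
have H := has_intD (has_intD (has_intD (has_intD (has_intD (h 0 0 (c 0)) (h 1 0 (c 1)))
  (h 0 1 (c 2))) (h 2 0 (c 3))) (h 1 1 (c 4))) (h 0 2 (c 5)).
apply: has_int_eq H => [x|].
  by rewrite /frame_quad /quad /frame_tensor /= !expr0 !expr1; ring.
by rewrite /quad_moment /moment; ring.
Qed.

End FrameIntegrals.

(** * Open and compact sets of the plane and their measurability *)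

Section OpenBoxes.
Context {R : realType}.
Implicit Types (A : set (R * R)) (M : R * R).

Definition open_square M (a : R) : set (R * R) :=
  `]M.1 - a, M.1 + a[ `*` `]M.2 - a, M.2 + a[.

Lemma open_squareP M a x :
  open_square M a x <-> `|x.1 - M.1| < a /\ `|x.2 - M.2| < a.
Proof. by rewrite /open_square /= !in_itv /= !ltr_distl. Qed.

Lemma measurable_open_square M a :
  measurable (open_square M a : set (plane R)).
Proof. by rewrite /open_square; apply: measurableX; exact: measurable_itv. Qed.

Lemma open_square_open M a : open (open_square M a).
Proof.
rewrite /open_square (_ : _ `*` _ = (fst @^-1` `]M.1 - a, M.1 + a[) `&` (snd @^-1` `]M.2 - a, M.2 + a[))//.
apply: openI; apply: open_comp; try exact: itv_open => //.
  by move=> x _; exact: cvg_fst.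
by move=> x _; exact: cvg_snd.
Qed.

Lemma square_compact M a : compact (square M a).
Proof. by apply: compact_setX; exact: segment_compact. Qed.

Lemma nbhs_square A x : nbhs x A -> exists2 e : R, 0 < e & square x e `<=` A.
Proof.
move=> /nbhs_ballP[e /= e0 he]; exists (e / 2); first by rewrite divr_gt0.
move=> y /squareP[h1 h2]; apply: he; split.
  by rewrite /= -ball_normE /= distrC; apply: (le_lt_trans h1); lra.
by rewrite /= -ball_normE /= distrC; apply: (le_lt_trans h2); lra.
Qed.

Lemma square_nbhs A x (e : R) : 0 < e -> square x e `<=` A -> nbhs x A.
Proof.
move=> e0 he; apply: (@filterS _ _ _ (open_square x e)).
  by move=> y /open_squareP[h1 h2]; apply: he; apply/squareP; split; exact: ltW.
apply: open_nbhs_nbhs; split; first exact: open_square_open.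
by apply/open_squareP; rewrite !subrr normr0.
Qed.

(** The plane carries the product sigma-algebra, so topological sets are reached by countably many
    squares, those with rational data. Codes that are not useful stand for a square of half-side -1,
    which is empty. *)
Lemma open_countable_squares A : open A ->
  exists (c : nat -> R * R) (a : nat -> R),
    (forall n, square (c n) (a n) `<=` A) /\
    A = \bigcup_n open_square (c n) (a n).
Proof.
move=> oA.
pose c (q : rat * rat * rat) : R * R := (ratr q.1.1, ratr q.1.2).
pose P q := square (c q) (ratr q.2) `<=` A.
pose val n : (R * R) * R := if unpickle n is Some q then
   (if `[< P q >] then (c q, ratr q.2) else (0, -1)) else (0, -1).
have e0 M : square M (-1) = set0.
  apply/seteqP; split => // x /squareP[h _].
  by have := le_trans (normr_ge0 _) h; rewrite ler0N1.
exists (fun n => (val n).1), (fun n => (val n).2); split.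
  move=> n; rewrite /val; case: unpickle => [q|]; last by rewrite /= e0.
  by case: asboolP => //= _; rewrite e0.
apply/seteqP; split => [x Ax|x [n _]]; last first.
  rewrite /val; have e1 : open_square (0 : R * R) (-1) x -> False.
    by move=> /open_squareP[h _]; have := le_lt_trans (normr_ge0 _) h; rewrite ltr0N1.
  case: unpickle => [q|]; last by move=> /e1.
  case: asboolP => [Pq|_ /e1 //] /= /open_squareP[h1 h2].
  by apply: Pq; apply/squareP; split; exact: ltW.
have /nbhs_square[e ep he] : nbhs x A by apply: open_nbhs_nbhs.
(* The centre is within e/4 of x and the half-side d lies between e/4 and e/2: the square contains
   x, and its points stay within d + e/4 < e of x. *)
have [q1 q1P] : exists q : rat, ratr q \in `]x.1 - e / 4, x.1 + e / 4[ by apply: rat_in_itvoo; lra.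
have [q2 q2P] : exists q : rat, ratr q \in `]x.2 - e / 4, x.2 + e / 4[ by apply: rat_in_itvoo; lra.
have [d dP] : exists q : rat, ratr q \in `]e / 4, e / 2[ by apply: rat_in_itvoo; lra.
move: q1P q2P dP; rewrite !in_itv /= -!ltr_distl => h1 h2 /andP[d1 d2].
exists (pickle (q1, q2, d)) => //; rewrite /val pickleK /=.
have -> : `[< P (q1, q2, d) >].
  apply/asboolP => y /squareP[/= k1 k2]; apply: he; apply/squareP; split.
    by have := ler_distD (ratr q1) y.1 x.1; lra.
  by have := ler_distD (ratr q2) y.2 x.2; lra.
by apply/open_squareP => /=; rewrite ![`|_ - ratr _|]distrC; split; lra.
Qed.

Lemma open_measurable_plane A : open A ->
  measurable (A : set (plane R)).
Proof.
move=> /open_countable_squares[c [a [_ ->]]].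
by apply: bigcupT_measurable => n; exact: measurable_open_square.
Qed.

Lemma compact_measurable_plane A : compact A ->
  measurable (A : set (plane R)).
Proof.
move=> cA; rewrite -[A]setCK; apply: measurableC; apply: open_measurable_plane.
apply: closed_openC; apply: compact_closed cA; exact: norm_hausdorff.
Qed.

Lemma continuous_measurable_plane (f : R * R -> R) :
  continuous f -> measurable_fun setT f.
Proof.
move=> cf; apply: (measurability _ (RGenOInfty.measurableE R)).
move=> _ [_ [x ->] <-]; rewrite setTI; apply: open_measurable_plane.
by apply: open_comp => //; exact: itv_open.
Qed.

Lemma compact_bounded_plane A : compact A -> exists a, A `<=` square 0 a.
Proof.
move=> /compact_bounded[a [_ ha]]; exists (a + 1) => x Ax.
have a1 : a < a + 1 by rewrite ltrDl.
have := ha (a + 1) a1 x Ax.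
rewrite /= prod_normE ge_max => /andP[h1 h2].
by apply/squareP; rewrite /= !subr0.
Qed.

Lemma compact_mu2_fin A : compact A -> (mu2 A < +oo)%E.
Proof.
move=> cA; have [a ha] := compact_bounded_plane cA.
apply: (@le_lt_trans _ _ (mu2 (square 0 `|a|))).
  apply: le_measure; rewrite ?inE; [exact: compact_measurable_plane|exact: measurable_square|].
  move=> x /ha /squareP[h1 h2]; apply/squareP; split; apply: le_trans (ler_norm a) => //.
by rewrite mu2_square// ltry.
Qed.

End OpenBoxes.

(** * Uniqueness of weak derivatives *)

Section FundamentalLemma.
Context {R : realType}.
Implicit Types (G K : set (R * R)) (f g h phi : R * R -> R).
Local Notation mu2 := (@mu2 R).

Lemma Rintegral_support G K h : K `<=` G -> (forall x, ~ K x -> h x = 0) ->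
  \int[mu2]_(x in G) h x = \int[mu2]_x h x.
Proof.
move=> KG h0; rewrite Rintegral_mkcond; congr (Rintegral _ _ _).
apply/funext => x; rewrite patchE; case: ifPn => // /negP xG.
by rewrite h0// => /KG Gx; apply: xG; exact/mem_set.
Qed.

Lemma integrable_support K h : compact K -> (forall x, ~ K x -> h x = 0) ->
  mu2.-integrable K (EFin \o h) -> mu2.-integrable setT (EFin \o h).
Proof.
move=> cK h0 hK.
have -> : EFin \o h = (EFin \o h) \_ K.
  apply/funext => x; rewrite patchE; case: ifPn => // /negP xK /=.
  by rewrite h0// => Kx; apply: xK; exact/mem_set.
by apply: (integrable_mkcond _ _).1 => //; exact: compact_measurable_plane.
Qed.

Lemma loc_integrable_compact G K f : open G -> loc_integrable G f ->
  compact K -> K `<=` G -> mu2.-integrable K (EFin \o f).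
Proof.
move=> oG [mf fK] cK KG; apply/integrableP; split; last exact: fK.
apply/measurable_EFinP; apply: measurable_funS mf => //.
exact: open_measurable_plane.
Qed.

Lemma continuous_bounded_on phi K : compact K -> continuous phi ->
  exists B, forall x, K x -> `|phi x| <= B.
Proof.
move=> cK cphi.
have : compact (phi @` K).
  by apply: continuous_compact cK; exact: continuous_subspaceT.
move=> /compact_bounded[B [_ hB]]; exists (B + 1) => x Kx.
by apply: hB; [rewrite ltrDl|exists x].
Qed.

Lemma loc_mul_integrable G K f phi : open G -> loc_integrable G f ->
  compact K -> K `<=` G -> continuous phi -> (forall x, ~ K x -> phi x = 0) ->
  mu2.-integrable setT (EFin \o (fun x => f x * phi x)).
Proof.
move=> oG lf cK KG cphi phi0.
apply: (integrable_support cK); first by move=> x /phi0 ->; rewrite mulr0.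
have mK := compact_measurable_plane cK.
have [B hB] := continuous_bounded_on cK cphi.
apply: (integrableMl mK (loc_integrable_compact oG lf cK KG)).
  by apply: measurable_funTS; exact: continuous_measurable_plane.
exists B; split; first exact: num_real.
by move=> x Bx y Ky; exact: le_trans (hB y Ky) (ltW Bx).
Qed.

(** A smooth approximation of the indicator of ]p, q[: as [flat_exp 1] tends to 1 at infinity,
    speeding up its argument makes both factors tend to 1 inside, and they remain 0 outside. *)
Definition ramp (n : nat) (p q t : R) : R :=
  flat_exp 1 (n.+1%:R * (t - p)) * flat_exp 1 (n.+1%:R * (q - t)).

Lemma ramp_smooth n p q : line_smooth (ramp n p q).
Proof.
have -> : ramp n p q = (fun t => flat_exp 1 (n.+1%:R * t + - (n.+1%:R * p)) *
    flat_exp 1 ((- n.+1%:R) * t + n.+1%:R * q)).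
  by apply/funext => t; rewrite /ramp; congr (flat_exp _ _ * flat_exp _ _); ring.
by apply: line_smoothM; apply: line_smooth_affine; exact: flat_exp_smooth.
Qed.

Lemma flat_exp1_le1 (x : R) : flat_exp 1 x <= 1.
Proof.
rewrite /flat_exp; case: ifP => // x0; rewrite hornerC mul1r expR_le1.
by rewrite oppr_le0 invr_ge0 ltW.
Qed.

Lemma ramp_ge0_le1 n p q t : 0 <= ramp n p q t <= 1.
Proof.
by rewrite mulr_ge0 ?flat_exp1_ge0//= mulr_ile1 ?flat_exp1_ge0 ?flat_exp1_le1.
Qed.

Lemma ramp_out n p q t : ~~ (p < t < q) -> ramp n p q t = 0.
Proof.
rewrite negb_and -!leNgt /ramp /flat_exp => /orP[h|h].
  by rewrite pmulr_rgt0// subr_gt0 [p < t]ltNge h mul0r.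
by rewrite [0 < _ * (q - t)]pmulr_rgt0// subr_gt0 [t < q]ltNge h mulr0.
Qed.

Lemma flat_exp1_cvg (x : R) : 0 < x -> flat_exp 1 (n.+1%:R * x) @[n --> \oo] --> (1 : R).
Proof.
move=> x0.
have -> : (fun n => flat_exp 1 (n.+1%:R * x)) = (fun n => expR (- (n.+1%:R^-1 * x^-1))).
  by apply/funext => n; rewrite /flat_exp mulr_gt0// hornerC mul1r invfM.
have : expR (- (n.+1%:R^-1 * x^-1)) @[n --> \oo] --> expR (- (0 * x^-1)).
  apply: continuous_cvg; first exact: continuous_expR.
  by apply: cvgN; apply: cvgMr_tmp; exact: cvg_harmonic.
by rewrite mul0r oppr0 expR0.
Qed.

Lemma ramp_cvg p q t : ramp n p q t @[n --> \oo] --> ((p < t < q)%R%:R : R).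
Proof.
case: (boolP (p < t < q)) => [/andP[h1 h2]|h]; last first.
  have -> : (fun n => ramp n p q t) = cst 0 by apply/funext => n; rewrite ramp_out.
  exact: cvg_cst.
have : ramp n p q t @[n --> \oo] --> (1 * 1 : R).
  by apply: cvgM; apply: flat_exp1_cvg; rewrite subr_gt0.
by rewrite mulr1.
Qed.

Lemma affine_grad_fst : affine_grad (fun i : 'I_2 => (i == ord0)%:R : R) fst.
Proof. by exists 0 => x /=; ring. Qed.

Lemma affine_grad_snd : affine_grad (fun i : 'I_2 => (i != ord0)%:R : R) snd.
Proof. by exists 0 => x /=; ring. Qed.

Lemma tensor_smooth (u v : R -> R) : line_smooth u -> line_smooth v ->
  smooth (fun x : R * R => u x.1 * v x.2).
Proof.
move=> su sv; apply: (@smoothM _ (u \o fst) (v \o snd)); apply: smooth_comp_affine => //.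
  exact: affine_grad_fst.
exact: affine_grad_snd.
Qed.

(** Dominated convergence along products of ramps, with |h| as majorant. Only the lower left corner
    (p, q) varies: such boxes are the traces of quadrants on the open square, and quadrants generate
    the sigma-algebra. *)
Lemma box_integral_eq0 G h M (a p q : R) : open G -> loc_integrable G h ->
  (forall phi, test_fun G phi -> \int[mu2]_x (h x * phi x) = 0) ->
  square M a `<=` G -> M.1 - a <= p -> M.2 - a <= q ->
  \int[mu2]_(x in square M a)
    (h x * ((p < x.1 < M.1 + a)%R%:R * (q < x.2 < M.2 + a)%R%:R)) = 0.
Proof.
move=> oG lh hphi QG pM qM.
have cQ : compact (square M a) by exact: square_compact.
have mQ := compact_measurable_plane cQ.
have ihQ := loc_integrable_compact oG lh cQ QG.
have mh : measurable_fun (square M a) h by case/integrableP: ihQ => /measurable_EFinP.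
pose w n (x : R * R) := ramp n p (M.1 + a) x.1 * ramp n q (M.2 + a) x.2.
have sw n : smooth (w n) by apply: tensor_smooth; exact: ramp_smooth.
have w0 n x : ~ square M a x -> w n x = 0.
  move=> nQ; rewrite /w.
  have [h1|h1] := boolP (p < x.1 < M.1 + a); last by rewrite ramp_out ?mul0r.
  have [h2|h2] := boolP (q < x.2 < M.2 + a); last by rewrite [X in _ * X]ramp_out ?mulr0.
  exfalso; apply: nQ; rewrite /square /= !in_itv /=.
  by case/andP: h1 => *; case/andP: h2 => *; split; apply/andP; split; lra.
have tw n : test_fun G (w n) by split=> //; exists (square M a); split=> // x; exact: w0.
pose F n x := (h x * w n x)%:E.
have FE n : (\int[mu2]_(x in square M a) F n x)%E = 0%E.
  have ii := loc_mul_integrable oG lh cQ QG (smooth_continuous (sw n)) (w0 n).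
  rewrite -[LHS]fineK; last first.
    by apply: integrable_fin_num => //; exact: integrableS ii.
  congr EFin; rewrite -[RHS](hphi _ (tw n)) -(@Rintegral_support (square M a) (square M a)) //.
  by move=> x /w0 ->; rewrite mulr0.
pose ind (x : R * R) : R := (p < x.1 < M.1 + a)%R%:R * (q < x.2 < M.2 + a)%R%:R.
have wcvg x : w n x @[n --> \oo] --> ind x by apply: cvgM; exact: ramp_cvg.
have mw n : measurable_fun (square M a) (w n).
  by apply: measurable_funTS; apply: continuous_measurable_plane; exact: smooth_continuous.
have mF n : measurable_fun (square M a) (F n).
  by apply/measurable_EFinP; exact: measurable_funM.
have mind : measurable_fun (square M a) ind.
  by apply: (measurable_fun_cvg mw) => x _; exact: wcvg.
have mf : measurable_fun (square M a) (fun x => (h x * ind x)%:E).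
  by apply/measurable_EFinP; exact: measurable_funM.
have Fcvg : {ae mu2, forall x, square M a x -> F n x @[n --> \oo] --> (h x * ind x)%:E}.
  apply: aeW => x _; apply: cvg_EFin; first exact: nearW.
  by apply: cvgMl_tmp; exact: wcvg.
have ig : mu2.-integrable (square M a) (fun x => `|h x|%:E).
  exact: (integrable_norm ihQ).
have domF : {ae mu2, forall x n, square M a x -> (`|F n x| <= `|h x|%:E)%E}.
  apply: aeW => x n _; rewrite /F /= lee_fin normrM.
  have /andP[r1 r2] := ramp_ge0_le1 n p (M.1 + a) x.1.
  have /andP[r3 r4] := ramp_ge0_le1 n q (M.2 + a) x.2.
  have w01 : 0 <= w n x <= 1 by rewrite mulr_ge0 //= mulr_ile1.
  by case/andP: w01 => w0' w1; rewrite (ger0_norm w0') ler_piMr.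
have [_ _ H] := dominated_convergence mQ mF mf Fcvg ig domF.
rewrite /Rintegral; have := cvg_lim _ H; move=> <- //.
rewrite (_ : [sequence _]_n = cst 0%E); last by apply/funext => n /=; rewrite FE.
by rewrite lim_cst.
Qed.

End FundamentalLemma.

Section Density.
Context {d} {T : measurableType d} {R : realType} (mu : {measure set T -> \bar R}).
Variable f : T -> \bar R.
Hypotheses (mf : measurable_fun setT f) (f0 : forall x, (0 <= f x)%E).

(** Measurability and positivity are arguments so that the term itself determines its structure of
    measure. *)
Definition density_of (mf0 : measurable_fun setT f) (f00 : forall x, (0 <= f x)%E)
  (A : set T) : \bar R := (\int[mu]_(x in A) f x)%E.

Let density0 : density_of mf f0 set0 = 0%E.
Proof. exact: integral_set0. Qed.

Let density_ge0 A : (0 <= density_of mf f0 A)%E.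
Proof. by apply: integral_ge0 => x _; exact: f0. Qed.

Let density_additive : semi_sigma_additive (density_of mf f0).
Proof. exact: semi_sigma_additive_nng_induced. Qed.

HB.instance Definition _ := isMeasure.Build _ _ _ (density_of mf f0)
  density0 density_ge0 density_additive.

End Density.

Section WeakUniqueness.
Context {R : realType}.
Implicit Types (G K : set (R * R)) (f g h phi : R * R -> R).
Local Notation mu2 := (@mu2 R).

Definition quadrants : set (set (R * R)) :=
  [set A | exists u v : R, A = `]u, +oo[ `*` `]v, +oo[].

(** Half planes are countable unions of quadrants, so both coordinates are measurable for the
    sigma-algebra that quadrants generate. *)
Lemma measurable_quadrants :
  (measurable : set (set (plane R))) = <<s quadrants >>.
Proof.
apply/seteqP; split; last first.
  apply: smallest_sub; first exact: smallest_sigma_algebra.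
  by move=> _ [u [v ->]]; apply: measurableX; exact: measurable_itv.
have cover1 (u : R) : `]u, +oo[ `*` [set: R] = \bigcup_n (`]u, +oo[ `*` `]- n%:R, +oo[).
  apply/seteqP; split => [[x y] /= [hx _]|[x y] [n _] [/= hx _]]; last by split.
  have [n hn] : exists n : nat, `|y| < n%:R by exists (Num.truncn `|y|).+1; rewrite truncnS_gt.
  exists n => //; split => //=; rewrite in_itv /= andbT.
  by have := ler_norm (- y); rewrite normrN; lra.
have cover2 (u : R) : [set: R] `*` `]u, +oo[ = \bigcup_n (`]- n%:R, +oo[ `*` `]u, +oo[).
  apply/seteqP; split => [[x y] /= [_ hx]|[x y] [n _] [/= _ hx]]; last by split.
  have [n hn] : exists n : nat, `|x| < n%:R by exists (Num.truncn `|x|).+1; rewrite truncnS_gt.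
  exists n => //; split => //=; rewrite in_itv /= andbT.
  by have := ler_norm (- x); rewrite normrN; lra.
pose S := [the measurableType _ of g_sigma_algebraType quadrants].
have m1 : measurable_fun [set: S] (fst : S -> R).
  apply: (measurability _ (RGenOInfty.measurableE R)) => _ [_ [u ->] <-].
  rewrite setTI (_ : _ @^-1` _ = `]u, +oo[ `*` [set: R]); last first.
    by apply/seteqP; split => x //= [].
  rewrite cover1; apply: bigcupT_measurable => n; apply: sub_sigma_algebra.
  by exists u, (- n%:R).
have m2 : measurable_fun [set: S] (snd : S -> R).
  apply: (measurability _ (RGenOInfty.measurableE R)) => _ [_ [u ->] <-].
  rewrite setTI (_ : _ @^-1` _ = [set: R] `*` `]u, +oo[); last first.
    by apply/seteqP; split => x //= [].
  rewrite cover2; apply: bigcupT_measurable => n; apply: sub_sigma_algebra.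
  by exists (- n%:R), u.
apply: smallest_sub; first exact: smallest_sigma_algebra.
rewrite subUset; split => _ [B mB <-].
  exact: (m1 measurableT B mB).
exact: (m2 measurableT B mB).
Qed.

Lemma quadrants_setI : setI_closed quadrants.
Proof.
move=> _ _ [u [v ->]] [u' [v' ->]]; exists (Num.max u u'), (Num.max v v').
by apply/seteqP; split => x /=; rewrite !in_itv /= !andbT !gt_max;
  [case=> -[-> ->] [-> ->]|move=> [/andP[-> ->] /andP[-> ->]]].
Qed.

(** The measures with densities the positive and negative parts of h agree on quadrants by
    [box_integral_eq0]. Quadrants are stable under intersection and exhaust the plane, so the two
    finite measures coincide and h has integral zero over every measurable set. *)
Lemma ae0_open_square G h M (a : R) : open G -> loc_integrable G h ->
  (forall phi, test_fun G phi -> \int[mu2]_x (h x * phi x) = 0) ->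
  square M a `<=` G ->
  {ae mu2, forall x, open_square M a x -> h x = 0}.
Proof.
move=> oG lh hphi QG.
have cQ : compact (square M a) by exact: square_compact.
have mQ := compact_measurable_plane cQ.
have mO := measurable_open_square M a.
have OQ : open_square M a `<=` square M a.
  by move=> x /open_squareP[h1 h2]; apply/squareP; split; exact: ltW.
have ihQ := loc_integrable_compact oG lh cQ QG.
have ihO : mu2.-integrable (open_square M a) (EFin \o h) by exact: integrableS ihQ.
pose H := h \_ (open_square M a).
have iH : mu2.-integrable setT (EFin \o H).
  have := (integrable_mkcond _ mO).1 ihO; apply: eq_integrable => // x _ /=.
  by rewrite /H !patchE; case: ifP.
have mH : measurable_fun setT (EFin \o H) by case/integrableP: iH.
pose mp : {measure set (plane R) -> \bar R} := density_of mu2 (measurable_funepos mH) (fun x => funepos_ge0 _ x).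
pose mn : {measure set (plane R) -> \bar R} := density_of mu2 (measurable_funeneg mH) (fun x => funeneg_ge0 _ x).
have fin A : measurable A -> (mp A < +oo)%E /\ (mn A < +oo)%E.
  move=> mA; have iA : mu2.-integrable A (EFin \o H) by exact: integrableS iH.
  split; rewrite -ge0_fin_numE; try exact: measure_ge0.
    exact: integrable_pos_fin_num iA.
  exact: integrable_neg_fin_num iA.
have HE A : measurable A -> (\int[mu2]_(x in A) (H x)%:E = mp A - mn A)%E.
  by move=> mA; rewrite integralE.
have agree A : quadrants A -> mp A = mn A.
  move=> qA; have mA : measurable (A : set (plane R)).
    by rewrite measurable_quadrants; exact: sub_sigma_algebra.
  have [f1 f2] := fin _ mA.
  suff : (\int[mu2]_(x in A) (H x)%:E = 0)%E.
    rewrite HE// => /eqP; rewrite sube_eq ?add0e; last 2 first.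
    - by rewrite ge0_fin_numE//; exact: measure_ge0.
    - by rewrite fin_num_adde_defr//.
    by move=> /eqP.
  have [u [v AE]] := qA.
  pose p := Num.max u (M.1 - a); pose q := Num.max v (M.2 - a).
  have Z := @box_integral_eq0 _ G h M a p q oG lh hphi QG.
  have e1 : (\int[mu2]_(x in A) (H x)%:E =
    \int[mu2]_(x in square M a) (h x * ((p < x.1 < M.1 + a)%R%:R * (q < x.2 < M.2 + a)%R%:R))%:E)%E.
    rewrite integral_mkcond [RHS]integral_mkcond; apply: eq_integral => x _.
    have key : (p < x.1 < M.1 + a) && (q < x.2 < M.2 + a) <-> open_square M a x /\ A x.
      rewrite AE /open_square /= !in_itv /= !andbT /p /q !gt_max.
      split=> [/andP[/andP[/andP[-> ->] ->] /andP[/andP[-> ->] ->]]//|].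
      by move=> [[/andP[-> ->] /andP[-> ->]] [-> ->]].
    have [/key/andP[k1 k2]|nk] := pselect (open_square M a x /\ A x).
      have [xO xA] := key.1 (introT andP (conj k1 k2)).
      rewrite !patchE !mem_set //; last exact: OQ.
      by rewrite k1 k2 !mulr1 /H patchE mem_set.
    have -> : ((fun x => (h x * ((p < x.1 < M.1 + a)%R%:R * (q < x.2 < M.2 + a)%R%:R))%:E)
         \_ (square M a)) x = 0%E.
      rewrite patchE; case: ifP => // _.
      case: (boolP (p < x.1 < M.1 + a)) => k1; last by rewrite mul0r mulr0.
      case: (boolP (q < x.2 < M.2 + a)) => k2; last by rewrite mulr0 mulr0.
      by exfalso; apply/nk/key/andP.
    rewrite patchE; case: ifPn => // xA; rewrite /H patchE; case: ifPn => // xO.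
    by exfalso; apply: nk; split; exact: set_mem.
  rewrite e1 -[LHS]fineK; last first.
    rewrite -e1; apply: integrable_fin_num => //; exact: integrableS iH.
  congr EFin; apply: Z; rewrite /p /q le_max lexx orbT //.
have cover : \bigcup_n (`]- n%:R, +oo[ `*` `]- n%:R, +oo[) = [set: R * R].
  apply/seteqP; split => // x _.
  have [n hn] : exists n : nat, `|x.1| + `|x.2| < n%:R.
    by exists (Num.truncn (`|x.1| + `|x.2|)).+1; rewrite truncnS_gt.
  exists n => //=; rewrite !in_itv /= !andbT.
  have := ler_norm (- x.1); have := ler_norm (- x.2); rewrite !normrN.
  by have := normr_ge0 x.1; have := normr_ge0 x.2; split; lra.
have mQd n : quadrants (`]- n%:R, +oo[ `*` `]- n%:R, +oo[) by exists (- n%:R), (- n%:R).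
have eqm A : measurable (A : set (plane R)) -> mp A = mn A.
  have H1 := @measure_unique _ R [the measurableType _ of (plane R)]
    quadrants _ measurable_quadrants quadrants_setI mQd cover mp mn.
  have H2 := H1 agree.
  apply: H2.
  move=> n; apply: (fin _ _).1.
  by rewrite measurable_quadrants; exact: sub_sigma_algebra.
have mc : measurable_fun setT (cst 0%E : measurableTypeR R * measurableTypeR R -> \bar R).
  exact: measurable_cst.
have aeH := integral_ae_eq measurableT iH mc.
have /aeH : forall E, E `<=` setT -> measurable (E : set (plane R)) ->
    (\int[mu2]_(x in E) (EFin \o H) x = \int[mu2]_(x in E) 0)%E.
  move=> E _ mE; rewrite HE// eqm// integral0 subee//.
  by rewrite ge0_fin_numE ?measure_ge0//; exact: (fin E mE).2.
apply: filterS => x /(_ I) /= [+] xO; rewrite /H patchE.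
by rewrite mem_set.
Qed.

Lemma fundamental_lemma G h : open G -> loc_integrable G h ->
  (forall phi, test_fun G phi -> \int[mu2]_x (h x * phi x) = 0) ->
  {ae mu2, forall x, G x -> h x = 0}.
Proof.
move=> oG lh hphi; have [c [a [sub GE]]] := open_countable_squares oG.
have /ae_foralln : forall n, {ae mu2, forall x, open_square (c n) (a n) x -> h x = 0}.
  by move=> n; exact: ae0_open_square oG lh hphi (sub n).
by apply: filterS => x hx; rewrite GE => -[n _ ]; exact: hx.
Qed.

Lemma test_fun_int G f phi : open G -> loc_integrable G f -> test_fun G phi ->
  has_int mu2 (fun x => f x * phi x) (\int[mu2]_(x in G) (f x * phi x)).
Proof.
move=> oG lf [sphi [K [cK KG phi0]]]; split.
  exact: loc_mul_integrable oG lf cK KG (smooth_continuous sphi) phi0.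
by symmetry; apply: (Rintegral_support KG) => x /phi0 ->; rewrite mulr0.
Qed.

Lemma loc_integrableB G f g : open G -> loc_integrable G f -> loc_integrable G g ->
  loc_integrable G (f \- g).
Proof.
move=> oG lf lg; split; first by apply: measurable_funB; [case: lf|case: lg].
move=> K cK KG; have mK := compact_measurable_plane cK.
have := integrableB mK (loc_integrable_compact oG lf cK KG) (loc_integrable_compact oG lg cK KG).
by case/integrableP.
Qed.

(** This is what gives access to [wpartial], an unspecified choice among the weak derivatives. *)
Lemma wpartial_unique G i f g1 g2 : open G ->
  is_wpartial G i f g1 -> is_wpartial G i f g2 ->
  {ae mu2, forall x, G x -> g1 x = g2 x}.
Proof.
move=> oG [_ l1 h1] [_ l2 h2].
have : {ae mu2, forall x, G x -> (g1 \- g2) x = 0}.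
  apply: fundamental_lemma => //; first exact: loc_integrableB.
  move=> phi tphi.
  have [_] := has_intB (test_fun_int oG l1 tphi) (test_fun_int oG l2 tphi).
  have -> : \int[mu2]_(x in G) (g1 x * phi x) = \int[mu2]_(x in G) (g2 x * phi x).
    by apply: oppr_inj; rewrite -h1// -h2.
  rewrite subrr => <-; apply: eq_Rintegral => x _ /=; ring.
by apply: (@filterS _ _ (ae_filter_ringOfSetsType mu2)) => x hx Gx; have := hx Gx; move/eqP; rewrite subr_eq0 => /eqP.
Qed.

End WeakUniqueness.

(** * Test functions and integrals of their derivatives *)

Section TestFunctions.
Context {R : realType}.
Implicit Types (G K : set (R * R)) (f g h phi : R * R -> R).
Local Notation mu2 := (@mu2 R).
Local Notation leb := (@lebesgue_measure R).

Lemma ord2P (i : 'I_2) : i = ord0 \/ i = ord_max.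
Proof. by case: i => -[|[|//]] hi; [left|right]; exact/val_inj. Qed.

Lemma sum2E (F : 'I_2 -> R) : \sum_(i < 2) F i = F ord0 + F ord_max.
Proof. by rewrite big_ord_recl big_ord1; congr (_ + F _); exact/val_inj. Qed.

Lemma test_fun_smooth G phi : test_fun G phi -> smooth phi.
Proof. by case. Qed.

Lemma test_fun_partial G i phi : test_fun G phi -> test_fun G (partial i phi).
Proof.
move=> [sphi [K [cK KG phi0]]]; split; first exact: smooth_partial.
exists K; split=> // x nKx; rewrite /partial.
have oK : open (~` K).
  by apply: closed_openC; apply: compact_closed cK; exact: norm_hausdorff.
have -> : 'D_(dir i) phi x = 'D_(dir i) (cst (0 : R)) x.
  apply: near_eq_derive; apply: (@filterS _ _ _ (~` K)); first by move=> y; exact: phi0.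
  by apply: open_nbhs_nbhs; split.
by rewrite derive_cst.
Qed.

Lemma test_fun0 G : test_fun G (fun=> 0).
Proof.
split; first exact: smooth_cst.
by exists set0; split => //; exact: compact0.
Qed.

Lemma test_funM_smooth G phi f : smooth f -> test_fun G phi ->
  test_fun G (fun x => f x * phi x).
Proof.
move=> sf [sphi [K [cK KG phi0]]]; split; first exact: smoothM.
by exists K; split => // x /phi0 ->; rewrite mulr0.
Qed.

Lemma test_fun_integrable G phi : test_fun G phi -> mu2.-integrable setT (EFin \o phi).
Proof.
move=> [sphi [K [cK KG phi0]]]; have cphi := smooth_continuous sphi.
have [B hB] := continuous_bounded_on cK cphi.
apply: (@bounded_integrable _ _ _ mu2 K _ B) => //.
- exact: compact_measurable_plane.
- exact: compact_mu2_fin.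
- exact: continuous_measurable_plane.
Qed.

Lemma slice_derive (i : 'I_2) phi (c x : R) : smooth phi ->
  let e t : R * R := if i == ord0 then (t, c) else (c, t) in
  is_derive x 1 (phi \o e) (partial i phi (e x)).
Proof.
move=> sphi e; have [dphi dE] := smooth_is_derive i (e x) sphi.
have qE : (fun k : R => k^-1 *: (((phi \o e) \o shift x) (k *: 1) - (phi \o e) x)) =
          (fun k : R => k^-1 *: ((phi \o shift (e x)) (k *: dir i) - phi (e x))).
  apply/funext => k /=; congr (_ *: (phi _ - _)).
  by rewrite /e /dir; case: ifP => _; congr pair; rewrite /= /GRing.scale /= ?mulr0 ?add0r.
by apply: DeriveDef; [rewrite /derivable qE|rewrite /derive qE].
Qed.

Lemma slice_integral (i : 'I_2) G phi (c : R) : test_fun G phi ->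
  \int[leb]_t (partial i phi (if i == ord0 then (t, c) else (c, t))) = 0.
Proof.
move=> tphi; have [sphi [K [cK KG phi0]]] := tphi.
have [_ [K' [cK' _ dphi0]]] := test_fun_partial i tphi.
have [a Ka] := compact_bounded_plane cK; have [a' Ka'] := compact_bounded_plane cK'.
(* Large enough for both [phi] and its derivative, whose vanishing is known outside two separate
   compact sets. *)
pose A := `|a| + `|a'| + 1.
pose e t : R * R := if i == ord0 then (t, c) else (c, t).
have A0 : - A < A by rewrite /A; have := normr_ge0 a; have := normr_ge0 a'; lra.
have out t (f : R * R -> R) L b : L `<=` square 0 b -> (forall x, ~ L x -> f x = 0) ->
    b < `|t| -> f (e t) = 0.
  move=> Lb f0 bt; apply: f0 => /Lb /squareP[]; rewrite /e /= !subr0.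
  by case: ifP => _ /= h1 h2; [move: h1|move: h2]; rewrite leNgt bt.
have e_cont : continuous e.
  rewrite /e; case: (i == ord0) => t.
    by apply: (cvg_pair (G := nbhs _) (H := nbhs _)); [exact: cvg_id|exact: cvg_cst].
  by apply: (cvg_pair (G := nbhs _) (H := nbhs _)); [exact: cvg_cst|exact: cvg_id].
have D (t : R) : is_derive t 1 (phi \o e) (partial i phi (e t)) := slice_derive i c t sphi.
have -> : (fun t => partial i phi (if i == ord0 then (t, c) else (c, t))) =
    (fun t => partial i phi (e t)) \_ `[- A, A].
  apply/funext => t; rewrite patchE mem_setE in_itv /= -ler_norml -/(e t).
  case: (leP `|t| A) => // tA; apply: (out _ _ _ _ Ka' dphi0).
  have := ler_norm a'; have := normr_ge0 a; have := normr_ge0 a'; move: tA; rewrite /A; lra.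
rewrite -Rintegral_mkcond /Rintegral (@continuous_FTC2 _ _ (phi \o e))//.
- rewrite /= !(out _ _ _ _ Ka phi0) ?subrr// ?normrN ger0_norm /A;
  by have := ler_norm a; have := normr_ge0 a; have := normr_ge0 a'; lra.
- apply: continuous_subspaceT => t; apply: continuous_comp; first exact: e_cont.
  exact: smooth_continuous (smooth_partial i sphi) _.
- have ce : continuous (phi \o e).
    by move=> t; apply: continuous_comp; [exact: e_cont|exact: smooth_continuous].
  split=> [t _||]; first by case: (D t).
  + exact: cvg_at_right_filter (ce _).
  + exact: cvg_at_left_filter (ce _).
- by move=> t _; rewrite derive1E; case: (D t).
Qed.

(** Fubini, integrating first in the direction of the derivative: by the fundamental theorem of
    calculus every slice contributes zero. *)
Lemma integral_partial0 G i phi : test_fun G phi -> \int[mu2]_x partial i phi x = 0.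
Proof.
move=> tphi; have ii := test_fun_integrable (test_fun_partial i tphi).
suff H : (\int[mu2]_x (partial i phi x)%:E = 0)%E by rewrite /Rintegral H.
have [K [cK KG phi0]] := (test_fun_partial i tphi).2.
have slice_int (c : R) : leb.-integrable setT
    (EFin \o (fun t => partial i phi (if i == ord0 then (t, c) else (c, t)))).
  have [a Ka] := compact_bounded_plane cK.
  have [B hB] := continuous_bounded_on cK (smooth_continuous (smooth_partial i (test_fun_smooth tphi))).
  have B' x : `|partial i phi x| <= `|B|.
    have [Kx|nKx] := pselect (K x); first exact: le_trans (hB x Kx) (ler_norm _).
    by rewrite phi0// normr0.
  apply: (@bounded_integrable _ _ _ leb `[- a, a]%classic _ `|B|) => //.
  - by rewrite /= lebesgue_measure_itv /= lte_fin; case: ifP => _; rewrite ltry.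
  - have cd := smooth_continuous (smooth_partial i (test_fun_smooth tphi)).
    apply: continuous_measurable_fun; case: (i == ord0) => t.
      apply: (@continuous_comp _ _ _ (fun t => (t, c)) (partial i phi)); last exact: cd.
      by apply: (cvg_pair (G := nbhs _) (H := nbhs _)); [exact: cvg_id|exact: cvg_cst].
    apply: (@continuous_comp _ _ _ (fun t => (c, t)) (partial i phi)); last exact: cd.
    by apply: (cvg_pair (G := nbhs _) (H := nbhs _)); [exact: cvg_cst|exact: cvg_id].
  - move=> t /= tA; apply: phi0 => /Ka /squareP[]; rewrite /= !subr0.
    by case: ifP => _ /= h1 h2; apply: tA; rewrite /= in_itv /= -ler_norml.
have sl (c : R) : (\int[leb]_t (partial i phi (if i == ord0 then (t, c) else (c, t)))%:E = 0)%E.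
  by rewrite -[LHS]fineK; [congr EFin; exact: slice_integral tphi|exact: (integrable_fin_num measurableT (slice_int c))].
have [i0|i1] := ord2P i.
  rewrite -(integral21_prod_meas1 ii) /fubini_G /=.
  by apply: integral0_eq => y _; rewrite -[RHS](sl y) i0.
rewrite -(integral12_prod_meas1 ii) /fubini_F /=.
by apply: integral0_eq => y _; rewrite -[RHS](sl y) i1.
Qed.

End TestFunctions.

Section WeakDerivatives.
Context {R : realType}.
Implicit Types (G K : set (R * R)) (f g h phi : R * R -> R).
Local Notation mu2 := (@mu2 R).

Lemma ae2S (P Q : R * R -> Prop) : (forall x, P x -> Q x) ->
  {ae mu2, forall x, P x} -> {ae mu2, forall x, Q x}.
Proof. by move=> PQ; apply: (@filterS _ _ (ae_filter_ringOfSetsType mu2)). Qed.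

Lemma ae2I (P Q : R * R -> Prop) :
  {ae mu2, forall x, P x} -> {ae mu2, forall x, Q x} -> {ae mu2, forall x, P x /\ Q x}.
Proof. by apply: (@filterI _ _ (ae_filter_ringOfSetsType mu2)). Qed.

Lemma ae_Rintegral G f g : measurable (G : set (plane R)) ->
  measurable_fun G f -> measurable_fun G g ->
  {ae mu2, forall x, G x -> f x = g x} ->
  \int[mu2]_(x in G) f x = \int[mu2]_(x in G) g x.
Proof.
move=> mG mf mg fg; congr fine; apply: ae_eq_integral => //; try exact/measurable_EFinP.
by apply: ae2S fg => x h Gx; rewrite h.
Qed.

Lemma smooth_loc_integrable G f : open G -> continuous f -> loc_integrable G f.
Proof.
move=> oG cf; have mf := continuous_measurable_plane cf.
split; first exact: measurable_funTS.
move=> K cK KG; have [B hB] := continuous_bounded_on cK cf.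
have mK := compact_measurable_plane cK.
have : mu2.-integrable K (EFin \o f).
  apply: measurable_bounded_integrable => //; first exact: compact_mu2_fin.
    exact: measurable_funTS.
  exists B; split; first exact: num_real.
  by move=> x Bx y Ky; exact: le_trans (hB y Ky) (ltW Bx).
by case/integrableP.
Qed.

(** The product of [f] with a test function is again a test function, so its derivative has integral
    zero; the product rule does the rest. *)
Lemma is_wpartial_smooth G i f : open G -> smooth f -> is_wpartial G i f (partial i f).
Proof.
move=> oG sf; have cf := smooth_continuous sf.
have lf := smooth_loc_integrable oG cf.
have ldf := smooth_loc_integrable oG (smooth_continuous (smooth_partial i sf)).
split => // phi tphi; have sphi := test_fun_smooth tphi.
have h1 := test_fun_int oG lf (test_fun_partial i tphi).
have h2 := test_fun_int oG ldf tphi.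
have [_ h3] := has_intD h1 h2.
apply/eqP; rewrite -addr_eq0 -h3 -[X in _ == X](integral_partial0 i (test_funM_smooth sf tphi)).
apply/eqP; apply: eq_Rintegral => x _ /=; symmetry; apply: partialE.
have D : is_derive x (dir i) (fun x => f x * phi x) _ :=
  is_deriveM (smooth_is_derive i x sf) (smooth_is_derive i x sphi).
by apply: (is_derive_eq D); rewrite /GRing.scale /=; ring.
Qed.

Lemma wpartialP G i f g : is_wpartial G i f g -> is_wpartial G i f (wpartial G i f).
Proof. by move=> h; rewrite /wpartial; case: xgetP => [g' _ //|/(_ g)]. Qed.

Lemma wpartial_ae G i f g : open G -> is_wpartial G i f g ->
  {ae mu2, forall x, G x -> wpartial G i f x = g x}.
Proof. by move=> oG h; apply: wpartial_unique oG (wpartialP h) h. Qed.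

Lemma is_wpartialB_test G i f g phi : open G -> is_wpartial G i f g -> test_fun G phi ->
  is_wpartial G i (fun x => f x - phi x) (fun x => g x - partial i phi x).
Proof.
move=> oG [lf lg hfg] tphi; have [lp ldp hp] := is_wpartial_smooth i oG (test_fun_smooth tphi).
split; [exact: (loc_integrableB oG lf lp)|exact: (loc_integrableB oG lg ldp)|].
move=> psi tpsi; have tdpsi := test_fun_partial i tpsi.
have [_ e1] := has_intB (test_fun_int oG lf tdpsi) (test_fun_int oG lp tdpsi).
have [_ e2] := has_intB (test_fun_int oG lg tpsi) (test_fun_int oG ldp tpsi).
have [_ <-] := test_fun_int oG (loc_integrableB oG lf lp) tdpsi.
have [_ <-] := test_fun_int oG (loc_integrableB oG lg ldp) tpsi.
transitivity (\int[mu2]_(x in G) (f x * partial i psi x) -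
     \int[mu2]_(x in G) (phi x * partial i psi x)).
  by rewrite -e1; apply: eq_Rintegral => x _ /=; ring.
rewrite hfg// hp// -opprD -e2; congr (- _); apply: eq_Rintegral => x _ /=; ring.
Qed.

Lemma wpartial_measurable G i f g : is_wpartial G i f g -> measurable_fun G (wpartial G i f).
Proof. by move=> /wpartialP[_ [mg _] _]. Qed.

Lemma L2_integrable G f : open G -> (mu2 G < +oo)%E -> L2 unit_weight G f ->
  mu2.-integrable G (EFin \o f).
Proof.
move=> oG G1 [mf f2]; have mG := open_measurable_plane oG.
have i2 : mu2.-integrable G (EFin \o (fun x => f x ^+ 2)).
  apply/integrableP; split; first by apply/measurable_EFinP; exact: measurable_funX.
  apply: le_lt_trans f2; rewrite le_eqVlt; apply/orP; left; apply/eqP.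
  by apply: eq_integral => x _; rewrite /= /unit_weight mulr1 ger0_norm ?sqr_ge0.
have i1 : mu2.-integrable G (EFin \o (cst (1 : R) : R * R -> R)).
  apply: measurable_bounded_integrable => //.
  by exists 1; split=> // M /ltW ? y _; rewrite /= normr1.
(* On a set of finite measure, |f| <= 1 + f^2 replaces the inclusion of Lebesgue spaces. *)
have i12 : mu2.-integrable G (fun x => (1 + f x ^+ 2)%:E) := integrableD mG i1 i2.
apply: le_integrable i12 => //; first exact/measurable_EFinP.
move=> x _; rewrite /= lee_fin [X in _ <= X]ger0_norm; last by rewrite addr_ge0 ?sqr_ge0.
rewrite ler_norml; apply/andP; split; nra.
Qed.

Lemma L2_loc_integrable G f : open G -> (mu2 G < +oo)%E -> L2 unit_weight G f ->
  loc_integrable G f.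
Proof.
move=> oG G1 Lf; split; first by case: Lf.
move=> K cK KG; have := L2_integrable oG G1 Lf.
move=> /(integrableS (open_measurable_plane oG) (compact_measurable_plane cK) KG).
by case/integrableP.
Qed.

Lemma test_fun_L2 G phi : open G -> (mu2 G < +oo)%E -> test_fun G phi -> L2 unit_weight G phi.
Proof.
move=> oG G1 tphi; have mG := open_measurable_plane oG.
split.
  by apply: measurable_funTS; apply: continuous_measurable_plane; exact: smooth_continuous (test_fun_smooth tphi).
have t2 := test_funM_smooth (test_fun_smooth tphi) tphi.
have /integrableP[_] := integrableS measurableT mG (@subsetT _ G) (test_fun_integrable t2).
apply: le_lt_trans; rewrite le_eqVlt; apply/orP; left; apply/eqP.
by apply: eq_integral => x _; rewrite /= /unit_weight mulr1 -expr2 ger0_norm ?sqr_ge0.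
Qed.

Lemma test_fun_H10 G phi : open G -> (mu2 G < +oo)%E -> test_fun G phi ->
  H10 unit_weight G phi.
Proof.
move=> oG G1 tphi; have mG := open_measurable_plane oG; split.
  split; first exact: test_fun_L2.
  move=> i; exists (partial i phi); first exact: is_wpartial_smooth oG (test_fun_smooth tphi).
  exact: test_fun_L2 oG G1 (test_fun_partial i tphi).
(* [phi] approximates itself. The norm of the difference still requires work, since [wpartial] of
   the zero function vanishes only almost everywhere. *)
move=> eps eps0; exists phi => //.
have -> : (fun x => phi x - phi x) = (fun=> 0) by apply/funext => x; rewrite subrr.
have w0 i := is_wpartial_smooth i oG (@smooth_cst R 0).
have p0 i : partial i (fun=> 0 : R) = fun=> 0 by apply: partial_is => x; exact: is_derive_cst.
rewrite /H1sqnorm (_ : (\int[_]_(_ in _) _)%E = 0%E) ?lte_fin//.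
transitivity (\int[mu2]_(x in G) (cst 0 x))%E; last by rewrite integral0.
apply: ae_eq_integral => //.
  apply/measurable_EFinP.
  have mw i : measurable_fun G (wpartial G i (fun=> 0)) := wpartial_measurable (w0 i).
  rewrite [X in measurable_fun _ X](_ : _ = (fun x => (0 ^+ 2 + (wpartial G ord0 (fun=> 0) x ^+ 2
    + wpartial G ord_max (fun=> 0) x ^+ 2)) * 1)); last first.
    by apply/funext => x; rewrite sum2E.
  apply: measurable_funM => //; apply: measurable_funD => //.
  by apply: measurable_funD; apply: measurable_funX; exact: mw.
apply: ae2S (ae2I (wpartial_ae oG (w0 ord0)) (wpartial_ae oG (w0 ord_max))) => x [h0 h1] Gx.
by rewrite sum2E h0// h1// !p0 expr0n /= !addr0 mul0r.
Qed.

End WeakDerivatives.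

(** * The state equations tested with smooth functions *)

Section WeakIdentities.
Context {R : realType}.
Implicit Types (G K : set (R * R)) (f g h phi p : R * R -> R) (u y : 'I_2 -> R * R -> R).
Local Notation mu2 := (@mu2 R).

Lemma wpartial_test_int G i f g phi : open G -> is_wpartial G i f g -> test_fun G phi ->
  has_int mu2 (fun x => wpartial G i f x * phi x)
    (- \int[mu2]_x (f x * partial i phi x)).
Proof.
move=> oG wf tphi; have [lf lw hw] := wpartialP wf.
have [i1 e1] := test_fun_int oG lw tphi; split => //; rewrite e1.
have [_ ->] := test_fun_int oG lf (test_fun_partial i tphi).
by rewrite hw// opprK.
Qed.

Lemma wpartial_test_or0 G i phi (b : bool) : open G -> test_fun G phi ->
  let v := if b then phi else fun=> 0 in
  measurable_fun G (wpartial G i v) /\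
  {ae mu2, forall x, G x -> wpartial G i v x = if b then partial i phi x else 0}.
Proof.
move=> oG tphi; case: b => /=.
  have w := is_wpartial_smooth i oG (test_fun_smooth tphi).
  by split; [exact: wpartial_measurable w|exact: wpartial_ae].
have w := is_wpartial_smooth i oG (@smooth_cst R 0).
split; first exact: wpartial_measurable w.
apply: ae2S (wpartial_ae oG w) => x h Gx; rewrite h//.
by apply: partialE; exact: is_derive_cst.
Qed.

(** The field with j-th component [phi] and the other component 0 is admissible. The derivative left
    on y by [aform] moves to the test function because [partial i phi] is again a test function. *)
Lemma weak_momentum G y p u phi (j : 'I_2) :
  open G -> (mu2 G < +oo)%E ->
  (forall k i, exists g, is_wpartial G i (y k) g) ->
  loc_integrable G p -> (forall k, loc_integrable G (u k)) ->
  (forall v, (forall k, H10 unit_weight G (v k)) ->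
     aform G y v + bform G v p = L2dot G u v) ->
  test_fun G phi ->
  \int[mu2]_x (y j x * partial ord0 (partial ord0 phi) x)
  + \int[mu2]_x (y j x * partial ord_max (partial ord_max phi) x)
  + \int[mu2]_x (p x * partial j phi x) + \int[mu2]_x (u j x * phi x) = 0.
Proof.
move=> oG G1 wy lp lu eqn tphi; have mG := open_measurable_plane oG.
pose v (k : 'I_2) : R * R -> R := if k == j then phi else fun=> 0.
have tv k : test_fun G (v k) by rewrite /v; case: ifP => // _; exact: test_fun0.
have := eqn v (fun k => test_fun_H10 oG G1 (tv k)).
have W k i := wpartial_test_or0 i (k == j) oG tphi.
have my k i : measurable_fun G (wpartial G i (y k)).
  by have [g hg] := wy k i; exact: wpartial_measurable hg.
have mv k i : measurable_fun G (wpartial G i (v k)) := (W k i).1.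
have mp : measurable_fun G p by case: lp.
have mdphi i : measurable_fun G (partial i phi).
  apply: measurable_funTS; apply: continuous_measurable_plane.
  exact: smooth_continuous (smooth_partial i (test_fun_smooth tphi)).
have WA : {ae mu2, forall x, forall k i, G x ->
    wpartial G i (v k) x = if k == j then partial i phi x else 0}.
  have := ae2I (ae2I (W ord0 ord0).2 (W ord0 ord_max).2) (ae2I (W ord_max ord0).2 (W ord_max ord_max).2).
  apply: ae2S => x [[a1 a2] [a3 a4]] k i Gx; rewrite /v.
  by have [->|->] := ord2P k; have [->|->] := ord2P i; [exact: a1|exact: a2|exact: a3|exact: a4].
have msum2 (F : 'I_2 -> R * R -> R) : (forall k, measurable_fun G (F k)) ->
    measurable_fun G (fun x => \sum_(k < 2) F k x).
  by move=> mF; under eq_fun do rewrite sum2E; exact: measurable_funD.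
have pick (F : 'I_2 -> R) : \sum_(k < 2) (if k == j then F k else 0) = F j.
  by rewrite -big_mkcond /= big_pred1_eq.
have d1 i : has_int mu2 (fun x => wpartial G i (y j) x * partial i phi x)
    (- \int[mu2]_x (y j x * partial i (partial i phi) x)).
  have [g hg] := wy j i; exact: wpartial_test_int oG hg (test_fun_partial i tphi).
have supp f psi : test_fun G psi ->
    \int[mu2]_(x in G) (f x * psi x) = \int[mu2]_x (f x * psi x).
  move=> [spsi [K [cK KG psi0]]]; apply: (Rintegral_support KG) => x /psi0 ->.
  by rewrite mulr0.
have -> : aform G y v = - (\int[mu2]_x (y j x * partial ord0 (partial ord0 phi) x)
  + \int[mu2]_x (y j x * partial ord_max (partial ord_max phi) x)).
  pose F x := wpartial G ord0 (y j) x * partial ord0 phi x +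
      wpartial G ord_max (y j) x * partial ord_max phi x.
  have e : \int[mu2]_x F x = _ := (has_intD (d1 ord0) (d1 ord_max)).2.
  rewrite opprD -e.
  have [K [cK KG phi0]] : exists K, [/\ compact K, K `<=` G &
      forall x, ~ K x -> partial ord0 phi x = 0 /\ partial ord_max phi x = 0].
    have [_ [K0 [c0 K0G p0]]] := test_fun_partial ord0 tphi.
    have [_ [K1 [c1 K1G p1]]] := test_fun_partial ord_max tphi.
    exists (K0 `|` K1); split; first exact: compactU.
      by rewrite subUset.
    by move=> x nK; split; [apply: p0|apply: p1] => h; apply: nK; [left|right].
  have F0 x : ~ K x -> F x = 0.
    have zero (q1 q2 r1 r2 : R) : r1 = 0 -> r2 = 0 -> q1 * r1 + q2 * r2 = 0.
      by move=> -> ->; rewrite !mulr0 addr0.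
    by move=> /phi0[h0 h1]; exact: zero h0 h1.
  rewrite -(Rintegral_support KG F0).
  apply: ae_Rintegral => //.
  - by apply: (msum2 (fun k x => _)) => k; apply: (msum2 (fun i x => _)) => i; exact: measurable_funM.
  - by apply: measurable_funD; exact: measurable_funM.
  apply: ae2S WA => x h Gx.
  rewrite /F -[RHS](sum2E (fun i => wpartial G i (y j) x * partial i phi x)).
  rewrite -[RHS](pick (fun k => \sum_(i < 2) wpartial G i (y k) x * partial i phi x)).
  apply: eq_bigr => k _; case: eqVneq (h k) => [->|_] hk.
    by apply: eq_bigr => i _; rewrite hk.
  by rewrite big1// => i _; rewrite hk// mulr0.
have -> : bform G v p = - \int[mu2]_x (p x * partial j phi x).
  rewrite /bform -(supp p _ (test_fun_partial j tphi)); congr (- _); apply: ae_Rintegral => //.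
  - by apply: measurable_funM => //; apply: (msum2 (fun k x => _)) => k.
  - exact: measurable_funM.
  apply: ae2S WA => x h Gx; congr (_ * _).
  rewrite -[RHS](pick (fun k => partial k phi x)).
  by apply: eq_bigr => k _; rewrite h.
have -> : L2dot G u v = \int[mu2]_x (u j x * phi x).
  rewrite -(supp (u j) _ tphi); apply: eq_Rintegral => x _.
  rewrite -[RHS](pick (fun k => u k x * phi x)).
  by apply: eq_bigr => k _; rewrite /v; case: ifP => // _; rewrite mulr0.
have alg (q1 q2 q3 q4 : R) : - (q1 + q2) + - q3 = q4 -> q1 + q2 + q3 + q4 = 0.
  by move=> <-; ring.
exact: alg.
Qed.

(* Test functions have derivatives of mean zero, and [H10] is the closure of the
   test functions. *)
Lemma H10_mean_wpartial G f i : open G -> (mu2 G < +oo)%E -> H10 unit_weight G f ->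
  mu2.-integrable G (EFin \o wpartial G i f) /\ \int[mu2]_(x in G) wpartial G i f x = 0.
Proof.
move=> oG G1 [[Lf Hf] app]; have mG := open_measurable_plane oG.
have [g wg Lg] := Hf i; have aw := wpartial_ae oG wg.
have mW := wpartial_measurable wg; have mg : measurable_fun G g by case: Lg.
have iW : mu2.-integrable G (EFin \o wpartial G i f).
  have := L2_integrable oG G1 Lg; move=> /integrableP[mg' ig]; apply/integrableP.
  split; first exact/measurable_EFinP.
  apply: le_lt_trans ig; rewrite le_eqVlt; apply/orP; left; apply/eqP.
  apply: ge0_ae_eq_integral => //; try exact: measurableT_comp.
    by apply/measurableT_comp => //; exact/measurable_EFinP.
  by apply: ae2S aw => x h Gx; rewrite /= h.
split => //.
have [m mE] : exists m : R, mu2 G = m%:E /\ 0 <= m.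
  exists (fine (mu2 G)); split; last exact: fine_ge0.
  by rewrite fineK// ge0_fin_numE.
suff key (d : R) : 0 < d -> `|\int[mu2]_(x in G) wpartial G i f x| <= d * (m + 1).
  apply/eqP; rewrite -normr_eq0; apply/eqP/le_anti; rewrite normr_ge0 andbT.
  apply/ler_addgt0Pr => e e0; rewrite add0r.
  have m1 : 0 < m + 1 by case: mE => _; lra.
  apply: le_trans (key (e / (m + 1)) _) _; first exact: divr_gt0.
  by rewrite divfK// gt_eqF.
move=> d0; have [phi tphi hphi] := app _ (exprn_gt0 2 d0).
pose W x := wpartial G i f x - partial i phi x.
have idphi : mu2.-integrable G (EFin \o partial i phi).
  exact: integrableS measurableT mG (@subsetT _ G) (test_fun_integrable (test_fun_partial i tphi)).
have iWB : mu2.-integrable G (EFin \o W) := integrableB mG iW idphi.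
have e0 : \int[mu2]_(x in G) wpartial G i f x = \int[mu2]_(x in G) W x.
  rewrite RintegralB// [X in _ - X](_ : _ = 0) ?subr0//.
  have [K [cK KG phi0]] := (test_fun_partial i tphi).2.
  by rewrite (Rintegral_support KG phi0) (integral_partial0 i tphi).
have mW2 : measurable_fun G W by case/integrableP: iWB => /measurable_EFinP.
have wB := is_wpartialB_test oG wg tphi.
have mX f1 : measurable_fun G f1 -> measurable_fun G (fun x => (f1 x ^+ 2)%:E).
  by move=> mf1; apply/measurable_EFinP; exact: measurable_funX.
have W2 : (\int[mu2]_(x in G) (W x ^+ 2)%:E < (d ^+ 2)%:E)%E.
  apply: le_lt_trans hphi; rewrite /H1sqnorm.
  have wk k : measurable_fun G (wpartial G k (fun x => f x - phi x)).
    by have [gk wgk _] := Hf k; exact: wpartial_measurable (is_wpartialB_test oG wgk tphi).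
  rewrite (@ge0_ae_eq_integral _ _ _ mu2 G _
      (fun x => (wpartial G i (fun x => f x - phi x) x ^+ 2)%:E)) //; first last.
  - apply: ae2S (ae2I aw (wpartial_ae oG wB)) => x [h1 h2] Gx.
    by rewrite /W h1// h2.
  - by move=> x _; rewrite lee_fin sqr_ge0.
  - by move=> x _; rewrite lee_fin sqr_ge0.
  - exact: mX.
  - exact: mX.
  apply: ge0_le_integral => //.
  - by move=> x _; rewrite lee_fin sqr_ge0.
  - exact: mX.
  - apply/measurable_EFinP.
    have mf : measurable_fun G (fun x => f x - phi x).
      apply: measurable_funB; first by case: Lf.
      apply: measurable_funTS; apply: continuous_measurable_plane.
      exact: smooth_continuous (test_fun_smooth tphi).
    rewrite [X in measurable_fun _ X](_ : _ = (fun x => ((f x - phi x) ^+ 2 +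
      (wpartial G ord0 (fun x => f x - phi x) x ^+ 2
      + wpartial G ord_max (fun x => f x - phi x) x ^+ 2)) * 1)); last first.
      by apply/funext => x; rewrite sum2E.
    apply: measurable_funM => //; apply: measurable_funD; first exact: measurable_funX.
    by apply: measurable_funD; apply: measurable_funX; exact: wk.
  - move=> x _; rewrite lee_fin /unit_weight mulr1 sum2E.
    have aux (q1 q2 q3 : R) : q2 ^+ 2 <= q1 ^+ 2 + (q2 ^+ 2 + q3 ^+ 2) /\
        q3 ^+ 2 <= q1 ^+ 2 + (q2 ^+ 2 + q3 ^+ 2).
      by have := sqr_ge0 q1; have := sqr_ge0 q2; have := sqr_ge0 q3; split; lra.
    by have [->|->] := ord2P i; [exact: (aux _ _ _).1|exact: (aux _ _ _).2].
have iabs := integrable_norm iWB.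
rewrite e0; apply: le_trans (le_normr_Rintegral mG iWB) _.
rewrite -lee_fin /Rintegral fineK; last exact: (integrable_fin_num mG iabs).
(* |W| <= d + W^2 / d stands in for the Cauchy-Schwarz inequality: as W^2 has integral below d^2,
   the total is at most d m + d, where m is the measure of G and d is arbitrary. *)
apply: (@le_trans _ _ (\int[mu2]_(x in G) (d%:E + d^-1%:E * (W x ^+ 2)%:E)%E)%E).
  apply: ge0_le_integral => //.
  - by case/integrableP: iabs.
  - apply: emeasurable_funD => //; apply: emeasurable_funM => //.
    exact: mX.
  - move=> x _; rewrite -EFinM -EFinD lee_fin.
    have h : d * `|W x| <= d * d + W x ^+ 2.
      rewrite -[X in _ <= _ + X]real_normK ?num_real//.
      by have := sqr_ge0 (`|W x| - d); have := sqr_ge0 (`|W x|); have := sqr_ge0 d; nra.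
    by rewrite -(ler_pM2l d0) mulrDr mulrA mulfV ?gt_eqF// mul1r.
rewrite ge0_integralD //; last 3 first.
- by move=> x _; rewrite lee_fin ltW.
- by move=> x _; rewrite -EFinM lee_fin mulr_ge0 ?sqr_ge0// invr_ge0 ltW.
- by apply: emeasurable_funM => //; apply/measurable_EFinP; exact: measurable_funX.
have icst : (\int[mu2]_(x in G) d%:E = d%:E * m%:E)%E.
  by rewrite integral_cst//; congr (_ * _)%E; exact: mE.1.
rewrite icst ge0_integralZl//; last 3 first.
- exact: mX.
- by move=> x _; rewrite lee_fin sqr_ge0.
- by rewrite lee_fin invr_ge0 ltW.
have -> : (d * (m + 1))%:E = (d%:E * m%:E + d^-1%:E * (d ^+ 2)%:E)%E.
  rewrite -!EFinM -EFinD; congr EFin; field; exact: lt0r_neq0.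
by apply: leeD => //; apply: lee_wpmul2l; [rewrite lee_fin invr_ge0 ltW|exact: ltW].
Qed.

End WeakIdentities.

Section WeakDivergence.
Context {R : realType}.
Implicit Types (G K : set (R * R)) (f g h phi p : R * R -> R) (u y : 'I_2 -> R * R -> R).
Local Notation mu2 := (@mu2 R).

Lemma open_mu2_gt0 G : open G -> G !=set0 -> (0 < mu2 G)%E.
Proof.
move=> oG [x Gx]; have /nbhs_square[e e0 he] : nbhs x G by exact: open_nbhs_nbhs.
apply: (@lt_le_trans _ _ (mu2 (square x e))); last first.
  by apply: le_measure; rewrite ?inE; [exact: measurable_square|exact: open_measurable_plane|].
by rewrite mu2_square ?ltW// lte_fin exprn_gt0// mulr_gt0.
Qed.

(* The constant needed to make [phi] an admissible [q] of zero mean does not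
   contribute, as weak derivatives of functions in [H10] have zero mean. *)
Lemma weak_divergence G y phi :
  open G -> (mu2 G < +oo)%E -> G !=set0 ->
  (forall k, H10 unit_weight G (y k)) ->
  (forall q, L2mod unit_weight G q -> bform G y q = 0) ->
  test_fun G phi ->
  \int[mu2]_x (y ord0 x * partial ord0 phi x)
  + \int[mu2]_x (y ord_max x * partial ord_max phi x) = 0.
Proof.
move=> oG G1 G0 hy eqn tphi; have mG := open_measurable_plane oG.
have cphi := smooth_continuous (test_fun_smooth tphi).
pose w i := wpartial G i (y i).
have iw i : mu2.-integrable G (EFin \o w i) := (H10_mean_wpartial i oG G1 (hy i)).1.
have w0 i : \int[mu2]_(x in G) w i x = 0 := (H10_mean_wpartial i oG G1 (hy i)).2.
have [m m0 mE] : exists2 m : R, 0 < m & mu2 G = m%:E.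
  exists (fine (mu2 G)); first by rewrite fine_gt0// open_mu2_gt0.
  by rewrite fineK// ge0_fin_numE.
have iphi : mu2.-integrable G (EFin \o phi).
  exact: integrableS measurableT mG (@subsetT _ G) (test_fun_integrable tphi).
pose c := (\int[mu2]_(x in G) phi x) / m.
have mc : measurable_fun G (cst c : R * R -> R) by exact: measurable_cst.
have ic : mu2.-integrable G (EFin \o cst c).
  apply: measurable_bounded_integrable => //.
  by exists `|c|; split=> [|B /ltW ? z _//]; exact: num_real.
have [B hB] : exists B, forall x, `|phi x| <= B.
  have [_ [K [cK KG phi0]]] := tphi; have [B hB] := continuous_bounded_on cK cphi.
  exists `|B| => x; have [Kx|nKx] := pselect (K x); first exact: le_trans (hB x Kx) (ler_norm _).
  by rewrite phi0// normr0.
pose q x := phi x - c.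
have mq : measurable_fun G q.
  by apply: measurable_funB => //; apply: measurable_funTS; exact: continuous_measurable_plane.
have qB x : `|q x| <= B + `|c| by apply: le_trans (ler_normB _ _) _; rewrite lerD2r.
have Lq : L2mod unit_weight G q.
  split; last first.
    rewrite /q RintegralB// Rintegral_cst// [X in fine X](_ : _ = m%:E) //=.
    by rewrite /c divfK ?subrr// gt_eqF.
  split => //; have i2 : mu2.-integrable G (EFin \o (fun x => q x ^+ 2)).
    apply: measurable_bounded_integrable => //; first exact: measurable_funX.
    exists ((B + `|c|) ^+ 2); split=> [|D /ltW BD z _]; first exact: num_real.
    apply: le_trans BD.
    by rewrite normrX lerXn2r ?nnegrE// (le_trans _ (qB z)).
  case/integrableP: i2 => _; apply: le_lt_trans; rewrite le_eqVlt; apply/orP; left; apply/eqP.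
  by apply: eq_integral => x _; rewrite /= /unit_weight mulr1 ger0_norm ?sqr_ge0.
have iqw i : mu2.-integrable G (EFin \o (fun x => q x * w i x)).
  apply: (integrableMr mG mq _ (iw i)).
  exists (B + `|c|); split; first exact: num_real.
  by move=> D /ltW BD z _; exact: le_trans (qB z) BD.
have ipw i : mu2.-integrable G (EFin \o (fun x => phi x * w i x)).
  apply: (integrableMr mG _ _ (iw i)).
    by apply: measurable_funTS; exact: continuous_measurable_plane.
  exists B; split; first exact: num_real.
  by move=> D /ltW BD z _; exact: le_trans (hB z) BD.
have icw i : mu2.-integrable G (EFin \o (fun x => c * w i x)) := integrableZl mG c (iw i).
have qw i : \int[mu2]_(x in G) (q x * w i x) = - \int[mu2]_x (y i x * partial i phi x).
  transitivity (\int[mu2]_(x in G) (phi x * w i x - c * w i x)).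
    by apply: eq_Rintegral => x _; rewrite /q mulrBl.
  rewrite RintegralB// RintegralZl// w0 mulr0 subr0.
  have [g wg _] := (hy i).1.2 i.
  have [lw hw] := wpartialP wg.
  rewrite -(wpartial_test_int oG wg tphi).2.
  have [_ [K [cK KG phi0]]] := tphi.
  transitivity (\int[mu2]_(x in G) (w i x * phi x)).
    by apply: eq_Rintegral => x _; rewrite mulrC.
  by apply: (Rintegral_support KG) => x /phi0 ->; rewrite mulr0.
have := eqn q Lq; rewrite /bform.
have -> : \int[mu2]_(x in G) (q x * \sum_(i < 2) w i x) =
    (- \int[mu2]_x (y ord0 x * partial ord0 phi x))
    + (- \int[mu2]_x (y ord_max x * partial ord_max phi x)).
  transitivity (\int[mu2]_(x in G) (q x * w ord0 x + q x * w ord_max x)).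
    by apply: eq_Rintegral => x _; rewrite sum2E mulrDr.
  transitivity (\int[mu2]_(x in G) (q x * w ord0 x) + \int[mu2]_(x in G) (q x * w ord_max x)).
    by apply: RintegralD; [exact: mG|exact: iqw|exact: iqw].
  by congr (_ + _); exact: qw.
have alg (q1 q2 : R) : - (- q1 + - q2) = 0 -> q1 + q2 = 0.
  by rewrite -opprD opprK.
exact: alg.
Qed.

End WeakDivergence.

(** * Integrals of errors against bounded functions of small support *)

Section LpBounds.
Context {R : realType}.
Implicit Types (N K : set (R * R)) (e g psi : R * R -> R).
Local Notation mu2 := (@mu2 R).

(** [Lnorm] at infinity is an essential supremum only when the measure is not zero. *)
Lemma mu2T_gt0 : (0 < mu2 setT)%E.
Proof. by apply: open_mu2_gt0; [exact: openT|exists 0]. Qed.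

(** The integral of a nonnegative function is a supremum over the simple functions below it, hence
    monotone without measurability. This matters because the exact solution is measurable on the
    open domain, while a patch may touch the boundary. *)
Lemma ge0_le_integral_any (f1 f2 : R * R -> \bar R) :
  (forall x, 0 <= f1 x)%E -> (forall x, f1 x <= f2 x)%E ->
  (\int[mu2]_x f1 x <= \int[mu2]_x f2 x)%E.
Proof.
move=> f10 f12; rewrite !ge0_integralE//; last by move=> x _; exact: le_trans (f12 x).
apply: ereal_sup_le => _ [h hf <-]; exists h => // x; apply: le_trans (hf x) _.
by rewrite !patch_setT; exact: f12.
Qed.

Lemma gt0_le_poweR (r : R) (a b : \bar R) :
  0 <= r -> (0 <= a)%E -> (a <= b)%E -> (a `^ r <= b `^ r)%E.
Proof.
move=> r0 a0 ab; apply: gt0_ler_poweR => //; rewrite in_itv /= leey andbT //.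
exact: le_trans ab.
Qed.

Lemma Lp_norm2_mono N K e g : (forall x, K x -> N x /\ `|e x| <= `|g x|) ->
  (Lp_norm 2%:E K e <= Lp_norm 2%:E N g)%E.
Proof.
move=> H; rewrite /Lp_norm unlock /Lnorm.
have le1 x : (`|(EFin \o e \_ K) x| <= `|(EFin \o g \_ N) x|)%E.
  rewrite /= lee_fin !patchE; case: ifPn => [/set_mem/H[Nx eg]|_].
    by rewrite mem_set.
  by rewrite normr0.
apply: gt0_le_poweR => //; try (by apply: integral_ge0 => x _; exact: poweR_ge0).
apply: ge0_le_integral_any => x; first exact: poweR_ge0.
by apply: gt0_le_poweR => //; exact: abse_ge0.
Qed.

Lemma Lp_norm_ge0 (a : \bar R) N g : (0 <= Lp_norm a N g)%E.
Proof. exact: Lnorm_ge0. Qed.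

Lemma Lp_normy_ae N g :
  {ae mu2, forall x, N x -> (`|g x|%:E <= Lp_norm +oo N g)%E}.
Proof.
rewrite /Lp_norm unlock /Lnorm mu2T_gt0.
have := ess_sup_inf.ess_sup_ge mu2 (abse \o (EFin \o g \_ N)).
by apply: ae2S => x /= + Nx; rewrite patchE mem_set.
Qed.

Lemma Lp_normy_le N g (a : R) : 0 <= a -> (forall x, N x -> `|g x| <= a) ->
  (Lp_norm +oo N g <= a%:E)%E.
Proof.
move=> a0 H; rewrite /Lp_norm unlock /Lnorm mu2T_gt0; apply/ess_sup_inf.ess_supP.
by apply: aeW => x /=; rewrite patchE; case: ifPn => [/set_mem/H|_]; rewrite ?normr0 lee_fin.
Qed.

Lemma sup_bound_integral N K e psi (A S m : R) :
  measurable (K : set (plane R)) -> mu2 K = m%:E -> K `<=` N -> 0 <= A -> 0 <= S ->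
  {ae mu2, forall x, N x -> `|e x| <= A} ->
  (forall x, `|psi x| <= S) -> (forall x, ~ K x -> psi x = 0) ->
  mu2.-integrable setT (EFin \o (fun x => e x * psi x)) ->
  `|\int[mu2]_x (e x * psi x)| <= A * S * m.
Proof.
move=> mK Km KN A0 S0 eA psiS psi0 ii.
apply: le_trans (le_normr_Rintegral measurableT ii) _.
have iabs := integrable_norm ii.
rewrite -lee_fin /Rintegral fineK; last exact: (integrable_fin_num measurableT iabs).
apply: (@le_trans _ _ (\int[mu2]_x ((A * S) * \1_K x)%:E)%E).
  apply: ae_ge0_le_integral => //.
  - by case/integrableP: iabs.
  - by move=> x _; rewrite lee_fin !mulr_ge0// indicE.
  - by apply/measurable_EFinP; apply: measurable_funM => //; exact: measurable_indic.
  apply: ae2S eA => x h _; rewrite lee_fin indicE normrM.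
  case: (boolP (x \in K)) => [/set_mem Kx|/negP nK].
    by rewrite mulr1; apply: ler_pM => //; apply: h; exact: KN.
  by rewrite psi0 ?normr0 ?mulr0// => Kx; apply: nK; exact/mem_set.
have mA : (0 <= A * S) by rewrite mulr_ge0.
under eq_integral do rewrite EFinM.
have m1 : measurable_fun setT (fun x => (\1_K x : R)%:E).
  by apply/measurable_EFinP; exact: measurable_indic.
have p1 x : setT x -> (0 <= (\1_K x : R)%:E)%E by move=> _; rewrite lee_fin indicE.
rewrite ge0_integralZl//.
rewrite integral_indic// setIT [X in (_ * X)%E](_ : _ = m%:E)//.
Qed.

(** The Hoelder inequality is used on [K], where [e] is measurable; the passage to the norm of [g]
    on [N] is mere monotonicity. Here m is the square root of the area of [K]. *)
Lemma L2_bound_integral N K e g psi (B S m : R) :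
  measurable (K : set (plane R)) -> mu2 K = (m ^+ 2)%:E -> 0 <= m -> 0 <= S ->
  (forall x, K x -> N x /\ `|e x| <= `|g x|) -> Lp_norm 2%:E N g = B%:E ->
  measurable_fun K e -> measurable_fun setT psi ->
  (forall x, `|psi x| <= S) -> (forall x, ~ K x -> psi x = 0) ->
  mu2.-integrable setT (EFin \o (fun x => e x * psi x)) ->
  `|\int[mu2]_x (e x * psi x)| <= B * (S * m).
Proof.
move=> mK Km m0 S0 H gB me mpsi psiS psi0 ii.
apply: le_trans (le_normr_Rintegral measurableT ii) _.
have iabs := integrable_norm ii.
rewrite -lee_fin /Rintegral fineK; last exact: (integrable_fin_num measurableT iabs).
have meK : measurable_fun setT (e \_ K) by exact/(measurable_restrictT _ _).1.
have := @hoelder _ _ _ mu2 (e \_ K) psi 2 2 meK mpsi (ltr0n _ 2) (ltr0n _ 2).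
have h2 : (2^-1 + 2^-1 : R) = 1 by field.
move=> /(_ h2); rewrite Lnorm1 => hh.
have -> : (\int[mu2]_x (`|e x * psi x|)%:E = \int[mu2]_x `|(EFin \o ((e \_ K) \* psi)%R) x|)%E.
  apply: eq_integral => x _ /=; rewrite patchE; case: ifPn => // /negP nK.
  by rewrite psi0 ?mulr0// => Kx; apply: nK; exact/mem_set.
apply: (le_trans hh); rewrite EFinM.
apply: lee_pmul; try exact: Lnorm_ge0.
  by rewrite -gB; exact: (@Lp_norm2_mono N K e g H).
rewrite unlock /Lnorm.
have -> : (S * m)%:E = (((S * m) ^+ 2)%:E `^ 2^-1)%E.
  rewrite poweR_EFin -powR_mulrn ?mulr_ge0// -powRrM mulfV ?powRr1// mulr_ge0//.
apply: gt0_le_poweR => //; try (by apply: integral_ge0 => x _; exact: poweR_ge0).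
apply: (@le_trans _ _ (\int[mu2]_x (S ^+ 2 * \1_K x)%:E)%E).
  apply: ge0_le_integral_any => x; first exact: poweR_ge0.
  rewrite /= lee_fin powR_mulrn// indicE.
  case: (boolP (x \in K)) => [_|/negP nK].
    by rewrite mulr1 lerXn2r ?nnegrE.
  by rewrite psi0 ?normr0 ?expr0n ?mulr0// => Kx; apply: nK; exact/mem_set.
under eq_integral do rewrite EFinM.
have m1 : measurable_fun setT (fun x => (\1_K x : R)%:E).
  by apply/measurable_EFinP; exact: measurable_indic.
have p1 x : setT x -> (0 <= (\1_K x : R)%:E)%E by move=> _; rewrite lee_fin indicE.
rewrite ge0_integralZl ?lee_fin ?sqr_ge0//.
by rewrite integral_indic// setIT [X in (_ * X)%E](_ : _ = (m ^+ 2)%:E)// -EFinM exprMn.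
Qed.

End LpBounds.

(** * Piecewise quadratic functions against tensor products *)

Section CoreEstimate.
Context {R : realType}.
Implicit Types (G N : set (R * R)) (g k : R -> R) (f e phi : R * R -> R).
Implicit Types (c : bool -> nat -> R).
Local Notation mu2 := (@mu2 R).
Variables (b : bool) (s : R) (M : R * R) (r : R).
Hypotheses (r0 : 0 < r) (s1 : `|s| <= 1).
Local Notation xi := (frame_xi b M r).
Local Notation ta := (frame_ta b s M r).
Local Notation tens := (frame_tensor b s M r).
Local Notation al := (grad_xi b r).
Local Notation be := (grad_ta b s r).
Local Notation K := (square M (2 * r)).

Definition piecewise c (x : R * R) : R := frame_quad b s M r (c (0 <= ta x)) x.

Definition piecewise_moment c g k : R :=
  quad_moment (c true) g (halfline true k) + quad_moment (c false) g (halfline false k).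

(** The side of the line depends on ta alone, so it can be recorded in the profile [k] instead of in
    the coefficients; each half is then a plain quadratic against a tensor product. *)
Lemma piecewise_has_int c g k : boxfun g -> boxfun k ->
  has_int mu2 (fun x => piecewise c x * tens g k x) (r ^+ 2 * piecewise_moment c g k).
Proof.
move=> bg bk.
have ht := frame_quad_has_int b M (c true) r0 s1 bg (boxfun_half true bk).
have hf := frame_quad_has_int b M (c false) r0 s1 bg (boxfun_half false bk).
apply: has_int_eq (has_intD ht hf) => [x|]; last by rewrite -mulrDr.
rewrite /piecewise /frame_tensor /halfline /=.
by case: (0 <= ta x); rewrite /= !mulr0 ?addr0 ?add0r.
Qed.

Lemma frame_quad_measurable (c : nat -> R) : measurable_fun setT (frame_quad b s M r c).
Proof.
have mx := continuous_measurable_plane (affine_grad_continuous (frame_xi_affine b M r)).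
have mt := continuous_measurable_plane (affine_grad_continuous (frame_ta_affine b s M r)).
have mc (a : R) f : measurable_fun setT f -> measurable_fun setT (fun x => a * f x).
  by move=> mf; apply: measurable_funM => //; exact: measurable_cst.
rewrite /frame_quad /quad.
apply: measurable_funD; last by apply: (mc); exact: measurable_funX.
apply: measurable_funD; last by apply: (mc); exact: measurable_funM.
apply: measurable_funD; last by apply: (mc); exact: measurable_funX.
apply: measurable_funD; last exact: (mc).
by apply: measurable_funD; [exact: measurable_cst|exact: (mc)].
Qed.

Lemma piecewise_measurable c : measurable_fun setT (piecewise c).
Proof.
have mt := continuous_measurable_plane (affine_grad_continuous (frame_ta_affine b s M r)).
have -> : piecewise c = fun x => if 0 <= ta x then frame_quad b s M r (c true) x
    else frame_quad b s M r (c false) x.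
  by apply/funext => x; rewrite /piecewise; case: (0 <= ta x).
apply: measurable_fun_ifT; try exact: frame_quad_measurable.
by apply: measurable_fun_ler => //; exact: measurable_cst.
Qed.

Lemma frame_tensor_test G g k : K `<=` G -> line_test g -> line_test k ->
  test_fun G (tens g k).
Proof.
move=> KG [sg g0] [sk k0]; split; first exact: frame_tensor_smooth.
exists K; split => //; first exact: square_compact.
by move=> x; exact: frame_tensor_support.
Qed.

Definition bounded_jet (L : R) g := forall t,
  [/\ `|g t| <= L, `|g^`()%classic t| <= L & `|g^`()%classic^`()%classic t| <= L].

Lemma grad_xi_le i : `|al i| <= r^-1.
Proof.
rewrite /grad_xi normrM [X in _ * X]gtr0_norm ?invr_gt0// ler_piMl ?invr_ge0 ?(ltW r0)//.
by case: ifP => _; [rewrite normr1|rewrite normr0 ler01].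
Qed.

Lemma grad_ta_le i : `|be i| <= r^-1.
Proof.
rewrite /grad_ta normrM [X in _ * X]gtr0_norm ?invr_gt0// ler_piMl ?invr_ge0 ?(ltW r0)//.
by case: ifP => _; [rewrite normrN|rewrite normr1].
Qed.

Lemma partial_tens_le i g k (L : R) x : 0 <= L -> line_smooth g -> line_smooth k ->
  (forall t, `|g t| <= L /\ `|g^`()%classic t| <= L) ->
  (forall t, `|k t| <= L /\ `|k^`()%classic t| <= L) ->
  `|partial i (tens g k) x| <= 2 * L ^+ 2 / r.
Proof.
move=> L0 sg sk gL kL; rewrite (partial_frame_tensor b s M r i sg sk).
apply: le_trans (ler_normD _ _) _.
have LL (q1 q2 : R) : `|q1| <= L -> `|q2| <= L -> `|q1 * q2| <= L ^+ 2.
  by move=> h1 h2; rewrite normrM expr2 ler_pM.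
have -> : 2 * L ^+ 2 / r = r^-1 * L ^+ 2 + r^-1 * L ^+ 2 by ring.
apply: lerD; rewrite normrM; apply: ler_pM => //.
- exact: grad_xi_le.
- by apply: LL; [exact: (gL _).2|exact: (kL _).1].
- exact: grad_ta_le.
- by apply: LL; [exact: (gL _).1|exact: (kL _).2].
Qed.

Lemma partial2_tens i g k : line_smooth g -> line_smooth k ->
  partial i (partial i (tens g k)) = fun x =>
    al i ^+ 2 * tens g^`()%classic^`()%classic k x
    + 2 * al i * be i * tens g^`()%classic k^`()%classic x
    + be i ^+ 2 * tens g k^`()%classic^`()%classic x.
Proof.
move=> sg sk; have dg := line_smooth_derive sg; have dk := line_smooth_derive sk.
rewrite (partial_frame_tensor b s M r i sg sk); apply: partial_is => x.
have D1 := smooth_is_derive i x (frame_tensor_smooth b s M r dg sk).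
have D2 := smooth_is_derive i x (frame_tensor_smooth b s M r sg dk).
have D : is_derive x (dir i) (fun x => al i * tens g^`()%classic k x + be i * tens g k^`()%classic x) _ :=
  is_deriveD (is_deriveZ (al i) D1) (is_deriveZ (be i) D2).
apply: (is_derive_eq D).
rewrite !(partial_frame_tensor b s M r i _ _) // /GRing.scale /=.
have alg (q1 q2 q3 q4 q5 : R) : q1 * (q1 * q3 + q2 * q4) + q2 * (q1 * q4 + q2 * q5)
  = q1 ^+ 2 * q3 + 2 * q1 * q2 * q4 + q2 ^+ 2 * q5 by ring.
exact: alg.
Qed.

Lemma partial2_tens_le i g k (L : R) x : 0 <= L -> line_smooth g -> line_smooth k ->
  bounded_jet L g -> bounded_jet L k ->
  `|partial i (partial i (tens g k)) x| <= 4 * L ^+ 2 / r ^+ 2.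
Proof.
move=> L0 sg sk gL kL; rewrite (partial2_tens i sg sk).
have LL (q1 q2 : R) : `|q1| <= L -> `|q2| <= L -> `|q1 * q2| <= L ^+ 2.
  by move=> h1 h2; rewrite normrM expr2 ler_pM.
have -> : 4 * L ^+ 2 / r ^+ 2 = r^-1 ^+ 2 * L ^+ 2 + 2 * r^-1 * r^-1 * L ^+ 2 + r^-1 ^+ 2 * L ^+ 2.
  by rewrite -exprVn; ring.
have [ga gb gc] := gL (xi x); have [ka kb kc] := kL (ta x).
have rv : 0 <= r^-1 by rewrite invr_ge0 ltW.
have h1 := grad_xi_le i; have h2 := grad_ta_le i.
have sq (q : R) : `|q| <= r^-1 -> `|q ^+ 2| <= r^-1 ^+ 2.
  by move=> hq; rewrite normrX lerXn2r ?nnegrE.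
have pr (q1 q2 : R) : `|q1| <= r^-1 -> `|q2| <= r^-1 -> `|2 * q1 * q2| <= 2 * r^-1 * r^-1.
  move=> hq1 hq2; rewrite !normrM (ger0_norm (ler0n _ 2)); apply: ler_pM => //.
  by apply: ler_pM.
have fin (q1 q2 q3 q4 q5 q6 : R) : `|q1| <= r^-1 ^+ 2 -> `|q2| <= 2 * r^-1 * r^-1 ->
    `|q3| <= r^-1 ^+ 2 -> `|q4| <= L ^+ 2 -> `|q5| <= L ^+ 2 -> `|q6| <= L ^+ 2 ->
    `|q1 * q4 + q2 * q5 + q3 * q6| <=
    r^-1 ^+ 2 * L ^+ 2 + 2 * r^-1 * r^-1 * L ^+ 2 + r^-1 ^+ 2 * L ^+ 2.
  move=> k1 k2 k3 k4 k5 k6; apply: le_trans (ler_normD _ _) _.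
  apply: lerD; last by rewrite normrM ler_pM.
  by apply: le_trans (ler_normD _ _) _; apply: lerD; rewrite normrM ler_pM.
exact: (fin _ _ _ _ _ _ (sq _ h1) (pr _ _ h1 h2) (sq _ h2) (LL _ _ gc ka) (LL _ _ gb kb) (LL _ _ ga kc)).
Qed.

Lemma norm_le_vnorm (w : 'I_2 -> R) (j : 'I_2) : `|w j| <= vnorm w.
Proof.
rewrite /vnorm -sqrtr_sqr ler_sqrt; last by rewrite sum2E addr_ge0 ?sqr_ge0.
by rewrite sum2E; have [->|->] := ord2P j; rewrite ?lerDl ?lerDr sqr_ge0.
Qed.

Lemma vnorm_ge0 (w : 'I_2 -> R) : 0 <= vnorm w.
Proof. exact: sqrtr_ge0. Qed.

Lemma vnorm_le (w : 'I_2 -> R) (a : R) : (forall j, `|w j| <= a) -> vnorm w <= 2 * a.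
Proof.
move=> wa; have a0 : 0 <= a by exact: le_trans (wa ord0).
rewrite /vnorm -[2 * a]ger0_norm ?mulr_ge0// -sqrtr_sqr ler_sqrt ?sqr_ge0// sum2E.
have sq j : w j ^+ 2 <= a ^+ 2 by rewrite -[w j ^+ 2]real_normK ?num_real// lerXn2r ?nnegrE.
have := sq ord0; have := sq ord_max; have := sqr_ge0 a.
move: (w ord0 ^+ 2) (w ord_max ^+ 2) => q1 q2; rewrite exprMn; lra.
Qed.

Lemma partial_piecewise_has_int i c g k : line_test g -> line_test k ->
  has_int mu2 (fun x => piecewise c x * partial i (tens g k) x)
    (r ^+ 2 * (al i * piecewise_moment c g^`()%classic k
               + be i * piecewise_moment c g k^`()%classic)).
Proof.
move=> tg tk; have bg := line_test_boxfun tg; have bk := line_test_boxfun tk.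
have bdg := line_test_boxfun (line_test_derive tg).
have bdk := line_test_boxfun (line_test_derive tk).
have h1 := has_intZ (al i) (piecewise_has_int c bdg bk).
have h2 := has_intZ (be i) (piecewise_has_int c bg bdk).
apply: has_int_eq (has_intD h1 h2) => [x|].
  rewrite (partial_frame_tensor b s M r i tg.1 tk.1) /=.
  have alg (q1 q2 q3 q4 q5 : R) : q1 * (q2 * q3) + q4 * (q2 * q5) = q2 * (q1 * q3 + q4 * q5) by ring.
  exact: alg.
have alg (q1 q2 q3 q4 q5 : R) : q1 * (q2 * q3) + q4 * (q2 * q5) = q2 * (q1 * q3 + q4 * q5) by ring.
exact: alg.
Qed.

Lemma partial2_piecewise_has_int i c g k : line_test g -> line_test k ->
  has_int mu2 (fun x => piecewise c x * partial i (partial i (tens g k)) x)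
    (r ^+ 2 * (al i ^+ 2 * piecewise_moment c g^`()%classic^`()%classic k
               + 2 * al i * be i * piecewise_moment c g^`()%classic k^`()%classic
               + be i ^+ 2 * piecewise_moment c g k^`()%classic^`()%classic)).
Proof.
move=> tg tk; have bg := line_test_boxfun tg; have bk := line_test_boxfun tk.
have dg := line_test_derive tg; have dk := line_test_derive tk.
have h1 := has_intZ (al i ^+ 2) (piecewise_has_int c (line_test_boxfun (line_test_derive dg)) bk).
have h2 := has_intZ (2 * al i * be i) (piecewise_has_int c (line_test_boxfun dg) (line_test_boxfun dk)).
have h3 := has_intZ (be i ^+ 2) (piecewise_has_int c bg (line_test_boxfun (line_test_derive dk))).
have alg (q1 q2 q3 q4 q5 q6 q7 : R) : q1 * (q2 * q3) + q4 * (q2 * q5) + q6 * (q2 * q7)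
  = q2 * (q1 * q3 + q4 * q5 + q6 * q7) by ring.
apply: has_int_eq (has_intD (has_intD h1 h2) h3) => [x|]; last exact: alg.
by rewrite (partial2_tens i tg.1 tk.1) /=; exact: alg.
Qed.

End CoreEstimate.

(** * Moment calculus on the coefficients of quadratics *)

Section Coefficients.
Context {R : realType}.
Implicit Types (g k : R -> R) (c : nat -> R).

(** Integration by parts read on coefficients: a derivative of the profile becomes a derivative of
    the quadratic. *)
Lemma quad_moment_dxi c g k : line_test g ->
  quad_moment c g^`()%classic k = - quad_moment (quad_dxi c) g k.
Proof.
move=> tg; rewrite /quad_moment /quad_dxi moment0_derive// !momentS_derive//=; ring.
Qed.

Lemma quad_moment_dta c g k : line_test k ->
  quad_moment c g k^`()%classic = - quad_moment (quad_dta c) g k.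
Proof.
move=> tk; rewrite /quad_moment /quad_dta moment0_derive// !momentS_derive//=; ring.
Qed.

Lemma piecewise_moment_cst c g k : line_test k ->
  piecewise_moment (fun=> c) g k = quad_moment c g k.
Proof.
move=> tk; have h i := moment_halves i (line_test_boxfun tk).
rewrite /piecewise_moment /quad_moment !h; ring.
Qed.

Variables (psi : nat -> R -> R).
Hypothesis psiP : forall l, (l <= 2)%N ->
  line_test (psi l) /\ forall k : nat, (k <= 2)%N -> moment k (psi l) = (k == l)%:R.

Definition coef_xi (n : nat) : nat := nth 0%N [:: 0; 1; 0; 2; 1; 0]%N n.
Definition coef_ta (n : nat) : nat := nth 0%N [:: 0; 0; 1; 0; 1; 2]%N n.

(* The six monomials of [quad] are [xi ^ coef_xi n * ta ^ coef_ta n]. *)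
Lemma quad_moment_dual c n : (n <= 5)%N ->
  quad_moment c (psi (coef_xi n)) (psi (coef_ta n)) = c n.
Proof.
have m l (k : nat) : (l <= 2)%N -> (k <= 2)%N -> moment k (psi l) = (k == l)%:R.
  by move=> l2 k2; have [_ ->] := psiP l2.
by move: n => [|[|[|[|[|[|//]]]]]] _; rewrite /quad_moment /coef_xi /coef_ta /= !m //=; ring.
Qed.

Lemma coef_xi_le n : (coef_xi n <= 2)%N.
Proof. by move: n => [|[|[|[|[|[|n]]]]]]; rewrite /coef_xi //= nth_nil. Qed.

Lemma coef_ta_le n : (coef_ta n <= 2)%N.
Proof. by move: n => [|[|[|[|[|[|n]]]]]]; rewrite /coef_ta //= nth_nil. Qed.

Variable chi : R -> R.
Hypotheses (tchi : line_test chi) (chi0 : chi 0 = 1)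
  (mchi : forall b (k : nat), (k <= 2)%N -> moment k (halfline b chi) = 0).

Lemma half_moment_chi' b (k : nat) : (k <= 2)%N ->
  moment k (halfline b chi^`()%classic) =
  if k == 0%N then (if b then -1 else 1) else 0.
Proof.
case: k => [|k] k2 /=; first by rewrite moment0_half_derive// chi0.
by rewrite momentS_half_derive// mchi ?mulr0 ?oppr0// ltnW.
Qed.

Lemma half_moment_chi'' b (k : nat) : (k <= 2)%N ->
  moment k (halfline b chi^`()%classic^`()%classic) =
  if k == 0%N then (if b then - chi^`()%classic 0 else chi^`()%classic 0)
  else if k == 1%N then (if b then 1 else -1) else 0.
Proof.
have td := line_test_derive tchi.
case: k => [|k] k2 /=; first by rewrite moment0_half_derive.
rewrite momentS_half_derive// half_moment_chi'; last by rewrite ltnW.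
by case: k k2 => [|k] k2; rewrite /= ?mulr0 ?oppr0// mul1r; case: b; rewrite ?opprK.
Qed.

Variables (c : bool -> nat -> R) (g : R -> R).

Lemma piecewise_moment_chi : piecewise_moment c g chi = 0.
Proof. by rewrite /piecewise_moment /quad_moment !mchi//; ring. Qed.

(** On ta = 0 only the monomials 1, xi and xi^2 survive: this is continuity across the line. *)
Hypothesis cont : [/\ c true 0%N = c false 0%N, c true 1%N = c false 1%N &
                      c true 3%N = c false 3%N].

(** On the half lines chi' has opposite moments of order 0 and no others up to order 2; those of
    order 0 meet only the monomials free of ta, which continuity makes cancel. *)
Lemma piecewise_moment_chi' : piecewise_moment c g chi^`()%classic = 0.
Proof.
case: cont => e0 e1 e3.
by rewrite /piecewise_moment /quad_moment !half_moment_chi'//= e0 e1 e3; ring.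
Qed.

(** Order 0 cancels by continuity, whatever the slope of chi at 0. The moments of order 1 are 1 and
    -1, which leaves the jump of the derivative in ta on the line, affine in xi with coefficients
    number 2 and 4. *)
Lemma piecewise_moment_chi'' : piecewise_moment c g chi^`()%classic^`()%classic =
  (c true 2%N - c false 2%N) * moment 0 g + (c true 4%N - c false 4%N) * moment 1 g.
Proof.
case: cont => e0 e1 e3.
by rewrite /piecewise_moment /quad_moment !half_moment_chi''//= e0 e1 e3; ring.
Qed.

End Coefficients.

Section FrameCoefficients.
Context {R : realType}.
Variables (b : bool) (s : R) (M : R * R) (r : R).
Implicit Types (c cu cp : nat -> R) (cy : 'I_2 -> nat -> R).
Local Notation al := (grad_xi b r).
Local Notation be := (grad_ta b s r).

(** One summand of the Laplacian: the second derivative in the direction [dir i]. *)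
Definition lap_coef c (i : 'I_2) (n : nat) : R :=
  al i ^+ 2 * quad_dxi (quad_dxi c) n + 2 * al i * be i * quad_dta (quad_dxi c) n
  + be i ^+ 2 * quad_dta (quad_dta c) n.

Definition grad_coef c (i : 'I_2) (n : nat) : R :=
  al i * quad_dxi c n + be i * quad_dta c n.

Definition residual_coef c cp cu (j : 'I_2) (n : nat) : R :=
  cu n + (lap_coef c ord0 n + lap_coef c ord_max n) - grad_coef cp j n.

Lemma partial_frame_quadE c i :
  partial i (frame_quad b s M r c) = frame_quad b s M r (grad_coef c i).
Proof.
rewrite partial_frame_quad; apply/funext => x.
by rewrite /frame_quad /quad /grad_coef; ring.
Qed.

Lemma partial2_frame_quadE c i :
  partial i (partial i (frame_quad b s M r c)) = frame_quad b s M r (lap_coef c i).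
Proof.
rewrite !partial_frame_quadE; apply/funext => x.
by rewrite /frame_quad /quad /grad_coef /lap_coef /quad_dxi /quad_dta; ring.
Qed.

Lemma quad_momentD c c' (g k : R -> R) :
  quad_moment (fun n => c n + c' n) g k = quad_moment c g k + quad_moment c' g k.
Proof. by rewrite /quad_moment; ring. Qed.

Lemma quad_momentZ c (a : R) (g k : R -> R) :
  quad_moment (fun n => a * c n) g k = a * quad_moment c g k.
Proof. by rewrite /quad_moment; ring. Qed.

Lemma quad_moment_lap c i (g k : R -> R) : line_test g -> line_test k ->
  al i ^+ 2 * quad_moment c g^`()%classic^`()%classic k
  + 2 * al i * be i * quad_moment c g^`()%classic k^`()%classic
  + be i ^+ 2 * quad_moment c g k^`()%classic^`()%classic =
  quad_moment (lap_coef c i) g k.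
Proof.
move=> tg tk; have dg := line_test_derive tg; have dk := line_test_derive tk.
rewrite /lap_coef (quad_momentD (fun n => _ + _)) quad_momentD !quad_momentZ.
rewrite (quad_moment_dxi c k dg) (quad_moment_dxi _ k tg) opprK.
rewrite (quad_moment_dxi c _ tg) (quad_moment_dta _ g tk) opprK.
by rewrite (quad_moment_dta c g dk) (quad_moment_dta _ g tk) opprK.
Qed.

Lemma quad_moment_grad c i (g k : R -> R) : line_test g -> line_test k ->
  al i * quad_moment c g^`()%classic k + be i * quad_moment c g k^`()%classic =
  - quad_moment (grad_coef c i) g k.
Proof.
move=> tg tk; rewrite /grad_coef quad_momentD !quad_momentZ.
by rewrite (quad_moment_dxi c k tg) (quad_moment_dta c g tk); ring.
Qed.

Lemma frame_quad_le c (a rho : R) x : 1 <= rho -> 0 <= a ->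
  (forall n, (n <= 5)%N -> `|c n| <= a) ->
  `|frame_xi b M r x| <= rho -> `|frame_ta b s M r x| <= rho ->
  `|frame_quad b s M r c x| <= 6 * a * rho ^+ 2.
Proof.
move=> rho1 a0 ca; rewrite /frame_quad /quad.
move: (frame_xi _ _ _ _) (frame_ta _ _ _ _ _) => u v hu hv.
have rr : 1 <= rho ^+ 2 by rewrite exprn_ege1.
have r0 : 0 <= rho by lra.
have T n (w : R) : (n <= 5)%N -> `|w| <= rho ^+ 2 -> `|c n * w| <= a * rho ^+ 2.
  by move=> n5 hw; rewrite normrM ler_pM// ca.
have lin (w : R) : `|w| <= rho -> `|w| <= rho ^+ 2 by move=> hw; nra.
have pr (w w' : R) : `|w| <= rho -> `|w'| <= rho -> `|w * w'| <= rho ^+ 2.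
  by move=> hw hw'; rewrite normrM expr2 ler_pM.
have -> : 6 * a * rho ^+ 2 = a * rho ^+ 2 + a * rho ^+ 2 + a * rho ^+ 2 + a * rho ^+ 2
  + a * rho ^+ 2 + a * rho ^+ 2 by ring.
have c0 : `|c 0%N| <= a * rho ^+ 2.
  by apply: le_trans (ca 0%N isT) _; rewrite ler_peMr.
have c1 := T 1%N u isT (lin _ hu).
have c2 := T 2%N v isT (lin _ hv).
have c3 : `|c 3%N * u ^+ 2| <= _ := T 3%N (u * u) isT (pr _ _ hu hu).
have c4 := T 4%N (u * v) isT (pr _ _ hu hv).
have c5 : `|c 5%N * v ^+ 2| <= _ := T 5%N (v * v) isT (pr _ _ hv hv).
by do 5! (apply: le_trans (ler_normD _ _) _; apply: lerD => //).
Qed.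

End FrameCoefficients.

(** * Triangles and pairs of adjacent triangles *)

Section Triangles.
Context {R : realType}.
Implicit Types (x y A B C M : R * R) (T S Om : set (R * R)).

Lemma dotE x y : dot x y = x.1 * y.1 + x.2 * y.2.
Proof. by rewrite /dot sum2E /crd. Qed.

Lemma eucl_distE x y :
  eucl_dist x y = Num.sqrt ((x.1 - y.1) ^+ 2 + (x.2 - y.2) ^+ 2).
Proof. by rewrite /eucl_dist dotE -!expr2. Qed.

Lemma eucl_dist_ge x y : `|x.1 - y.1| <= eucl_dist x y /\ `|x.2 - y.2| <= eucl_dist x y.
Proof.
have h (p q : R) : `|p| <= Num.sqrt (p ^+ 2 + q ^+ 2).
  by rewrite -sqrtr_sqr ler_wsqrtr// lerDl sqr_ge0.
by rewrite eucl_distE; split; [exact: h|rewrite [X in Num.sqrt X]addrC; exact: h].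
Qed.

Lemma eucl_dist_le x y : eucl_dist x y <= `|x.1 - y.1| + `|x.2 - y.2|.
Proof.
rewrite eucl_distE -[leRHS]ger0_norm ?addr_ge0// -sqrtr_sqr ler_wsqrtr//.
rewrite -[(x.1 - y.1) ^+ 2]real_normK ?num_real// -[(x.2 - y.2) ^+ 2]real_normK ?num_real//.
move: (normr_ge0 (x.1 - y.1)) (normr_ge0 (x.2 - y.2)).
by move: (`|x.1 - y.1|) (`|x.2 - y.2|) => p q p0 q0; nra.
Qed.

(** Barycentric coordinates as quotients of signed areas; the one of C vanishes on the line AB, so
    its sign tells the sides of that line apart. *)
Definition bary1 A B C x : R := dot (x - A) (perp (C - A)) / dot (B - A) (perp (C - A)).
Definition bary2 A B C x : R := - (dot (x - A) (perp (B - A)) / dot (B - A) (perp (C - A))).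
Definition bary0 A B C x : R := 1 - bary1 A B C x - bary2 A B C x.

Lemma simplexP T A B C x : simplex T A B C ->
  T x <-> [/\ 0 <= bary0 A B C x, 0 <= bary1 A B C x & 0 <= bary2 A B C x].
Proof.
move=> [D0 ->]; rewrite /bary0 /bary1 /bary2.
move: D0; rewrite !dotE /perp /=.
move: A B C x => [a1 a2] [b1 b2] [c1 c2] [x1 x2] /= D0.
split.
  move=> [s [t [s0 t0 st [-> ->]]]] /=.
  rewrite /GRing.scale /=.
  set D := _ + _ in D0 *.
  have -> : ((a1 + s * (b1 - a1) + t * (c1 - a1) - a1) * - (c2 - a2) +
    (a2 + s * (b2 - a2) + t * (c2 - a2) - a2) * (c1 - a1)) / D = s by rewrite /D; field.
  have -> : ((a1 + s * (b1 - a1) + t * (c1 - a1) - a1) * - (b2 - a2) +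
    (a2 + s * (b2 - a2) + t * (c2 - a2) - a2) * (b1 - a1)) / D = - t by rewrite /D; field.
  by rewrite opprK; split => //; lra.
set D := _ + _ in D0 *.
pose s := ((x1 - a1) * - (c2 - a2) + (x2 - a2) * (c1 - a1)) / D.
pose t := - (((x1 - a1) * - (b2 - a2) + (x2 - a2) * (b1 - a1)) / D).
rewrite -/s -/t => -[h0 h1 h2]; exists s, t; split => //.
  by move: (s) (t) h0 => s' t'; lra.
have e1 : x1 = a1 + s * (b1 - a1) + t * (c1 - a1) by rewrite /s /t /D; field.
have e2 : x2 = a2 + s * (b2 - a2) + t * (c2 - a2) by rewrite /s /t /D; field.
exact: f_equal2 e1 e2.
Qed.

Definition affine_with (f : R * R -> R) (g1 g2 : R) :=
  forall x y, f x - f y = g1 * (x.1 - y.1) + g2 * (x.2 - y.2).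

Lemma bary_affine A B C : exists g : 'I_3 -> R * R,
  [/\ affine_with (bary0 A B C) (g 0).1 (g 0).2,
      affine_with (bary1 A B C) (g 1).1 (g 1).2 &
      affine_with (bary2 A B C) (g 2%:R).1 (g 2%:R).2].
Proof.
set D := dot (B - A) (perp (C - A)).
pose g1 := (- (C.2 - A.2) / D, (C.1 - A.1) / D).
pose g2 := ((B.2 - A.2) / D, - (B.1 - A.1) / D).
exists (fun i => if i == 1 then g1 else if i == 2%:R then g2 else
   (- g1.1 - g2.1, - g1.2 - g2.2)).
by split => x y; rewrite /= /bary0 /bary1 /bary2 -/D /g1 /g2 !dotE /perp /=; ring.
Qed.

Lemma bary_vertices T A B C : simplex T A B C ->
  [/\ bary0 A B C A = 1 /\ bary0 A B C B = 0 /\ bary0 A B C C = 0,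
      bary1 A B C A = 0 /\ bary1 A B C B = 1 /\ bary1 A B C C = 0 &
      bary2 A B C A = 0 /\ bary2 A B C B = 0 /\ bary2 A B C C = 1].
Proof.
move=> [+ _]; rewrite /bary0 /bary1 /bary2 !dotE /perp.
move: A B C => [a1 a2] [b1 b2] [c1 c2] /= D0.
by do ?split; field.
Qed.

Lemma simplex_vertices T A B C : simplex T A B C -> [/\ T A, T B & T C].
Proof.
move=> sT; have [[a0 [a1 a2]] [b0 [b1 b2]] [c0 [c1 c2]]] := bary_vertices sT.
by split; apply/(simplexP _ sT); rewrite ?a0 ?a1 ?a2 ?b0 ?b1 ?b2 ?c0 ?c1 ?c2.
Qed.

Lemma simplex_bary_le1 T A B C x : simplex T A B C -> T x ->
  [/\ 0 <= bary0 A B C x <= 1, 0 <= bary1 A B C x <= 1 & 0 <= bary2 A B C x <= 1].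
Proof.
move=> sT /(simplexP _ sT); rewrite /bary0 => -[h0 h1 h2].
by split; apply/andP; split; lra.
Qed.

(** Along a diameter of the disc parallel to an axis, f changes by 2 rho times one component of its
    gradient and stays between 0 and 1. *)
Lemma affine_gradient_bound (f : R * R -> R) (g1 g2 rho : R) x0 T :
  affine_with f g1 g2 -> 0 < rho ->
  [set y | eucl_dist y x0 <= rho] `<=` T -> (forall x, T x -> 0 <= f x <= 1) ->
  2 * rho * `|g1| <= 1 /\ 2 * rho * `|g2| <= 1.
Proof.
move=> af rho0 bT f01.
have inT (u v : R) : u ^+ 2 + v ^+ 2 = rho ^+ 2 -> T (x0.1 + u, x0.2 + v).
  move=> uv; apply: bT; rewrite /= eucl_distE /=.
  by rewrite !(addrC x0.1, addrC x0.2) !addrK uv sqrtr_sqr ger0_norm// ltW.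
have p1 := f01 _ (inT rho 0 ltac:(by rewrite expr0n addr0)).
have m1 := f01 _ (inT (- rho) 0 ltac:(by rewrite sqrrN expr0n addr0)).
have p2 := f01 _ (inT 0 rho ltac:(by rewrite expr0n add0r)).
have m2 := f01 _ (inT 0 (- rho) ltac:(by rewrite sqrrN expr0n add0r)).
have a1 := af (x0.1 + rho, x0.2 + 0) (x0.1 - rho, x0.2 + 0).
have a2 := af (x0.1 + 0, x0.2 + rho) (x0.1 + 0, x0.2 - rho).
move: a1 a2; rewrite /= => a1 a2.
have e1 : f (x0.1 + rho, x0.2 + 0) - f (x0.1 - rho, x0.2 + 0) = 2 * rho * g1 by rewrite a1; ring.
have e2 : f (x0.1 + 0, x0.2 + rho) - f (x0.1 + 0, x0.2 - rho) = 2 * rho * g2 by rewrite a2; ring.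
have key (q p m : R) : 0 <= p <= 1 -> 0 <= m <= 1 -> p - m = 2 * rho * q -> 2 * rho * `|q| <= 1.
  move=> /andP[p0 p1'] /andP[m0 m1'] pm.
  have -> : 2 * rho * `|q| = `|2 * rho * q| by rewrite normrM (@ger0_norm _ (2 * rho))// mulr_ge0// ltW.
  by rewrite -pm ler_norml; apply/andP; split; lra.
by split; [exact: key p1 m1 e1|exact: key p2 m2 e2].
Qed.

Lemma affine_with_close (f : R * R -> R) (g1 g2 rho : R) x y :
  affine_with f g1 g2 -> 0 < rho -> 2 * rho * `|g1| <= 1 -> 2 * rho * `|g2| <= 1 ->
  2 * rho * `|f x - f y| <= `|x.1 - y.1| + `|x.2 - y.2|.
Proof.
move=> af rho0 h1 h2; rewrite af.
have := ler_normD (g1 * (x.1 - y.1)) (g2 * (x.2 - y.2)); rewrite !normrM.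
move: (normr_ge0 (x.1 - y.1)) (normr_ge0 (x.2 - y.2)).
move: (`|x.1 - y.1|) (`|x.2 - y.2|) (`|g1|) (`|g2|) h1 h2 (`|_ + _|) => p q k1 k2 h1 h2 w p0 q0 hw.
have h3 := ler_wpM2r p0 h1; have h4 := ler_wpM2r q0 h2.
have h5 := ler_wpM2l (ltW rho0) hw.
lra.
Qed.

Lemma simplex_bounded T A B C x y : simplex T A B C -> T x -> T y ->
  eucl_dist x y <= 2 * (`|B.1 - A.1| + `|C.1 - A.1| + `|B.2 - A.2| + `|C.2 - A.2|).
Proof.
move=> [_ ->] [s [t [s0 t0 st ->]]] [s' [t' [s0' t0' st' ->]]].
apply: le_trans (eucl_dist_le _ _) _; rewrite /= /GRing.scale /=.
have key (p q a : R) : `|a + s * p + t * q - (a + s' * p + t' * q)| <= 2 * (`|p| + `|q|).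
  have -> : a + s * p + t * q - (a + s' * p + t' * q) = (s - s') * p + (t - t') * q by ring.
  apply: le_trans (ler_normD _ _) _; rewrite !normrM.
  have h1 : `|s - s'| <= 1 by rewrite ler_norml; apply/andP; split; lra.
  have h2 : `|t - t'| <= 1 by rewrite ler_norml; apply/andP; split; lra.
  have := ler_wpM2r (normr_ge0 p) h1; have := ler_wpM2r (normr_ge0 q) h2.
  by have := normr_ge0 p; have := normr_ge0 q; lra.
have := key (B.1 - A.1) (C.1 - A.1) A.1; have := key (B.2 - A.2) (C.2 - A.2) A.2.
move: (`|_ - _|) (`|_ - _|) => u v; lra.
Qed.

Lemma le_diam T A B C x y : simplex T A B C -> T x -> T y -> eucl_dist x y <= diam T.
Proof.
move=> sT Tx Ty; apply: ub_le_sup; last by exists (x, y).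
exists (2 * (`|B.1 - A.1| + `|C.1 - A.1| + `|B.2 - A.2| + `|C.2 - A.2|)).
by move=> _ [[u v] /= [Tu Tv] <-]; exact: simplex_bounded sT Tu Tv.
Qed.

Lemma simplex_neq T A B C : simplex T A B C -> A <> B.
Proof.
move=> sT AB; have [_ [b0 [b1 b2]] _] := bary_vertices sT.
by move: b1; rewrite -[X in bary1 _ _ _ X]AB b0 => /esym/eqP; rewrite oner_eq0.
Qed.

Lemma diam_gt0 T A B C : simplex T A B C -> 0 < diam T.
Proof.
move=> sT; have [TA TB _] := simplex_vertices sT.
apply: lt_le_trans (le_diam sT TA TB).
have [h1 h2] := eucl_dist_ge A B; rewrite lt_neqAle sqrtr_ge0 andbT eq_sym.
apply/negP => /eqP e; apply: (simplex_neq sT).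
move: h1 h2; rewrite e !normr_le0 !subr_eq0 => /eqP e1 /eqP e2.
by rewrite [A]surjective_pairing [B]surjective_pairing e1 e2.
Qed.

(** The supremum of diameters in [inball_diam] need not be attained, but it exceeds diam / (2
    sigma), so some disc has at least this diameter: half of the expected size. *)
Lemma inscribed_disc T A B C (sigma : R) : simplex T A B C -> 1 <= sigma ->
  diam T <= sigma * inball_diam T ->
  exists x0, [set y | eucl_dist y x0 <= diam T / (4 * sigma)] `<=` T.
Proof.
move=> sT sg1 hsg; have d0 := diam_gt0 sT.
pose E := [set 2 * r | r in [set r | 0 <= r /\
         exists x, [set y | eucl_dist y x <= r] `<=` T]].
have [TA _ _] := simplex_vertices sT.
(* Without this the supremum would be the default 0. A disc of radius 0 at a vertex and the bound by
   twice the diameter provide it. *)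
have hs : has_sup E.
  split; first (exists (2 * 0); exists 0 => //; split => //; exists A => y /= hy).
    have [h1 h2] := eucl_dist_ge y A.
    have e1 := le_trans h1 hy; have e2 := le_trans h2 hy.
    move: e1 e2; rewrite !normr_le0 !subr_eq0 => /eqP e1 /eqP e2.
    by rewrite [y]surjective_pairing e1 e2 -surjective_pairing.
  exists (2 * diam T) => _ [q [/= q0 [x hx]] <-]; rewrite ler_pM2l//.
  have Tx : T x by apply: hx; rewrite /= eucl_distE !subrr expr0n addr0 sqrtr0.
  have Ty : T (x.1 + q, x.2).
    by apply: hx; rewrite /= eucl_distE /= subrr expr0n /= addr0 addrC addKr sqrtr_sqr ger0_norm.
  apply: le_trans (le_diam sT Ty Tx); have [+ _] := eucl_dist_ge (x.1 + q, x.2) x.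
  by rewrite /= addrC addKr ger0_norm.
have lt : diam T / (2 * sigma) < sup E.
  rewrite ltr_pdivrMr; last lra.
  have : diam T <= sigma * sup E := hsg.
  by move: (sup E) (diam T) d0 => S d d0 h; lra.
have e0 : 0 < sup E - diam T / (2 * sigma) by rewrite subr_gt0.
have [_ [q [q0 [x hx]] <-] hq] := sup_adherent e0 hs.
exists x => y /= hy; apply: hx => /=; apply: le_trans hy _.
have -> : diam T / (4 * sigma) = diam T / (2 * sigma) / 2 by field; lra.
by lra.
Qed.

End Triangles.

Section Adjacent.
Context {R : realType}.
Implicit Types (x y A B C M : R * R) (T S Om : set (R * R)).

(* Locally [Om] lies on one side of its boundary, so a neighbourhood of a
   boundary point is never contained in the closure of [Om]. *)
Lemma lipschitz_interior Om x (e0 : R) : open Om -> lipschitz_boundary Om -> 0 < e0 ->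
  square x e0 `<=` closure Om -> Om x.
Proof.
move=> oO lip e00 sub; apply: contrapT => nOx.
have cx : closure Om x by apply: sub; apply/squareP; rewrite !subrr normr0; split; exact: ltW.
have bx : boundary Om x by split=> // /interior_subset.
have [e [r [L [g [ee r0 lipg gr]]]]] := lip x bx.
have dxx : eucl_dist x x < r by rewrite eucl_distE !subrr expr0n addr0 sqrtr0.
have gx : dot x e <= g (dot x (perp e)).
  by rewrite leNgt; apply/negP => h; apply: nOx; apply/(gr x dxx).
pose ep := Num.min e0 (r / 8).
have ep0 : 0 < ep by rewrite lt_min e00 divr_gt0.
have epe : ep <= e0 by rewrite ge_min lexx.
have epr : ep <= r / 8 by rewrite ge_min lexx orbT.
have [e1 e2] : `|e.1| <= 1 /\ `|e.2| <= 1.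
  move: ee; rewrite dotE -!expr2 => ee.
  split; rewrite -(ler_pXn2r (n := 2))// ?nnegrE// expr1n real_normK ?num_real//.
    by have := sqr_ge0 e.2; lra.
  by have := sqr_ge0 e.1; lra.
(* A step of length ep straight down from x, which is on or below the graph: the abscissa is kept,
   the height drops by ep. The bound r/8 keeps all points close to y in the disc where the graph
   describes the set. *)
pose y := (x.1 - ep * e.1, x.2 - ep * e.2).
have epN (q : R) : `|q| <= 1 -> `|ep * q| <= ep.
  by move=> q1; rewrite normrM (gtr0_norm ep0) ler_piMr// ltW.
have cy : closure Om y.
  apply: sub; apply/squareP; rewrite /y /= !(addrC x.1, addrC x.2) !addrK !normrN.
  by split; exact: le_trans (epN _ _) epe.
(* A point z of the set this close to y is higher than y by at most 2 de, and the graph changes by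
   at most 2 de |L|: in all ep/2, too little to get above the graph. *)
pose de := ep / (4 * (1 + `|L|)).
have L0 : 0 <= `|L| by [].
have L1 : 0 < 4 * (1 + `|L|) by lra.
have de0 : 0 < de by rewrite divr_gt0.
have dee : de * (4 * (1 + `|L|)) = ep by rewrite /de divfK// gt_eqF.
have [z [Oz /squareP[z1 z2]]] := cy _ (square_nbhs de0 (fun _ => id)).
have deep : de * 4 <= ep.
  by rewrite -dee ler_pM2l// ler_peMr//; lra.
have dzx : eucl_dist z x < r.
  have h (q w v : R) : `|w| <= 1 -> `|q - (v - ep * w)| <= de -> `|q - v| <= de + ep.
    move=> /epN w1 qd; have -> : q - v = q - (v - ep * w) - ep * w by ring.
    by apply: (le_trans (ler_normB _ _)); exact: lerD.
  apply: (le_lt_trans (eucl_dist_le z x)).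
  by have := h _ _ _ e1 z1; have := h _ _ _ e2 z2; lra.
move/(gr z dzx): Oz.
have lz (q1 q2 : R) : `|q1| <= 1 -> `|q2| <= 1 ->
    `|(z.1 - y.1) * q1 + (z.2 - y.2) * q2| <= de + de.
  move=> hq1 hq2; apply: (le_trans (ler_normD _ _)).
  rewrite !normrM; apply: lerD; rewrite -[leRHS]mulr1; exact: ler_pM.
have ze : dot z e - dot y e <= de + de.
  apply: le_trans (ler_norm _) _.
  have -> : dot z e - dot y e = (z.1 - y.1) * e.1 + (z.2 - y.2) * e.2 by rewrite !dotE; ring.
  exact: lz.
have zp : `|dot z (perp e) - dot y (perp e)| <= de + de.
  have -> : dot z (perp e) - dot y (perp e) = (z.1 - y.1) * (- e.2) + (z.2 - y.2) * e.1.
    by rewrite !dotE /perp /=; ring.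
  by apply: lz; rewrite ?normrN.
have gl : `|g (dot z (perp e)) - g (dot y (perp e))| <= `|L| * (de + de).
  apply: (le_trans (lipg (dot z (perp e), dot y (perp e)) (conj I I))).
  apply: (le_trans (ler_wpM2r _ (ler_norm L))) => //.
  by apply: ler_wpM2l.
have yp : dot y (perp e) = dot x (perp e) by rewrite !dotE /perp /y /=; ring.
have ye : dot y e = dot x e - ep.
  have -> : dot y e = dot x e - ep * dot e e by rewrite !dotE /y /=; ring.
  by rewrite ee mulr1.
move: gl; rewrite yp => /lerNnormlW gl.
have alg (q w zq zw yw l d p : R) : 0 < p -> d * (4 * (1 + l)) = p ->
    - (l * (d + d)) <= zq - q -> w <= q -> zw - yw <= d + d -> yw = w - p -> zq < zw -> False.
  by move=> *; lra.
exact: alg ep0 dee gl gx ze ye.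
Qed.

Lemma plane_eq x y : x.1 = y.1 -> x.2 = y.2 -> x = y.
Proof. by case: x y => [x1 x2] [y1 y2] /= -> ->. Qed.

Lemma bounded_mu2_fin Om : open Om -> bounded_set Om -> (@mu2 R Om < +oo)%E.
Proof.
move=> oO [m [_ hm]].
have sub : Om `<=` square 0 (`|m| + 1).
  move=> x Ox; have hx : `|x| <= `|m| + 1.
    by apply: hm => //; apply: (le_lt_trans (ler_norm m)); rewrite ltrDl.
  apply/squareP; rewrite /= !subr0; split; apply: le_trans hx; rewrite prod_normE /=.
    by rewrite le_max lexx.
  by rewrite le_max lexx orbT.
apply: (@le_lt_trans _ _ (@mu2 R (square 0 (`|m| + 1)))).
  apply: le_measure => //; rewrite inE.
    exact: open_measurable_plane.
  exact: measurable_square.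
by rewrite mu2_square ?ltry// addr_ge0.
Qed.

Lemma affine_with_comb (f : R * R -> R) (g1 g2 : R) A B C (s t : R) :
  affine_with f g1 g2 ->
  f (A + s *: (B - A) + t *: (C - A)) = f A + s * (f B - f A) + t * (f C - f A).
Proof.
move=> af; rewrite (af B A) (af C A).
have := af (A + s *: (B - A) + t *: (C - A)) A.
rewrite /= /GRing.scale /= => e.
have -> : f (A + s *: (B - A) + t *: (C - A)) =
  f A + (f (A + s *: (B - A) + t *: (C - A)) - f A) by ring.
by rewrite e; ring.
Qed.

Lemma affine_simplex0 (f : R * R -> R) (g1 g2 : R) T A B C x : affine_with f g1 g2 ->
  simplex T A B C -> f A = 0 -> f B = 0 -> f C = 0 -> T x -> f x = 0.
Proof.
move=> af [_ ->] fA fB fC [s [t [_ _ _ ->]]].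
by rewrite (affine_with_comb _ _ _ _ _ af) fA fB fC; ring.
Qed.

(* Otherwise [T] and [T'] would share a point strictly inside [T] near the
   midpoint of [AB], which no case of conformity allows. *)
Lemma conforming_opposite Th T T' A B C C' (e : R) : conforming Th -> Th T -> Th T' ->
  T' <> T -> simplex T A B C -> simplex T' A B C' -> 0 < e ->
  let M := (2^-1 *: (A + B) : R * R) in
  (forall x, `|x.1 - M.1| + `|x.2 - M.2| <= e ->
     (T x <-> 0 <= bary2 A B C x) /\ (T' x <-> 0 <= bary2 A B C' x)) ->
  exists2 kappa, 0 < kappa & forall x, bary2 A B C' x = - kappa * bary2 A B C x.
Proof.
move=> cf hT hT' TT' sT sT' e0 M near.
pose D := dot (B - A) (perp (C - A)); pose D' := dot (B - A) (perp (C' - A)).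
have D0 : D != 0 by case: sT.
have D0' : D' != 0 by case: sT'.
have rel x : bary2 A B C' x = D / D' * bary2 A B C x.
  by rewrite /bary2 -/D -/D'; field; rewrite D0.
have [neg|] := ltP (D / D') 0.
  by exists (- (D / D')); rewrite ?oppr_gt0// => x; rewrite rel opprK.
rewrite le_eqVlt eq_sym mulf_eq0 invr_eq0 (negPf D0) (negPf D0') /= => pos; exfalso.
have [TA TB _] := simplex_vertices sT; have [TA' TB' _] := simplex_vertices sT'.
have AB := simplex_neq sT.
have [_ _ [a2 [b2 c2]]] := bary_vertices sT.
have [g [_ _ af]] := bary_affine A B C.
pose l := `|C.1 - M.1| + `|C.2 - M.2|.
have l0 : 0 <= l by rewrite addr_ge0.
(* P is taken on the median from M to C, near enough to M for the local description; if both
   triangles lay on the same side of AB, both would contain it. *)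
pose t := e / (e + l).
have t0 : 0 < t by rewrite divr_gt0// ltr_pwDl.
have tl : t * l <= e.
  by rewrite /t mulrAC ler_pdivrMr ?ltr_pwDl//; nra.
pose P := M + t *: (C - M).
have Mc : M = A + 2^-1 *: (B - A) + 0 *: (C - A).
  by apply: plane_eq; rewrite /M /= /GRing.scale /=; field.
have bM : bary2 A B C M = 0.
  by rewrite Mc (affine_with_comb _ _ _ _ _ af) a2 b2; ring.
have Pc : P = M + t *: (C - M) + 0 *: (C - M).
  by rewrite scale0r addr0.
have bP : bary2 A B C P = t.
  by rewrite Pc (affine_with_comb _ _ _ _ _ af) bM c2; ring.
have Pe : `|P.1 - M.1| + `|P.2 - M.2| <= e.
  have -> : P.1 - M.1 = t * (C.1 - M.1) by rewrite /P /= /GRing.scale /=; ring.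
  have -> : P.2 - M.2 = t * (C.2 - M.2) by rewrite /P /= /GRing.scale /=; ring.
  by rewrite !(normrM t) (gtr0_norm t0) -mulrDr.
have [TP TP'] := near P Pe.
have {}TP : T P by apply/TP; rewrite bP ltW.
have {}TP' : T' P by apply/TP'; rewrite rel bP mulr_ge0 ?ltW.
have inI x : T x -> T' x -> (T `&` T') x by [].
case: (cf T T' hT hT' (nesym TT')).
- by move=> e1; move: (inI _ TA TA'); rewrite e1.
- move=> [v [_ _ e1]]; move: (inI _ TA TA') (inI _ TB TB'); rewrite e1 /= => Av Bv.
  by apply: AB; rewrite Av Bv.
(* The coordinate of C1 vanishes on the common side, thus at A, B and P, then at M, and at C since P
   is on the open segment from M to C or at C. Being affine it vanishes on all of T, although it is
   1 at C1. *)
move=> [S [[A1 [B1 [C1 [s1 SE]]]] _ e1]].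
have [_ _ [a2' [b2' c2']]] := bary_vertices s1.
have [g' [_ _ af']] := bary_affine A1 B1 C1.
have z x : T x -> T' x -> bary2 A1 B1 C1 x = 0.
  move=> Tx Tx'; move: (inI _ Tx Tx'); rewrite e1 SE => -[q _ <-].
  have -> : A1 + q *: (B1 - A1) = A1 + q *: (B1 - A1) + 0 *: (C1 - A1).
    by rewrite scale0r addr0.
  by rewrite (affine_with_comb _ _ _ _ _ af') a2' b2'; ring.
have zA := z A TA TA'; have zB := z B TB TB'; have zP := z P TP TP'.
have zM : bary2 A1 B1 C1 M = 0.
  by rewrite Mc (affine_with_comb _ _ _ _ _ af') zA zB; ring.
have zC : bary2 A1 B1 C1 C = 0.
  move: zP; rewrite Pc (affine_with_comb _ _ _ _ _ af') zM subr0 add0r mul0r addr0.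
  by move=> /eqP; rewrite mulf_eq0 gt_eqF//= => /eqP.
have [_ _ TC1] := simplex_vertices s1.
have := affine_simplex0 af' sT zA zB zC TC1; rewrite c2' => /eqP.
by rewrite oner_eq0.
Qed.

End Adjacent.

(** * Geometry near the midpoint of a side *)

Section SideFrame.
Context {R : realType}.
Implicit Types (x y A B C M : R * R) (T S Om : set (R * R)).

Definition midpoint A B : R * R := 2^-1 *: (A + B).

Lemma midpointE A B : (midpoint A B).1 = (A.1 + B.1) / 2 /\ (midpoint A B).2 = (A.2 + B.2) / 2.
Proof. by split; rewrite /midpoint /= /GRing.scale /= mulrC. Qed.

(** At the midpoint the coordinates of A and B equal 1/2, and by [affine_gradient_bound] they lose
    at most 1/2 within distance rho; so only the sign of the third coordinate decides. *)
Lemma near_midpoint T A B C x0 (rho : R) x : simplex T A B C -> 0 < rho ->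
  [set y | eucl_dist y x0 <= rho] `<=` T ->
  `|x.1 - (midpoint A B).1| + `|x.2 - (midpoint A B).2| <= rho ->
  T x <-> 0 <= bary2 A B C x.
Proof.
move=> sT rho0 disc xM; rewrite (simplexP x sT).
have [g [af0 af1 _]] := bary_affine A B C.
have [[a0 [b0 _]] [a1 [b1 _]] _] := bary_vertices sT.
have half (f : R * R -> R) (g1 g2 : R) : affine_with f g1 g2 ->
    (forall y, T y -> 0 <= f y <= 1) -> f A + f B = 1 -> 0 <= f x.
  move=> af f01 fAB.
  have [h1 h2] := affine_gradient_bound af rho0 disc f01.
  have fM : f (midpoint A B) = 2^-1.
    have := af (midpoint A B) A; have := af (midpoint A B) B.
    have [-> ->] := midpointE A B => e1 e2.
    have alg (m p q u v w z : R) : m - q = g1 * ((u + v) / 2 - v) + g2 * ((w + z) / 2 - z) ->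
       m - p = g1 * ((u + v) / 2 - u) + g2 * ((w + z) / 2 - w) -> p + q = 1 -> m = 2^-1.
      by move=> *; lra.
    exact: alg e1 e2 fAB.
  have := affine_with_close x (midpoint A B) af rho0 h1 h2; rewrite fM => h3.
  have h4 := le_trans h3 xM.
  have : 2 * rho * `|f x - 2^-1| <= 2 * rho * 2^-1 by apply: (le_trans h4); lra.
  by rewrite ler_pM2l ?mulr_gt0// ler_distl => /andP[+ _]; rewrite subrr.
have h0 : 0 <= bary0 A B C x.
  by apply: half af0 _ _ => [y /(simplex_bary_le1 sT)[]//|]; rewrite a0 b0 addr0.
have h1 : 0 <= bary1 A B C x.
  by apply: half af1 _ _ => [y /(simplex_bary_le1 sT)[]//|]; rewrite a1 b1 add0r.
by split => [[]|].
Qed.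

(** The coordinate of B climbs from 0 to 1 along AB with a gradient controlled by rho. Through a
    common side this compares the sizes of neighbouring triangles. *)
Lemma side_length_ge T A B C x0 (rho : R) : simplex T A B C -> 0 < rho ->
  [set y | eucl_dist y x0 <= rho] `<=` T -> rho <= eucl_dist A B.
Proof.
move=> sT rho0 disc; have [g [_ af _]] := bary_affine A B C.
have [_ [a1 [b1 _]] _] := bary_vertices sT.
have [h1 h2] := affine_gradient_bound af rho0 disc
  (fun y Ty => let: And3 _ h _ := simplex_bary_le1 sT Ty in h).
have := affine_with_close A B af rho0 h1 h2; rewrite a1 b1 sub0r normrN1 mulr1.
by have [] := eucl_dist_ge A B; move: (eucl_dist _ _) => d *; lra.
Qed.

(** The axis of xi is the one along which B - A has its larger component, whence the slope at most
    1. The sign of [theta] is not determined. *)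
Lemma segment_frame A B (r : R) : A <> B -> 0 < r -> exists b (s theta : R),
  [/\ `|s| <= 1, theta != 0 & forall x,
    dot (x - A) (perp (B - A)) = theta * frame_ta b s (midpoint A B) r x].
Proof.
move=> AB r0; have [m1 m2] := midpointE A B.
have tau0 : B.1 - A.1 != 0 \/ B.2 - A.2 != 0.
  have [e1|] := eqVneq (B.1 - A.1) 0; last by left.
  right; apply/eqP => /eqP; rewrite subr_eq0 => /eqP e2; apply: AB.
  by move/eqP: e1; rewrite subr_eq0 => /eqP e1; exact: plane_eq.
have le1 (p q : R) : q != 0 -> `|p| <= `|q| -> `|p / q| <= 1.
  by move=> q0 pq; rewrite normrM normfV ler_pdivrMr ?mul1r// normr_gt0.
have r0' : r != 0 by rewrite gt_eqF.
have [le|/ltW le] := leP `|B.2 - A.2| `|B.1 - A.1|.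
  have t1 : B.1 - A.1 != 0.
    case: tau0 => // h; rewrite -normr_gt0; apply: lt_le_trans le.
    by rewrite normr_gt0.
  exists true, ((B.2 - A.2) / (B.1 - A.1)), (r * (B.1 - A.1)).
  split; [exact: le1|by rewrite mulf_neq0|move=> x].
  by rewrite dotE /frame_ta m1 m2 /perp /=; field; rewrite r0' t1.
have t1 : B.2 - A.2 != 0.
  case: tau0 => // h; rewrite -normr_gt0; apply: lt_le_trans le.
  by rewrite normr_gt0.
exists false, ((B.1 - A.1) / (B.2 - A.2)), (- (r * (B.2 - A.2))).
split; [exact: le1|by rewrite oppr_eq0 mulf_neq0|move=> x].
by rewrite dotE /frame_ta m1 m2 /perp /=; field; rewrite r0' t1.
Qed.

Lemma normal_towards_le1 A B C i : `|crd i (normal_towards A B C)| <= 1.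
Proof.
have [d1 d2] := eucl_dist_ge A B.
have d0 : 0 <= eucl_dist A B by exact: sqrtr_ge0.
have h (q : R) : `|q| <= eucl_dist A B -> `|(eucl_dist A B)^-1 * q| <= 1.
  move=> hq; rewrite normrM normfV (ger0_norm d0).
  move: d0; rewrite le_eqVlt => /predU1P[<-|d0]; first by rewrite invr0 mul0r.
  by rewrite mulrC ler_pdivrMr// mul1r.
have hs (q w : R) : `|q| <= 1 -> `|Num.sg w * q| <= 1.
  by move=> hq; rewrite normrM normr_sg; case: (w != 0); rewrite ?mul1r ?mul0r.
rewrite /normal_towards; move: (dot _ _) => w; rewrite /crd /= /GRing.scale /=.
case: ifP => _; apply: hs; rewrite /perp /=; apply: h; rewrite ?normrN distrC//.
Qed.

Lemma normal_towards_opposite A B C C' (kappa : R) :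
  dot (B - A) (perp (C' - A)) != 0 -> 0 < kappa ->
  (forall x, bary2 A B C' x = - kappa * bary2 A B C x) ->
  dot (B - A) (perp (C - A)) != 0 ->
  normal_towards A B C' = - normal_towards A B C.
Proof.
move=> D0' k0 hk D0; rewrite /normal_towards -scaleNr; congr (_ *: _).
set nu := _ *: _; pose l := (eucl_dist A B)^-1.
pose D := dot (B - A) (perp (C - A)); pose D' := dot (B - A) (perp (C' - A)).
have e1 : dot nu (C - A) = - (l * D).
  by rewrite /nu -/l /D !dotE /perp /= /GRing.scale /=; ring.
have e2 : dot nu (C' - A) = - (l * D').
  by rewrite /nu -/l /D' !dotE /perp /= /GRing.scale /=; ring.
have DD : D = - kappa * D'.
  have := hk C'; rewrite /bary2 -/D -/D'.
  have -> : dot (C' - A) (perp (B - A)) = - D' by rewrite /D' !dotE /perp /=; ring.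
  have alg (p q k : R) : p != 0 -> q != 0 -> - (- p / p) = - k * - (- p / q) -> q = - k * p.
    move=> p0 q0; rewrite mulNr divff// opprK => e.
    by rewrite -[LHS]mul1r e; field.
  exact: alg.
rewrite e1 e2 DD (_ : - (l * (- kappa * D')) = kappa * (l * D')); last by ring.
by rewrite (sgrM kappa) (gtr0_sg k0) mul1r sgrN.
Qed.

End SideFrame.

Section Frames.
Context {R : realType}.
Implicit Types (x y A B C M : R * R) (T S Om : set (R * R)) (sigma : R).

(** The support has half-side 2 r, is doubled to 4 r to stay off the boundary, and is seen in the
    sum of coordinate distances as 8 r. The disc in T has radius h / (4 sigma); as AB is at least
    that long, the one in T' has radius at least h / (16 sigma^2). Equating this with 8 r gives 128
    sigma^2. *)
Lemma adjacent_frame Th T T' A B C C' sigma : conforming Th -> Th T -> Th T' ->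
  T' <> T -> simplex T A B C -> simplex T' A B C' -> 1 <= sigma ->
  diam T <= sigma * inball_diam T -> diam T' <= sigma * inball_diam T' ->
  let r := diam T / (128 * sigma ^+ 2) in
  exists b (s theta : R), [/\ `|s| <= 1, theta != 0,
    forall x, square (midpoint A B) (4 * r) x ->
      (T x <-> 0 <= theta * frame_ta b s (midpoint A B) r x) /\
      (T' x <-> theta * frame_ta b s (midpoint A B) r x <= 0),
    forall k : R, 0 <= k <= 1 -> frame_ta b s (midpoint A B) r (A + k *: (B - A)) = 0 /\
      `|frame_xi b (midpoint A B) r (A + k *: (B - A))| <= 128 * sigma ^+ 2 &
    normal_towards A B C' = - normal_towards A B C].
Proof.
move=> cf hT hT' TT' sT sT' sg1 rT rT' r.
have h0 := diam_gt0 sT; have sg0 : 0 < sigma by lra.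
have ss : sigma <= sigma ^+ 2 by rewrite expr2 ler_peMr// ltW.
have s2 : 0 < sigma ^+ 2 by rewrite exprn_gt0.
have r0 : 0 < r by rewrite divr_gt0// mulr_gt0.
have rE : r * (128 * sigma ^+ 2) = diam T by rewrite /r divfK// mulf_neq0// gt_eqF.
have [x0 disc] := inscribed_disc sT sg1 rT; have [x1 disc'] := inscribed_disc sT' sg1 rT'.
have rho0 : 0 < diam T / (4 * sigma) by rewrite divr_gt0// mulr_gt0.
have len : diam T / (4 * sigma) <= diam T'.
  have [TA TB _] := simplex_vertices sT'.
  exact: le_trans (side_length_ge sT rho0 disc) (le_diam sT' TA TB).
have le1 : 8 * r <= diam T / (4 * sigma).
  rewrite ler_pdivlMr ?mulr_gt0// -rE; have := ler_wpM2l (ltW r0) ss.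
  have := mulr_gt0 r0 sg0.
  have alg (p q : R) : 0 < r * p -> r * p <= r * q -> 8 * r * (4 * p) <= r * (128 * q).
    by move=> *; lra.
  exact: alg.
have le2 : 8 * r <= diam T' / (4 * sigma).
  rewrite ler_pdivlMr ?mulr_gt0//; apply: le_trans len.
  rewrite ler_pdivlMr ?mulr_gt0// -rE expr2.
  by rewrite (_ : _ * (4 * sigma) * _ = r * (128 * (sigma * sigma)))//; ring.
have near1 x : `|x.1 - (midpoint A B).1| + `|x.2 - (midpoint A B).2| <= 8 * r ->
    (T x <-> 0 <= bary2 A B C x) /\ (T' x <-> 0 <= bary2 A B C' x).
  move=> hx; split.
    by apply: near_midpoint sT rho0 disc _; exact: le_trans hx le1.
  apply: near_midpoint sT' _ disc' _; last exact: le_trans hx le2.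
  by apply: lt_le_trans le2; rewrite mulr_gt0.
have [kappa k0 kE] := conforming_opposite cf hT hT' TT' sT sT' (mulr_gt0 (ltr0Sn R 7) r0) near1.
have [b [s [theta [s1 th0 thE]]]] := segment_frame (simplex_neq sT) r0.
pose D := dot (B - A) (perp (C - A)).
have D0 : D != 0 by case: sT.
have bE x : bary2 A B C x = - (theta / D) * frame_ta b s (midpoint A B) r x.
  by rewrite /bary2 thE -/D; ring.
exists b, s, (- (theta / D)); split => //.
- by rewrite oppr_eq0 mulf_neq0 ?invr_eq0.
- move=> x /squareP[q1 q2]; rewrite -bE.
  have e8 : 4 * r + 4 * r = 8 * r by ring.
  have [-> ->] := near1 x (le_trans (lerD q1 q2) ltac:(by rewrite e8)); rewrite kE; split => //.
  by rewrite mulNr oppr_ge0 pmulr_rle0.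
- move=> k k01; pose x := A + k *: (B - A); rewrite -/x.
  have t0 : frame_ta b s (midpoint A B) r x = 0.
    have := thE x; rewrite (_ : dot _ _ = 0).
      by move/esym/eqP; rewrite mulf_eq0 (negPf th0) => /eqP.
    by rewrite /x !dotE /perp /= /GRing.scale /=; ring.
  split => //.
  have [TA TB _] := simplex_vertices sT.
  have := le_diam sT TA TB; have [d1 d2] := eucl_dist_ge A B => dAB.
  have key (p q m : R) : `|p - q| <= diam T -> `|(p + k * (q - p) - (p + q) / 2) / r| <= 128 * sigma ^+ 2.
    move=> pq; rewrite normrM normfV (gtr0_norm r0) ler_pdivrMr// (mulrC _ r) rE.
    have -> : p + k * (q - p) - (p + q) / 2 = (2^-1 - k) * (p - q) by field.
    rewrite normrM; apply: le_trans pq; rewrite ler_piMl//.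
    by move/andP: k01 => [k0' k1]; rewrite ler_norml; apply/andP; split; lra.
  have [m1 m2] := midpointE A B.
  by rewrite /frame_xi m1 m2 /x /= /GRing.scale /=; case: b {bE thE t0}; apply: key => //; lra.
- by apply: normal_towards_opposite kE _ => //; case: sT'.
Qed.

Lemma frame_monomials b (s : R) M (r : R) : r != 0 -> exists p1 q1 p2 q2 : R,
  forall x, x.1 = M.1 + p1 * frame_xi b M r x + q1 * frame_ta b s M r x /\
            x.2 = M.2 + p2 * frame_xi b M r x + q2 * frame_ta b s M r x.
Proof.
move=> r0; rewrite /frame_xi /frame_ta; case: b.
  by exists r, 0, (r * s), r => x; split; field.
by exists (r * s), r, r, 0 => x; split; field.
Qed.

Lemma polynomial_fun2 f : polynomial_fun 2 f -> exists c00 c01 c02 c10 c11 c20 : R,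
  forall x, f x = c00 + c01 * x.2 + c02 * x.2 ^+ 2 + c10 * x.1 + c11 * (x.1 * x.2) + c20 * x.1 ^+ 2.
Proof.
move=> [c fE]; exists (c 0%N 0%N), (c 0%N 1%N), (c 0%N 2%N), (c 1%N 0%N), (c 1%N 1%N), (c 2%N 0%N).
move=> x; rewrite fE; do 4 (rewrite ?big_mkcond /= ?(big_ord_recl, big_ord0) /=).
by rewrite /bump /= !(expr0, expr1, mulr1); ring.
Qed.

Lemma polynomial_fun1 f : polynomial_fun 1 f -> exists c00 c01 c10 : R,
  forall x, f x = c00 + c01 * x.2 + c10 * x.1.
Proof.
move=> [c fE]; exists (c 0%N 0%N), (c 0%N 1%N), (c 1%N 0%N).
move=> x; rewrite fE; do 3 (rewrite ?big_mkcond /= ?(big_ord_recl, big_ord0) /=).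
by rewrite /bump /= !(expr0, expr1, mulr1); ring.
Qed.

Lemma polynomial2_frame_quad b (s : R) M (r : R) f : r != 0 -> polynomial_fun 2 f ->
  exists c, f = frame_quad b s M r c.
Proof.
move=> r0 /polynomial_fun2[c00 [c01 [c02 [c10 [c11 [c20 fE]]]]]].
have [p1 [q1 [p2 [q2 xE]]]] := frame_monomials b s M r0.
exists (fun n => nth 0 [:: c00 + c01 * M.2 + c02 * M.2 ^+ 2 + c10 * M.1 + c11 * M.1 * M.2 + c20 * M.1 ^+ 2;
  c01 * p2 + 2 * c02 * M.2 * p2 + c10 * p1 + c11 * (M.1 * p2 + M.2 * p1) + 2 * c20 * M.1 * p1;
  c01 * q2 + 2 * c02 * M.2 * q2 + c10 * q1 + c11 * (M.1 * q2 + M.2 * q1) + 2 * c20 * M.1 * q1;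
  c02 * p2 ^+ 2 + c11 * p1 * p2 + c20 * p1 ^+ 2;
  2 * c02 * p2 * q2 + c11 * (p1 * q2 + p2 * q1) + 2 * c20 * p1 * q1;
  c02 * q2 ^+ 2 + c11 * q1 * q2 + c20 * q1 ^+ 2] n).
apply/funext => x; rewrite fE; have [-> ->] := xE x; rewrite /frame_quad /quad /=.
by move: (frame_xi _ _ _ _) (frame_ta _ _ _ _ _) => u v; ring.
Qed.

Lemma polynomial1_frame_quad b (s : R) M (r : R) f : r != 0 -> polynomial_fun 1 f ->
  exists c, f = frame_quad b s M r c.
Proof.
move=> r0 /polynomial_fun1[c00 [c01 [c10 fE]]].
have [p1 [q1 [p2 [q2 xE]]]] := frame_monomials b s M r0.
exists (fun n => nth 0 [:: c00 + c01 * M.2 + c10 * M.1;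
  c01 * p2 + c10 * p1; c01 * q2 + c10 * q1; 0; 0; 0] n).
apply/funext => x; rewrite fE; have [-> ->] := xE x; rewrite /frame_quad /quad /=.
by move: (frame_xi _ _ _ _) (frame_ta _ _ _ _ _) => u v; ring.
Qed.

Lemma local_polyP k T f : (exists g, is_local k T f g) -> is_local k T f (local_poly k T f).
Proof. exact: (@xgetPex _ (fun=> 0) [set g | is_local k T f g]). Qed.

End Frames.

(** The w's are meant for the integrals with the exact solution, which sum to zero, and the q's for
    those with the discrete one; 128 is 64 + 64, and the smaller factors are rounded up to it. *)
Lemma four_close {R : realType} (q1 q2 q3 q4 w1 w2 w3 w4 a b c : R) :
  w1 + w2 + w3 + w4 = 0 -> 0 <= b -> 0 <= c ->
  `|q1 - w1| <= 64 * a -> `|q2 - w2| <= 64 * a ->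
  `|q3 - w3| <= 8 * b -> `|q4 - w4| <= 4 * c ->
  `|q1 + q2 + q3 + q4| <= 128 * (a + b + c).
Proof.
move=> w0 b0 c0 k1 k2 k3 k4.
have -> : q1 + q2 + q3 + q4 = (q1 - w1) + (q2 - w2) + (q3 - w3) + (q4 - w4).
  by rewrite -[LHS]subr0 -w0; ring.
apply: le_trans (ler_normD _ _) _.
have h1 := ler_normD (q1 - w1 + (q2 - w2)) (q3 - w3).
have h2 := ler_normD (q1 - w1) (q2 - w2).
lra.
Qed.

Lemma two_close {R : realType} (q1 q2 w1 w2 a : R) :
  w1 + w2 = 0 -> `|q1 - w1| <= 32 * a -> `|q2 - w2| <= 32 * a ->
  `|q1 + q2| <= 64 * a.
Proof.
move=> w0 k1 k2.
have -> : q1 + q2 = (q1 - w1) + (q2 - w2) by rewrite -[LHS]subr0 -w0; ring.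
by apply: le_trans (ler_normD _ _) _; lra.
Qed.

(** * Local lower bounds *)

Section CoreBounds.
Context {R : realType}.
Implicit Types (G N : set (R * R)) (g k : R -> R) (f e phi psi p : R * R -> R).
Implicit Types (c : bool -> nat -> R) (y u : 'I_2 -> R * R -> R).
Local Notation mu2 := (@mu2 R).
Variables (b : bool) (s : R) (M : R * R) (r : R).
Hypotheses (r0 : 0 < r) (s1 : `|s| <= 1).
Local Notation tens := (frame_tensor b s M r).
Local Notation al := (grad_xi b r).
Local Notation be := (grad_ta b s r).
Local Notation K := (square M (2 * r)).
Local Notation pw := (piecewise b s M r).

Lemma mu2_frame_square : mu2 K = ((4 * r) ^+ 2)%:E.
Proof. rewrite mu2_square; last by rewrite mulr_ge0// ltW. by congr EFin; ring. Qed.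

(** Here v is an explicit moment of the discrete function and w the integral of the exact one; only
    the integral of their difference remains to be bounded. *)
Lemma close_integrals f psi c (v w a : R) :
  has_int mu2 (fun x => pw c x * psi x) v -> has_int mu2 (fun x => f x * psi x) w ->
  (mu2.-integrable setT (EFin \o (fun x => (f x - pw c x) * psi x)) ->
   `|\int[mu2]_x ((f x - pw c x) * psi x)| <= a) ->
  `|v - w| <= a.
Proof.
move=> hv hw; have h := has_intB hw hv.
have [ii e] : has_int mu2 (fun x => (f x - pw c x) * psi x) (w - v).
  by apply: has_int_eq h => // x /=; rewrite mulrBl.
by move=> /(_ ii); rewrite e distrC.
Qed.

Lemma close_sup N f fT psi c (v w A S : R) :
  K `<=` N -> 0 <= A -> 0 <= S ->
  {ae mu2, forall x, N x -> `|f x - fT x| <= A} ->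
  (forall x, K x -> fT x = pw c x) ->
  (forall x, `|psi x| <= S) -> (forall x, ~ K x -> psi x = 0) ->
  has_int mu2 (fun x => pw c x * psi x) v -> has_int mu2 (fun x => f x * psi x) w ->
  `|v - w| <= 16 * r ^+ 2 * (A * S).
Proof.
move=> KN A0 S0 eA fTE psiS psi0 hv hw; apply: close_integrals hv hw _ => ii.
have -> : 16 * r ^+ 2 * (A * S) = A * S * (4 * r) ^+ 2 by ring.
apply: (@sup_bound_integral _ K K _ psi A S) => //.
- exact: measurable_square.
- exact: mu2_frame_square.
- by apply: ae2S eA => x h Kx; rewrite -fTE//; apply: h; exact: KN.
Qed.

Lemma close_L2 N G f fT (g : R * R -> R) psi c (v w B S : R) : open G ->
  K `<=` N -> K `<=` G -> 0 <= S -> measurable_fun G f -> measurable_fun setT psi ->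
  (forall x, `|f x - fT x| <= `|g x|) -> Lp_norm 2%:E N g = B%:E ->
  (forall x, K x -> fT x = pw c x) ->
  (forall x, `|psi x| <= S) -> (forall x, ~ K x -> psi x = 0) ->
  has_int mu2 (fun x => pw c x * psi x) v -> has_int mu2 (fun x => f x * psi x) w ->
  `|v - w| <= B * (S * (4 * r)).
Proof.
move=> oG KN KG S0 mf mpsi fg gB fTE psiS psi0 hv hw; apply: close_integrals hv hw _ => ii.
apply: (@L2_bound_integral _ N K _ g psi B S) => //.
- exact: measurable_square.
- exact: mu2_frame_square.
- by rewrite mulr_ge0// ltW.
- by move=> x Kx; split; [exact: KN|rewrite -fTE].
- apply: measurable_funB.
    by apply: measurable_funS mf => //; exact: open_measurable_plane.
  by apply: measurable_funTS; exact: piecewise_measurable.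
Qed.

End CoreBounds.

Section Preliminaries.
Context {R : realType}.

Lemma inball_diam_ge0 (T : set (R * R)) : 0 <= inball_diam T.
Proof.
rewrite /inball_diam; set E := image _ _; have [hs|hs] := pselect (has_sup E).
  have [q Eq] := hs.1; apply: le_trans (sup_upper_bound hs Eq).
  by case: Eq => q' [q0 _] <-; rewrite mulr_ge0.
by rewrite sup_out.
Qed.

Lemma line_test_jet (g : R -> R) : line_test g -> exists L, bounded_jet L g.
Proof.
move=> tg; have dg := line_test_derive tg.
have [_ [k0 h0] _] := line_test_boxfun tg.
have [_ [k1 h1] _] := line_test_boxfun dg.
have [_ [k2 h2] _] := line_test_boxfun (line_test_derive dg).
exists (Num.max k0 (Num.max k1 k2)) => t; rewrite !le_max; split.
- by rewrite h0.
- by rewrite h1 orbT.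
- by rewrite h2 !orbT.
Qed.

Lemma bounded_jetW (L L' : R) (g : R -> R) : L <= L' -> bounded_jet L g -> bounded_jet L' g.
Proof.
by move=> LL gL t; have [h0 h1 h2] := gL t; split; apply: le_trans LL.
Qed.

Lemma sup_norm_le d (X : measurableType d) (mu : {measure set X -> \bar R}) (f : X -> \bar R) (a : R) :
  0 <= a -> (forall x, (`|f x| <= a%:E)%E) -> ('N[mu]_+oo[f] <= a%:E)%E.
Proof.
move=> a0 fa; rewrite unlock /Lnorm; case: ifPn => _; last by rewrite lee_fin.
by apply/ess_sup_inf.ess_supP; apply: aeW => x; exact: fa.
Qed.

End Preliminaries.

(** * Estimates on one element and on one side *)

Section LocalEstimates.
Context {R : realType}.
Implicit Types (g k : R -> R) (c : bool -> nat -> R) (phi : R * R -> R).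
Local Notation mu2 := (@mu2 R).
Variables (Om : set (R * R)) (Th : set (set (R * R))).
Hypotheses (oO : open Om) (lipO : lipschitz_boundary Om) (mTh : mesh Om Th).
Variables (sigma : R).
Hypotheses (sg1 : 1 <= sigma)
  (reg : forall T, Th T -> diam T <= sigma * inball_diam T).
Variables (T : set (R * R)) (hT : Th T).
Local Notation N := (patch_of Th T).
Local Notation h := (diam T).
Variables (y u yT uT : 'I_2 -> R * R -> R) (p pT : R * R -> R).
Hypotheses (ly : forall j, loc_integrable Om (y j)) (lp : loc_integrable Om p)
  (lu : forall j, loc_integrable Om (u j)).
Variables (A B D : R).
Hypotheses
  (AE : Lp_vnorm +oo N (fun i x => y i x - yT i x) = A%:E)
  (BE : Lp_norm 2%:E N (fun x => p x - pT x) = B%:E)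
  (DE : Lp_vnorm 2%:E N (fun i x => u i x - uT i x) = D%:E).
Hypotheses
  (momentum : forall j phi, test_fun Om phi ->
    \int[mu2]_x (y j x * partial ord0 (partial ord0 phi) x)
    + \int[mu2]_x (y j x * partial ord_max (partial ord_max phi) x)
    + \int[mu2]_x (p x * partial j phi x) + \int[mu2]_x (u j x * phi x) = 0)
  (divergence : forall phi, test_fun Om phi ->
    \int[mu2]_x (y ord0 x * partial ord0 phi x)
    + \int[mu2]_x (y ord_max x * partial ord_max phi x) = 0).
Variables (L : R) (psi : nat -> R -> R) (chi : R -> R).
Hypotheses (L0 : 0 <= L)
  (psiP : forall l, (l <= 2)%N -> line_test (psi l) /\
    forall k : nat, (k <= 2)%N -> moment k (psi l) = (k == l)%:R)
  (psiL : forall l, (l <= 2)%N -> bounded_jet L (psi l))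
  (tchi : line_test chi) (chi0 : chi 0 = 1)
  (mchi : forall b (k : nat), (k <= 2)%N -> moment k (halfline b chi) = 0)
  (chiL : bounded_jet L chi).
Hypotheses (feY : forall j, fe_space 2 Om Th (yT j)) (feP : fe_space 1 Om Th pT)
  (feU : forall j, fe_space 2 Om Th (uT j)).

Lemma error_ge0 : [/\ 0 <= A, 0 <= B & 0 <= D].
Proof. by split; rewrite -lee_fin -?AE -?BE -?DE; exact: Lp_norm_ge0. Qed.

Lemma sup_error_ae j : {ae mu2, forall x, N x -> `|y j x - yT j x| <= A}.
Proof.
have := @Lp_normy_ae _ N (fun x => vnorm (fun i => y i x - yT i x)).
rewrite -/(Lp_vnorm +oo N (fun i x => y i x - yT i x)) AE.
apply: ae2S => x hx Nx; have := hx Nx; rewrite lee_fin => hA.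
apply: le_trans (norm_le_vnorm (fun i => y i x - yT i x) j) _.
exact: le_trans (ler_norm _) hA.
Qed.

Section Frame.
Variables (b : bool) (s : R) (M : R * R) (r : R).
Hypotheses (r0 : 0 < r) (s1 : `|s| <= 1).
Local Notation tens := (frame_tensor b s M r).
Local Notation al := (grad_xi b r).
Local Notation be := (grad_ta b s r).
Local Notation K := (square M (2 * r)).
Local Notation pw := (piecewise b s M r).
Hypotheses (KO : K `<=` Om) (KN : K `<=` N).

Section TestTensor.
Variables (cy cu : 'I_2 -> bool -> nat -> R) (cp : bool -> nat -> R).
Hypotheses (yTE : forall j x, K x -> yT j x = pw (cy j) x)
  (pTE : forall x, K x -> pT x = pw cp x)
  (uTE : forall j x, K x -> uT j x = pw (cu j) x).
Variables (g k : R -> R).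
Hypotheses (tg : line_test g) (tk : line_test k)
  (Lg : bounded_jet L g) (Lk : bounded_jet L k).

Lemma tens_test : test_fun Om (tens g k).
Proof. exact: frame_tensor_test. Qed.

Lemma tens_partial_support i x : ~ K x -> partial i (tens g k) x = 0.
Proof.
move=> nK; have [_ g0] := line_test_derive tg; have [_ k0] := line_test_derive tk.
rewrite (partial_frame_tensor b s M r i tg.1 tk.1).
have Z1 := frame_tensor_support b r0 s1 g0 tk.2 nK.
have Z2 := frame_tensor_support b r0 s1 tg.2 k0 nK.
have alg (q1 q2 q3 q4 : R) : q2 = 0 -> q4 = 0 -> q1 * q2 + q3 * q4 = 0.
  by move=> -> ->; rewrite !mulr0 addr0.
exact: alg.
Qed.

Lemma tens_partial2_support i x : ~ K x -> partial i (partial i (tens g k)) x = 0.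
Proof.
move=> nK; have dg := line_test_derive tg; have dk := line_test_derive tk.
rewrite (partial2_tens b s M r i tg.1 tk.1).
have Z1 := frame_tensor_support b r0 s1 (line_test_derive dg).2 tk.2 nK.
have Z2 := frame_tensor_support b r0 s1 dg.2 dk.2 nK.
have Z3 := frame_tensor_support b r0 s1 tg.2 (line_test_derive dk).2 nK.
have alg (q1 q2 q3 q4 q5 q6 : R) : q2 = 0 -> q4 = 0 -> q6 = 0 -> q1 * q2 + q3 * q4 + q5 * q6 = 0.
  by move=> -> -> ->; rewrite !mulr0 !addr0.
exact: alg.
Qed.

(** [P1], [P2] and [P0] are the exact integrals of [pw c] against the first derivative, the second
    derivative and the value of [tens g k]. *)
Let P1 c i := r ^+ 2 * (al i * piecewise_moment c g^`()%classic k
   + be i * piecewise_moment c g k^`()%classic).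
Let P2 c i := r ^+ 2 * (al i ^+ 2 * piecewise_moment c g^`()%classic^`()%classic k
   + 2 * al i * be i * piecewise_moment c g^`()%classic k^`()%classic
   + be i ^+ 2 * piecewise_moment c g k^`()%classic^`()%classic).
Let P0 c := r ^+ 2 * piecewise_moment c g k.

Lemma jet1 f : bounded_jet L f ->
  forall t, `|f t| <= L /\ `|f^`()%classic t| <= L.
Proof. by move=> fL t; have [h1 h2 _] := fL t. Qed.

(** The support has area 16 r^2. Against the maximum norm, second derivatives of size r^-2 leave no
    power of r; against the L2 norm, the root 4 r of the area cancels one derivative for the
    pressure and survives for the control. These are the powers of h in dimension 2. *)
Lemma momentum_bound (j : 'I_2) :
  `|P2 (cy j) ord0 + P2 (cy j) ord_max + P1 cp j + P0 (cu j)| <=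
  128 * L ^+ 2 * (A + B + r * D).
Proof.
have id0 := momentum j tens_test.
have tt := tens_test.
have hy i : has_int mu2 (fun x => y j x * partial i (partial i (tens g k)) x)
    (\int[mu2]_x (y j x * partial i (partial i (tens g k)) x)).
  have td := test_fun_partial i (test_fun_partial i tt).
  by split => //; exact: (test_fun_int oO (ly j) td).1.
have hp : has_int mu2 (fun x => p x * partial j (tens g k) x)
    (\int[mu2]_x (p x * partial j (tens g k) x)).
  by split => //; exact: (test_fun_int oO lp (test_fun_partial j tt)).1.
have hu : has_int mu2 (fun x => u j x * tens g k x) (\int[mu2]_x (u j x * tens g k x)).
  by split => //; exact: (test_fun_int oO (lu j) tt).1.
have [A0 B0 D0] := error_ge0.
have LL : 0 <= L ^+ 2 by rewrite exprn_ge0.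
have rr : 0 < r ^+ 2 by rewrite exprn_gt0.
have e2 i : `|P2 (cy j) i - \int[mu2]_x (y j x * partial i (partial i (tens g k)) x)|
     <= 64 * (L ^+ 2 * A).
  have -> : 64 * (L ^+ 2 * A) = 16 * r ^+ 2 * (A * (4 * L ^+ 2 / r ^+ 2)).
    by field; rewrite gt_eqF.
  have S0 : 0 <= 4 * L ^+ 2 / r ^+ 2 by rewrite divr_ge0 ?mulr_ge0// ltW.
  have bd x := partial2_tens_le b M r0 s1 i x L0 tg.1 tk.1 Lg Lk.
  have hv := partial2_piecewise_has_int b M r0 s1 i (cy j) tg tk.
  exact: (close_sup r0 KN A0 S0 (sup_error_ae j) (@yTE j) bd (@tens_partial2_support i) hv (hy i)).
have ep : `|P1 cp j - \int[mu2]_x (p x * partial j (tens g k) x)| <= 8 * (L ^+ 2 * B).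
  have -> : 8 * (L ^+ 2 * B) = B * (2 * L ^+ 2 / r * (4 * r)) by field; rewrite gt_eqF.
  have S0 : 0 <= 2 * L ^+ 2 / r by rewrite divr_ge0 ?mulr_ge0// ltW.
  have bd x := partial_tens_le b M r0 s1 j x L0 tg.1 tk.1 (jet1 Lg) (jet1 Lk).
  have mp : measurable_fun Om p by case: lp.
  have mpsi := continuous_measurable_plane (smooth_continuous (smooth_partial j (test_fun_smooth tt))).
  have hv := partial_piecewise_has_int b M r0 s1 j cp tg tk.
  exact: (close_L2 r0 oO KN KO S0 mp mpsi (fun x => lexx _) BE pTE bd (@tens_partial_support j) hv hp).
have eu : `|P0 (cu j) - \int[mu2]_x (u j x * tens g k x)| <= 4 * (L ^+ 2 * (r * D)).
  have -> : 4 * (L ^+ 2 * (r * D)) = D * (L ^+ 2 * (4 * r)) by ring.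
  have bd x : `|tens g k x| <= L ^+ 2.
    rewrite /frame_tensor normrM expr2; apply: ler_pM => //.
      by have [] := Lg (frame_xi b M r x).
    by have [] := Lk (frame_ta b s M r x).
  have mu : measurable_fun Om (u j) by case: (lu j).
  have mpsi := continuous_measurable_plane (smooth_continuous (test_fun_smooth tt)).
  have hv := piecewise_has_int b M r0 s1 (cu j) (line_test_boxfun tg) (line_test_boxfun tk).
  have sup0 x : ~ K x -> tens g k x = 0 by apply: frame_tensor_support => //; [exact: tg.2|exact: tk.2].
  have ule x : `|u j x - uT j x| <= `|vnorm (fun i => u i x - uT i x)|.
    by rewrite [X in _ <= X]ger0_norm ?vnorm_ge0//; exact: (norm_le_vnorm (fun i => u i x - uT i x)).
  exact: (close_L2 r0 oO KN KO LL mu mpsi ule DE (@uTE j) bd sup0 hv hu).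
have LB : 0 <= L ^+ 2 * B by rewrite mulr_ge0.
have LD : 0 <= L ^+ 2 * (r * D) by rewrite !mulr_ge0// ltW.
have alg (l q1 q2 q3 : R) : 128 * l * (q1 + q2 + q3) = 128 * (l * q1 + l * q2 + l * q3).
  by ring.
rewrite (alg (L ^+ 2) A B (r * D)).
exact: four_close id0 LB LD (e2 ord0) (e2 ord_max) ep eu.
Qed.

Lemma divergence_bound :
  `|P1 (cy ord0) ord0 + P1 (cy ord_max) ord_max| <= 64 * L ^+ 2 * (r * A).
Proof.
have id0 := divergence tens_test.
have tt := tens_test.
have hy i : has_int mu2 (fun x => y i x * partial i (tens g k) x)
    (\int[mu2]_x (y i x * partial i (tens g k) x)).
  by split => //; exact: (test_fun_int oO (ly i) (test_fun_partial i tt)).1.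
have [A0 _ _] := error_ge0.
have LL : 0 <= L ^+ 2 by rewrite exprn_ge0.
have e1 i : `|P1 (cy i) i - \int[mu2]_x (y i x * partial i (tens g k) x)|
     <= 32 * (L ^+ 2 * (r * A)).
  have -> : 32 * (L ^+ 2 * (r * A)) = 16 * r ^+ 2 * (A * (2 * L ^+ 2 / r)).
    by field; rewrite gt_eqF.
  have S0 : 0 <= 2 * L ^+ 2 / r by rewrite divr_ge0 ?mulr_ge0// ltW.
  have bd x := partial_tens_le b M r0 s1 i x L0 tg.1 tk.1 (jet1 Lg) (jet1 Lk).
  have hv := partial_piecewise_has_int b M r0 s1 i (cy i) tg tk.
  exact: (close_sup r0 KN A0 S0 (sup_error_ae i) (@yTE i) bd (@tens_partial_support i) hv (hy i)).
rewrite -mulrA.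
exact: two_close id0 (e1 ord0) (e1 ord_max).
Qed.

End TestTensor.

Section Element.
Variables (cy cu : 'I_2 -> nat -> R) (cp : nat -> R).
Hypotheses (yTE : forall j x, K x -> yT j x = frame_quad b s M r (cy j) x)
  (pTE : forall x, K x -> pT x = frame_quad b s M r cp x)
  (uTE : forall j x, K x -> uT j x = frame_quad b s M r (cu j) x).

(** With equal coefficients on both sides of the line, the moment calculus carries all derivatives
    back to the quadratics, and the dual profiles single out the coefficient of number n of the
    residual. *)
Lemma residual_coef_bound j n : (n <= 5)%N ->
  r ^+ 2 * `|residual_coef b s r (cy j) cp (cu j) j n| <= 128 * L ^+ 2 * (A + B + r * D).
Proof.
move=> n5; have [xi2 ta2] := (coef_xi_le n, coef_ta_le n).
have [tg _] := psiP xi2; have [tk _] := psiP ta2.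
have := @momentum_bound (fun j _ => cy j) (fun j _ => cu j) (fun=> cp) yTE pTE uTE
  _ _ tg tk (psiL xi2) (psiL ta2) j.
have dk := line_test_derive tk; have ddk := line_test_derive dk.
rewrite !(piecewise_moment_cst _ _ tk) !(piecewise_moment_cst _ _ dk) !(piecewise_moment_cst _ _ ddk).
rewrite !(quad_moment_lap b s r _ _ tg tk) (quad_moment_grad b s r _ _ tg tk).
set v := (X in `|X|); suff -> : v = r ^+ 2 * residual_coef b s r (cy j) cp (cu j) j n.
  by rewrite normrM (ger0_norm (exprn_ge0 2 (ltW r0))).
rewrite -(quad_moment_dual psiP _ n5) /v /residual_coef.
set g := psi _; set k := psi _.
have -> : (fun n => cu j n + (lap_coef b s r (cy j) ord0 n + lap_coef b s r (cy j) ord_max n)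
    - grad_coef b s r cp j n) = (fun n => (cu j n + (lap_coef b s r (cy j) ord0 n
    + lap_coef b s r (cy j) ord_max n)) + (-1) * grad_coef b s r cp j n).
  by apply/funext => m; rewrite mulN1r.
rewrite quad_momentD (quad_momentD (cu j)) quad_momentD quad_momentZ.
by move: (quad_moment _ _ _) (quad_moment _ _ _) (quad_moment _ _ _) (quad_moment _ _ _) => *; ring.
Qed.

Definition div_coef (n : nat) : R :=
  grad_coef b s r (cy ord0) ord0 n + grad_coef b s r (cy ord_max) ord_max n.

Lemma div_coef_bound n : (n <= 5)%N -> r * `|div_coef n| <= 64 * L ^+ 2 * A.
Proof.
move=> n5; have [xi2 ta2] := (coef_xi_le n, coef_ta_le n).
have [tg _] := psiP xi2; have [tk _] := psiP ta2.
have := @divergence_bound (fun j _ => cy j) yTE _ _ tg tk (psiL xi2) (psiL ta2).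
have dk := line_test_derive tk.
rewrite !(piecewise_moment_cst _ _ tk) !(piecewise_moment_cst _ _ dk).
rewrite !(quad_moment_grad b s r _ _ tg tk).
set v := (X in `|X|); have -> : v = - (r ^+ 2 * div_coef n).
  rewrite -(quad_moment_dual psiP div_coef n5) /div_coef quad_momentD /v.
  by move: (quad_moment _ _ _) (quad_moment _ _ _) => *; ring.
rewrite normrN normrM (ger0_norm (exprn_ge0 2 (ltW r0))) => h.
rewrite -(ler_pM2l r0); apply: le_trans (le_trans h _); rewrite le_eqVlt; apply/orP; left.
  by apply/eqP; ring.
by apply/eqP; ring.
Qed.

End Element.

Section Edge.
Variables (cy cu : 'I_2 -> bool -> nat -> R) (cp : bool -> nat -> R).
Hypotheses (yTE : forall j x, K x -> yT j x = pw (cy j) x)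
  (pTE : forall x, K x -> pT x = pw cp x)
  (uTE : forall j x, K x -> uT j x = pw (cu j) x).
Hypotheses
  (ycont : forall j, [/\ cy j true 0%N = cy j false 0%N, cy j true 1%N = cy j false 1%N &
                         cy j true 3%N = cy j false 3%N])
  (pcont : [/\ cp true 0%N = cp false 0%N, cp true 1%N = cp false 1%N &
               cp true 3%N = cp false 3%N]).

(** Continuity of the discrete pressure and velocity leaves only the second derivative in ta. Its
    weight (1 + s^2) / r^2, the squared gradient of ta, cancels r^2 and is at least 1 after that.
    The profiles dual to 1 and xi separate the two coefficients of the jump. *)
Lemma jump_coef_bound j :
  `|cy j true 2%N - cy j false 2%N| <= 128 * L ^+ 2 * (A + B + r * D) /\
  `|cy j true 4%N - cy j false 4%N| <= 128 * L ^+ 2 * (A + B + r * D).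
Proof.
have key l : (l <= 1)%N ->
    `|(1 + s ^+ 2) * ((cy j true 2%N - cy j false 2%N) * (0%N == l)%:R
       + (cy j true 4%N - cy j false 4%N) * (1%N == l)%:R)| <= 128 * L ^+ 2 * (A + B + r * D).
  move=> l1; have l2 : (l <= 2)%N by rewrite (leq_trans l1).
  have [tg mg] := psiP l2.
  have := momentum_bound yTE pTE uTE tg tchi (psiL l2) chiL j.
  rewrite !(piecewise_moment_chi mchi) !(piecewise_moment_chi' tchi chi0 mchi _ pcont).
  rewrite !(piecewise_moment_chi' tchi chi0 mchi _ (ycont j)).
  rewrite !(piecewise_moment_chi'' tchi chi0 mchi _ (ycont j)) !mg//.
  set d0 := cy j true 2%N - _; set d1 := cy j true 4%N - _.
  have e : be ord0 ^+ 2 + be ord_max ^+ 2 = (1 + s ^+ 2) / r ^+ 2.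
    by rewrite /grad_ta /=; case: b => /=; field; rewrite gt_eqF.
  set v := (X in `|X|); suff -> : v = (1 + s ^+ 2) * (d0 * (0%N == l)%:R + d1 * (1%N == l)%:R) by [].
  rewrite /v !mulr0 !add0r !addr0 -mulrDr -mulrDl e.
  rewrite mulr0 addr0 mulrA; congr (_ * _).
  by field; rewrite gt_eqF.
have s2 (q : R) : `|q| <= `|(1 + s ^+ 2) * q|.
  by rewrite normrM ler_peMl// ger0_norm ?addr_ge0 ?sqr_ge0// lerDl sqr_ge0.
split; apply: le_trans (s2 _) _.
  by have := key 0%N isT; rewrite /= mulr1 mulr0 addr0.
by have := key 1%N isT; rewrite /= mulr1 mulr0 add0r.
Qed.

End Edge.
End Frame.

Let E := A + B + h * D.

Lemma mesh_subset T' : Th T' -> T' `<=` closure Om.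
Proof. by case: mTh => _ _ <- _ hT' x Tx; exists T'. Qed.

(** Each point of the smaller square is the centre of a square contained in the closure, so that
    [lipschitz_interior] applies to it. *)
Lemma square_interior M (a : R) : 0 < a -> square M (2 * a) `<=` closure Om ->
  square M a `<=` Om.
Proof.
move=> a0 sub x /squareP[x1 x2]; apply: (lipschitz_interior oO lipO a0) => z /squareP[z1 z2].
apply/sub/squareP; split; first by apply: le_trans (ler_distD x.1 _ _) _; lra.
by apply: le_trans (ler_distD x.2 _ _) _; lra.
Qed.

Lemma diam_T_gt0 : 0 < h.
Proof. by case: mTh => _ /(_ T hT)[A1 [B1 [C1 sT]]] _ _; exact: diam_gt0 sT. Qed.

(** The indicator differentiates [local_poly], whereas the integrals see the values of [f] on the
    triangle; the same coefficients have to serve both. *)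
Definition represents b (s : R) M (r : R) (n : nat) T' (f : R * R -> R) (c : nat -> R) :=
  local_poly n T' f = frame_quad b s M r c /\
  forall x, T' x -> f x = frame_quad b s M r c x.

Lemma local_frame_quad b (s : R) M (r : R) T' : Th T' -> r != 0 ->
  exists (cy cu : 'I_2 -> nat -> R) (cp : nat -> R),
  [/\ forall j, represents b s M r 2 T' (yT j) (cy j),
      represents b s M r 1 T' pT cp &
      forall j, represents b s M r 2 T' (uT j) (cu j)].
Proof.
move=> hT' r0.
have rep2 f : fe_space 2 Om Th f -> exists c : nat -> R, represents b s M r 2 T' f c.
  move=> [_ /(_ T' hT')/local_polyP[p2 fE]].
  by have [c cE] := polynomial2_frame_quad b s M r0 p2; exists c; split => //; rewrite -cE.
have [cy cyE] := choice (fun j => rep2 _ (feY j)).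
have [cu cuE] := choice (fun j => rep2 _ (feU j)).
have [p1 pE] := local_polyP (feP.2 T' hT').
have [cp cpE] := polynomial1_frame_quad b s M r0 p1.
by exists cy, cu, cp; split => //; split => //; rewrite -cpE.
Qed.

Let sg0 : 0 < sigma. Proof. exact: lt_le_trans sg1. Qed.

Lemma element_estimate (x : R * R) : T x ->
  (forall j, h ^+ 2 * `|local_poly 2 T (uT j) x
     + \sum_(i < 2) partial i (partial i (local_poly 2 T (yT j))) x
     - partial j (local_poly 1 T pT) x| <= 768 * L ^+ 2 * (32 * sigma) ^+ 4 * E) /\
  h * `|\sum_(i < 2) partial i (local_poly 2 T (yT i)) x| <= 768 * L ^+ 2 * (32 * sigma) ^+ 4 * E.
Proof.
move=> Tx; have h0 := diam_T_gt0; have [A0 B0 D0] := error_ge0.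
have [A1 [B1 [C1 sT]]] : exists A1 B1 C1, simplex T A1 B1 C1 by case: mTh => _ /(_ T hT).
have [M disc] := inscribed_disc sT sg1 (reg hT).
(* The disc has radius h / (4 sigma) = 8 r, hence contains the square of half-side 4 r, twice the
   support. Conversely both frame coordinates are at most h / r = rho on T. *)
pose rho := 32 * sigma; pose r := h / rho.
have rho1 : 1 <= rho by apply: (le_trans sg1); rewrite ler_peMl ?(ltW sg0)// ler1n.
have rho0 : 0 < rho by exact: lt_le_trans rho1.
have r0 : 0 < r by rewrite divr_gt0.
have rE : r * rho = h by rewrite /r divfK// gt_eqF.
have sqT : square M (2 * (2 * r)) `<=` T.
  move=> z /squareP[z1 z2]; apply: disc => /=; apply: le_trans (eucl_dist_le _ _) _.
  apply: (le_trans (lerD z1 z2)); rewrite -rE /rho.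
  have -> : r * (32 * sigma) / (4 * sigma) = 8 * r by field; rewrite gt_eqF.
  by rewrite le_eqVlt; apply/orP; left; apply/eqP; ring.
have r20 : 0 < 2 * r by rewrite mulr_gt0.
have KO : square M (2 * r) `<=` Om.
  exact: square_interior r20 (subset_trans sqT (mesh_subset hT)).
have KT : square M (2 * r) `<=` T.
  by move=> z /squareP[z1 z2]; apply: sqT; apply/squareP; split; lra.
have KN : square M (2 * r) `<=` N.
  by move=> z /KT Tz; exists T => //; split => //; left.
(* No direction is distinguished inside T, so the frame is parallel to the axes. *)
have [cy [cu [cp [cyE cpE cuE]]]] := local_frame_quad true 0 M hT (lt0r_neq0 r0).
have s1 : `|0 : R| <= 1 by rewrite normr0.
have rb := residual_coef_bound r0 s1 KO KN (fun j z Kz => (cyE j).2 z (KT z Kz))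
  (fun z Kz => cpE.2 z (KT z Kz)) (fun j z Kz => (cuE j).2 z (KT z Kz)).
have db := div_coef_bound r0 s1 KO KN (fun j z Kz => (cyE j).2 z (KT z Kz)).
have LL : 0 <= L ^+ 2 by rewrite exprn_ge0.
have rh : r <= h by rewrite -rE ler_peMr// ltW.
have EB : A + B + r * D <= E by rewrite lerD2l ler_wpM2r.
have AEle : A <= E by rewrite /E -addrA lerDl addr_ge0// mulr_ge0// ltW.
have E0 : 0 <= E by exact: le_trans AEle.
have dM z : T z -> `|z.1 - M.1| <= h /\ `|z.2 - M.2| <= h.
  move=> Tz; have TM : T M.
    by apply: KT; apply/squareP; rewrite !subrr normr0; split; exact: ltW.
  have [d1 d2] := eucl_dist_ge z M; have d3 := le_diam sT Tz TM.
  by split; [exact: le_trans d1 d3|exact: le_trans d2 d3].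
have [d1 d2] := dM x Tx.
have xi_le : `|frame_xi true M r x| <= rho.
  by rewrite /frame_xi normrM normfV (gtr0_norm r0) ler_pdivrMr// mulrC rE.
have ta_le : `|frame_ta true 0 M r x| <= rho.
  by rewrite /frame_ta mul0r subr0 normrM normfV (gtr0_norm r0) ler_pdivrMr// mulrC rE.
have L2E : 0 <= L ^+ 2 * E by rewrite mulr_ge0.
split=> [j|].
  rewrite sum2E (cyE j).1 cpE.1 (cuE j).1 !partial2_frame_quadE partial_frame_quadE.
  set v := (X in `|X|).
  have -> : v = frame_quad true 0 M r (residual_coef true 0 r (cy j) cp (cu j) j) x.
    by rewrite /v /frame_quad /quad /residual_coef; ring.
  have a0 : 0 <= 128 * L ^+ 2 * E / r ^+ 2.
    by rewrite divr_ge0 ?sqr_ge0// -mulrA mulr_ge0.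
  have ca n : (n <= 5)%N -> `|residual_coef true 0 r (cy j) cp (cu j) j n| <= 128 * L ^+ 2 * E / r ^+ 2.
    move=> n5; rewrite ler_pdivlMr ?exprn_gt0// mulrC; apply: le_trans (rb j n n5) _.
    by rewrite ler_wpM2l// mulr_ge0.
  have := frame_quad_le rho1 a0 ca xi_le ta_le; move: (`|_|) => w hw.
  (* Six monomials give 6 * 128 = 768; one rho^2 comes from h^2 / r^2, the other from the growth of
     quadratics up to the ends of T. *)
  apply: le_trans (ler_wpM2l (sqr_ge0 h) hw) _; rewrite -rE le_eqVlt; apply/orP; left.
  by apply/eqP; rewrite /rho; field; rewrite gt_eqF.
rewrite sum2E !(cyE _).1 !partial_frame_quadE; set v := (X in `|X|).
have -> : v = frame_quad true 0 M r (div_coef true 0 r cy) x.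
  by rewrite /v /frame_quad /quad /div_coef; ring.
have a0 : 0 <= 64 * L ^+ 2 * E / r.
  by apply: divr_ge0; [rewrite -mulrA; exact: mulr_ge0|exact: ltW].
have ca n : (n <= 5)%N -> `|div_coef true 0 r cy n| <= 64 * L ^+ 2 * E / r.
  move=> n5; rewrite ler_pdivlMr// mulrC; apply: le_trans (db n n5) _.
  by rewrite ler_wpM2l// mulr_ge0.
have := frame_quad_le rho1 a0 ca xi_le ta_le; move: (`|_|) => w hw.
apply: le_trans (ler_wpM2l (ltW h0) hw) _; rewrite -[X in X * _]rE.
have -> : r * rho * (6 * (64 * L ^+ 2 * E / r) * rho ^+ 2) = 384 * (L ^+ 2 * E) * rho ^+ 3.
  by field; rewrite gt_eqF.
(* The divergence needs only rho^3, having one derivative less; it is rounded up to share the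
   constant of the residual. *)
have -> : 768 * L ^+ 2 * (32 * sigma) ^+ 4 * E = 384 * (L ^+ 2 * E) * (2 * rho ^+ 4).
  by rewrite /rho; ring.
apply: ler_wpM2l; first exact: mulr_ge0.
have : rho ^+ 3 <= rho ^+ 4 by rewrite [leRHS]exprSr ler_peMr// exprn_ge0// ltW.
have : 0 <= rho ^+ 4 by rewrite exprn_ge0// ltW.
lra.
Qed.

(** The sign of [theta] tells on which side of the line T lies. Points on the line belong to both
    triangles, so the convention made there by [piecewise] is harmless. *)
Lemma piecewise_mix b (s : R) M (r theta : R) T' (c c' : nat -> R) (f : R * R -> R) x :
  theta != 0 -> (forall z, T z -> f z = frame_quad b s M r c z) ->
  (forall z, T' z -> f z = frame_quad b s M r c' z) ->
  (T x <-> 0 <= theta * frame_ta b s M r x) /\ (T' x <-> theta * frame_ta b s M r x <= 0) ->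
  f x = piecewise b s M r (fun sd => if sd == (0 < theta) then c else c') x.
Proof.
move=> th0 fT fT' [TE TE']; rewrite /piecewise.
have [th|th|e] := ltrgtP 0 theta; last by rewrite -e eqxx in th0.
  have [ta|ta] := leP 0 (frame_ta b s M r x); rewrite /=.
    by apply/fT/TE; rewrite mulr_ge0// ltW.
  by apply/fT'/TE'; rewrite pmulr_rle0// ltW.
have [ta|ta] := leP 0 (frame_ta b s M r x); rewrite /=.
  by apply/fT'/TE'; rewrite mulr_le0_ge0// ltW.
by apply/fT/TE; rewrite mulr_le0// ltW.
Qed.

(** Restricted to the line, both are polynomials of degree at most 2 in xi; their values at -1, 0
    and 1 determine them. *)
Lemma common_axis_coef b (s : R) M (r : R) (c c' : nat -> R) : 0 < r -> `|s| <= 1 ->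
  (forall x, square M (2 * r) x -> frame_ta b s M r x = 0 ->
     frame_quad b s M r c x = frame_quad b s M r c' x) ->
  [/\ c 0%N = c' 0%N, c 1%N = c' 1%N & c 3%N = c' 3%N].
Proof.
move=> r0 s1 ce.
have key (xi : R) : `|xi| <= 1 -> c 0%N + c 1%N * xi + c 3%N * xi ^+ 2 = c' 0%N + c' 1%N * xi + c' 3%N * xi ^+ 2.
  move=> x1.
  pose x : R * R := if b then (M.1 + r * xi, M.2 + r * (s * xi)) else (M.1 + r * (s * xi), M.2 + r * xi).
  have rl (w : R) : `|w| <= 1 -> `|r * w| <= 2 * r.
    move=> w1; rewrite normrM (gtr0_norm r0) mulrC ler_wpM2r ?(ltW r0)//.
    by apply: (le_trans w1); rewrite ler1n.
  have sx : `|s * xi| <= 1 by rewrite normrM mulr_ile1.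
  have Kx : square M (2 * r) x.
    by apply/squareP; rewrite /x; case: b {ce x} => /=; split; rewrite addrC addKr; exact: rl.
  have tx : frame_ta b s M r x = 0.
    by rewrite /frame_ta /x; case: b {ce x Kx} => /=; field; rewrite gt_eqF.
  have xx : frame_xi b M r x = xi.
    by rewrite /frame_xi /x; case: b {ce x Kx tx} => /=; field; rewrite gt_eqF.
  have := ce x Kx tx; rewrite /frame_quad /quad tx xx => e.
  have alg (q : nat -> R) : q 0%N + q 1%N * xi + q 3%N * xi ^+ 2 = q 0%N + q 1%N * xi + q 2%N * 0 + q 3%N * xi ^+ 2 + q 4%N * (xi * 0) + q 5%N * 0 ^+ 2.
    by rewrite expr0n /=; ring.
  by rewrite !alg.
have k0 := key 0 ltac:(by rewrite normr0); have k1 := key 1 ltac:(by rewrite normr1).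
have km := key (-1) ltac:(by rewrite normrN1).
move: k0 k1 km; rewrite expr0n sqrrN expr1n /= => k0 k1 km.
by split; lra.
Qed.

Lemma jump_estimate T' A1 B1 C1 C1' (k : R) j :
  simplex T A1 B1 C1 -> Th T' -> T' <> T -> simplex T' A1 B1 C1' -> 0 <= k <= 1 ->
  h * `|jump T T' yT A1 B1 C1 C1' (A1 + k *: (B1 - A1)) j|
    <= 512 * L ^+ 2 * (128 * sigma ^+ 2) ^+ 2 * E.
Proof.
move=> sT hT' TT' sT' k01; have h0 := diam_T_gt0; have [A0 B0 D0] := error_ge0.
have cf : conforming Th by case: mTh.
have := adjacent_frame cf hT hT' TT' sT sT' sg1 (reg hT) (reg hT').
set tau := 128 * sigma ^+ 2; set r := h / tau; set M := midpoint A1 B1.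
have tau1 : 1 <= tau.
  rewrite /tau; have : 1 <= sigma ^+ 2 by rewrite exprn_ege1.
  by move: (sigma ^+ 2) => q q1; apply: (le_trans q1); rewrite ler_peMl ?ler1n// (le_trans _ q1).
have tau0 : 0 < tau by exact: lt_le_trans tau1.
have r0 : 0 < r by rewrite divr_gt0.
have rE : r * tau = h by rewrite /r divfK// gt_eqF.
move=> [b [s [theta [s1 th0 sq axis nuE]]]].
have [cy [cu [cp [cyE cpE cuE]]]] := local_frame_quad b s M hT (lt0r_neq0 r0).
have [cy' [cu' [cp' [cyE' cpE' cuE']]]] := local_frame_quad b s M hT' (lt0r_neq0 r0).
have K4 z : square M (2 * r) z -> square M (4 * r) z.
  move=> /squareP[z1 z2]; have le24 : 2 * r <= 4 * r by rewrite ler_wpM2r ?(ltW r0)// ler_nat.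
  by apply/squareP; split; [exact: le_trans z1 le24|exact: le_trans z2 le24].
have TU z : square M (4 * r) z -> T z \/ T' z.
  move=> /sq[z1 z2]; have [h1|h1] := leP 0 (theta * frame_ta b s M r z).
    by left; apply/z1.
  by right; apply/z2; exact: ltW.
have KO : square M (2 * r) `<=` Om.
  apply: square_interior; first by rewrite mulr_gt0.
  rewrite (_ : 2 * (2 * r) = 4 * r); last by ring.
  by move=> z /TU[Tz|Tz]; [exact: mesh_subset hT _ Tz|exact: mesh_subset hT' _ Tz].
have KN : square M (2 * r) `<=` N.
  move=> z /K4/TU[Tz|Tz]; [exists T => //; split => //; by left|exists T' => //; split => //].
  by right; exists (segment A1 B1); split; [exists A1, B1, C1|exists A1, B1, C1'].
pose mix (c c' : nat -> R) (sd : bool) := if sd == (0 < theta) then c else c'.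
have mixE (c c' : nat -> R) f : (forall z, T z -> f z = frame_quad b s M r c z) ->
    (forall z, T' z -> f z = frame_quad b s M r c' z) ->
    forall z, square M (2 * r) z -> f z = piecewise b s M r (mix c c') z.
  by move=> f1 f2 z /K4/sq; exact: piecewise_mix.
have cE (c c' : nat -> R) f : (forall z, T z -> f z = frame_quad b s M r c z) ->
    (forall z, T' z -> f z = frame_quad b s M r c' z) ->
    [/\ c 0%N = c' 0%N, c 1%N = c' 1%N & c 3%N = c' 3%N].
  move=> f1 f2; apply: (common_axis_coef (b := b) (s := s) (M := M) r0 s1) => z /K4/sq[z1 z2] tz.
  by rewrite -f1 ?f2//; [apply/z2|apply/z1]; rewrite tz mulr0.
have mixC (c c' : nat -> R) : [/\ c 0%N = c' 0%N, c 1%N = c' 1%N & c 3%N = c' 3%N] ->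
    [/\ mix c c' true 0%N = mix c c' false 0%N, mix c c' true 1%N = mix c c' false 1%N &
        mix c c' true 3%N = mix c c' false 3%N].
  by rewrite /mix; case: (0 < theta) => -[e0 e1 e3].
have [] := jump_coef_bound r0 s1 KO KN
  (fun j' => mixE _ _ _ (cyE j').2 (cyE' j').2) (mixE _ _ _ cpE.2 cpE'.2)
  (fun j' => mixE _ _ _ (cuE j').2 (cuE' j').2)
  (fun j' => mixC _ _ (cE _ _ _ (cyE j').2 (cyE' j').2)) (mixC _ _ (cE _ _ _ cpE.2 cpE'.2)) j.
have mixD n : `|mix (cy j) (cy' j) true n - mix (cy j) (cy' j) false n| = `|cy j n - cy' j n|.
  by rewrite /mix; case: (0 < theta) => //=; rewrite distrC.
rewrite !mixD => d2 d4.
have [_ e1 e3] := cE _ _ _ (cyE j).2 (cyE' j).2.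
have [ta0 xi_le] := axis k k01.
set x := A1 + k *: (B1 - A1) in ta0 xi_le *.
set nu := normal_towards A1 B1 C1 in nuE *.
have LL : 0 <= 128 * L ^+ 2 by rewrite mulr_ge0// exprn_ge0.
have rh : r <= h by rewrite -rE ler_peMr// ltW.
have EB : A + B + r * D <= E by rewrite lerD2l ler_wpM2r.
have {}d2 := le_trans d2 (ler_wpM2l LL EB); have {}d4 := le_trans d4 (ler_wpM2l LL EB).
have E0 : 0 <= 128 * L ^+ 2 * E by apply: le_trans d2.
(* Derivatives along xi agree on the line by [e1] and [e3], and the normals are opposite; what
   remains is the jump of the derivative in ta, multiplied by the scalar product of its gradient
   with the normal. *)
pose w i := grad_ta b s r i * ((cy j 2%N - cy' j 2%N) + (cy j 4%N - cy' j 4%N) * frame_xi b M r x) * crd i nu.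
have jE : jump T T' yT A1 B1 C1 C1' x j = w ord0 + w ord_max.
  rewrite /jump /normal_derivative nuE -/nu !sum2E !(cyE _).1 !(cyE' _).1 !partial_frame_quadE.
  rewrite /frame_quad /quad /grad_coef /quad_dxi /quad_dta ta0 e1 e3 /w /crd /=.
  by rewrite expr0n /=; ring.
have w_le i : h * `|w i| <= tau * (128 * L ^+ 2 * E * (1 + tau)).
  have bi := grad_ta_le b r0 s1 i; have ni := normal_towards_le1 A1 B1 C1 i; rewrite -/nu in ni.
  have q1 : `|(cy j 2%N - cy' j 2%N) + (cy j 4%N - cy' j 4%N) * frame_xi b M r x| <= 128 * L ^+ 2 * E * (1 + tau).
    apply: (le_trans (ler_normD _ _)); rewrite mulrDr mulr1; apply: lerD => //.
    by rewrite normrM; apply: ler_pM.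
  have hE : h = tau * r by rewrite mulrC rE.
  have alg (q1' q2 q3 e : R) : `|q1'| <= r^-1 -> `|q2| <= e -> `|q3| <= 1 ->
      h * `|q1' * q2 * q3| <= tau * e.
    move=> l1 l2 l3; rewrite !normrM hE -mulrA ler_pM2l//.
    have -> : e = r * (r^-1 * e * 1) by field; rewrite gt_eqF.
    by rewrite ler_pM2l// !ler_pM// mulr_ge0.
  exact: alg.
rewrite jE; apply: (le_trans (ler_wpM2l (ltW h0) (ler_normD _ _))).
rewrite mulrDr; apply: (le_trans (lerD (w_le ord0) (w_le ord_max))).
(* Two components, and 1 + t <= 2 t: hence 512 = 2 * 128 * 2. *)
have alg (l t e : R) : 0 <= 128 * l * e -> 1 <= t ->
    t * (128 * l * e * (1 + t)) + t * (128 * l * e * (1 + t)) <= 512 * l * t ^+ 2 * e.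
  move=> le0 t1; have t0 : 0 <= t by exact: le_trans t1.
  have t2 : 0 <= t - 1 by rewrite subr_ge0.
  rewrite -subr_ge0.
  have -> : 512 * l * t ^+ 2 * e - (t * (128 * l * e * (1 + t)) + t * (128 * l * e * (1 + t))) =
    2 * (128 * l * e * t * (t - 1)) by ring.
  by rewrite mulr_ge0// mulr_ge0// mulr_ge0.
exact: alg.
Qed.

End LocalEstimates.

(** Error norms may be infinite. As the constant and h are positive, no product of 0 with infinity
    occurs and the claim is then trivial. *)
Lemma eq_pinfty_sum {R : realType} (c h : R) (X Y Z : \bar R) : 0 < c -> 0 < h ->
  (0 <= X)%E -> (0 <= Y)%E -> (0 <= Z)%E ->
  [|| X == +oo%E, Y == +oo%E | Z == +oo%E] ->
  (c%:E * (X + Y + h%:E * Z))%E = +oo%E.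
Proof.
move=> c0 h0; case: X Y Z => [x||] [y||] [z||] //= _ _ _ _.
all: by rewrite ?gt0_muley ?lte_fin.
Qed.

Theorem theorem6p2 (R : realType) (Om : set (R * R))
    (Th0 : set (set (R * R))) (TT : set (set (set (R * R)))) :
  polytopal_lipschitz_domain Om -> mesh_family Om Th0 TT ->
  exists2 C : R, 0 < C &
  forall (D : set (R * R)) (yd : R * R -> 'I_2 -> R) (lam : R)
    (a b : 'I_2 -> R) (alpha : R),
  finite_set D -> D !=set0 -> D `<=` Om -> 0 < lam ->
  (forall i, a i < b i) -> space_dim - 2 < alpha < 2 ->
  forall (y : 'I_2 -> R * R -> R) (p : R * R -> R)
    (z : 'I_2 -> R * R -> R) (r : R * R -> R) (u : 'I_2 -> R * R -> R),
  OS Om D yd lam a b alpha y p z r u ->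
  forall Th : set (set (R * R)), TT Th ->
  forall (yT : 'I_2 -> R * R -> R) (pT : R * R -> R)
    (zT : 'I_2 -> R * R -> R) (rT : R * R -> R) (uT : 'I_2 -> R * R -> R),
  DOS Om D yd lam a b Th yT pT zT rT uT ->
  forall T : set (R * R), Th T ->
  let h := diam T in
  let N := patch_of Th T in
  let ey := fun i x => y i x - yT i x in
  let ep := fun x => p x - pT x in
  let eu := fun i x => u i x - uT i x in
  (E_st Th T uT yT pT <=
   C%:E * (Lp_vnorm +oo N ey
           + (h `^ (1 - space_dim / 2))%:E * Lp_norm 2%:E N ep
           + (h `^ (2 - space_dim / 2))%:E * Lp_vnorm 2%:E N eu))%E.
Proof.
move=> [oO _ O0 bO [_ lipO]] [_ hTT [sigma0 reg0]].
have [psi psiP] := @dual_functions R.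
have [chi [tchi chi0 mchi]] := @cutoff_function R.
have [l0 psi0L] := line_test_jet (psiP 0%N isT).1.
have [l1 psi1L] := line_test_jet (psiP 1%N isT).1.
have [l2 psi2L] := line_test_jet (psiP 2%N isT).1.
have [l3 chiL'] := line_test_jet tchi.
(* The profiles being fixed beforehand, this bound on their jets is independent of mesh and
   solutions. *)
pose L := Num.max 0 (Num.max l0 (Num.max l1 (Num.max l2 l3))).
have L0 : 0 <= L by rewrite le_max lexx.
have psiL l : (l <= 2)%N -> bounded_jet L (psi l).
  by move: l => [|[|[|//]]] _; [apply: bounded_jetW psi0L|apply: bounded_jetW psi1L|
    apply: bounded_jetW psi2L]; rewrite !le_max lexx ?orbT.
have chiL : bounded_jet L chi by apply: bounded_jetW chiL'; rewrite !le_max lexx !orbT.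
(* At least 1, so that powers of sigma are comparable; as [inball_diam] is nonnegative, enlarging
   the constant keeps the regularity. *)
pose sigma := Num.max 1 sigma0.
have sg1 : 1 <= sigma by rewrite le_max lexx.
pose K1 := 768 * L ^+ 2 * (32 * sigma) ^+ 4.
pose K2 := 512 * L ^+ 2 * (128 * sigma ^+ 2) ^+ 2.
have sg0 : 0 <= sigma by exact: le_trans sg1.
have K10 : 0 <= K1.
  exact: mulr_ge0 (mulr_ge0 (ler0n _ 768) (exprn_ge0 2 L0)) (exprn_ge0 4 (mulr_ge0 (ler0n _ 32) sg0)).
have K20 : 0 <= K2.
  exact: mulr_ge0 (mulr_ge0 (ler0n _ 512) (exprn_ge0 2 L0)) (exprn_ge0 2 (mulr_ge0 (ler0n _ 128) (exprn_ge0 2 sg0))).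
(* The residual contributes 2 K1, the 2 being the price of the Euclidean norm in [vnorm_le]; the
   divergence contributes K1, and the jump K2, where the factor 1/2 of the indicator absorbs the
   same 2. The last 1 ensures positivity. *)
exists (3 * K1 + K2 + 1); first by rewrite ltr_wpDl// addr_ge0// mulr_ge0.
move=> D yd lam a b alpha _ _ _ _ _ _ y p z r u
  [[hy hp _ _ hu] [mom div] _ _] Th hTh yT pT zT rT uT [[hV hQ _ _ hU] _ _ _] T hT.
cbv zeta; set h := diam T; set N := patch_of Th T.
set ey := fun i x => y i x - _; set ep := fun x => p x - _; set eu := fun i x => u i x - _.
have mTh : mesh Om Th := (hTT Th hTh).1.
have reg T' : Th T' -> diam T' <= sigma * inball_diam T'.
  move=> hT'; apply: (le_trans (reg0 _ _ hTh hT')).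
  by rewrite ler_wpM2r ?inball_diam_ge0// le_max lexx orbT.
have O1 := bounded_mu2_fin oO bO.
have ly j : loc_integrable Om (y j) by exact: L2_loc_integrable oO O1 (hy j).1.1.
have lp : loc_integrable Om p by exact: L2_loc_integrable oO O1 hp.1.
have lu j : loc_integrable Om (u j) by exact: L2_loc_integrable oO O1 (hu j).1.
have wy k i : exists g, is_wpartial Om i (y k) g by have [g hg _] := (hy k).1.2 i; exists g.
have momentum j phi : test_fun Om phi -> _ := weak_momentum j oO O1 wy lp lu mom.
have divergence phi : test_fun Om phi -> _ := weak_divergence oO O1 O0 hy div.
have h0 : 0 < h by exact: diam_T_gt0 mTh _ hT.
(* In dimension 2 the exponents of h are 0 and 1. *)
rewrite /space_dim divff// subrr powRr0 mul1e (_ : 2 - 1 = 1 :> R); last by ring.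
rewrite powRr1 ?(ltW h0)//.
have X0 : (0 <= Lp_vnorm +oo N ey)%E by exact: Lp_norm_ge0.
have Y0 : (0 <= Lp_norm 2%:E N ep)%E by exact: Lp_norm_ge0.
have Z0 : (0 <= Lp_vnorm 2%:E N eu)%E by exact: Lp_norm_ge0.
have [inf|] := boolP [|| Lp_vnorm +oo N ey == +oo%E, Lp_norm 2%:E N ep == +oo%E |
   Lp_vnorm 2%:E N eu == +oo%E].
  by rewrite eq_pinfty_sum ?leey// ltr_wpDl// addr_ge0// mulr_ge0.
case AE : (Lp_vnorm +oo N ey) X0 => [A||]//= _.
case BE : (Lp_norm 2%:E N ep) Y0 => [B||]//= _.
case DE : (Lp_vnorm 2%:E N eu) Z0 => [G||]//= _ _.
have eE x : T x -> _ := @element_estimate _ Om Th oO lipO mTh sigma sg1 reg T hT y u yT uT p pT ly lp lu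
  A B G AE BE DE momentum divergence L psi L0 psiP psiL (fun j => (hV j).1) hQ.1 hU.1 x.
have jE T' A1 B1 C1 C1' k j := @jump_estimate _ Om Th oO lipO mTh sigma sg1 reg T hT y u yT uT p pT ly lp lu
  A B G AE BE DE momentum L psi chi L0 psiP psiL tchi chi0 mchi chiL (fun j => (hV j).1) hQ.1 hU.1
  T' A1 B1 C1 C1' k j.
have [A0 B0 G0] := error_ge0 AE BE DE.
pose E := A + B + h * G.
have E0 : 0 <= E by rewrite !addr_ge0// mulr_ge0// ltW.
have K1E : 0 <= K1 * E by exact: mulr_ge0.
have h20 : 0 < h ^+ 2 by rewrite exprn_gt0.
have vnorm_bound (w : 'I_2 -> R) (q e : R) : 0 < q -> (forall j, q * `|w j| <= e) ->
    `|vnorm w| <= 2 * (e / q).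
  move=> q0 we; rewrite ger0_norm ?vnorm_ge0//; apply: vnorm_le => j.
  by rewrite ler_pdivlMr// mulrC.
have resid_le : (Lp_vnorm +oo T (fun j x => local_poly 2 T (uT j) x
    + \sum_(i < 2) partial i (partial i (local_poly 2 T (yT j))) x
    - partial j (local_poly 1 T pT) x)%R <= (2 * (K1 * E / h ^+ 2))%:E)%E.
  apply: Lp_normy_le => [|x Tx]; first exact: mulr_ge0 (ler0n _ 2) (divr_ge0 K1E (ltW h20)).
  by apply: vnorm_bound => // j; exact: (eE x Tx).1.
have div_le : (Lp_norm +oo T (fun x => \sum_(i < 2) partial i (local_poly 2 T (yT i)) x)%R
    <= (K1 * E / h)%:E)%E.
  apply: Lp_normy_le => [|x Tx]; first exact: divr_ge0 K1E (ltW h0).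
  by rewrite ler_pdivlMr// mulrC; exact: (eE x Tx).2.
have K2E : 0 <= 2 * (K2 * E / h) by exact: mulr_ge0 (ler0n _ 2) (divr_ge0 (mulr_ge0 K20 E0) (ltW h0)).
have jump_le : (jump_norm Th T yT <= (2 * (K2 * E / h))%:E)%E.
  apply: ge_ereal_sup => e [->|[A1 [B1 [C1 [T' [C1' [sT hT' TT' sT' ->]]]]]]].
    by rewrite lee_fin.
  apply: sup_norm_le => // k /=; rewrite patchE lee_fin; case: ifPn => [/set_mem/=|_]; last first.
    by rewrite normr0.
  rewrite in_itv /= => k01; apply: vnorm_bound => // j.
  exact: jE sT hT' TT' sT' k01.
rewrite /E_st -/h.
have -> : ((3 * K1 + K2 + 1)%:E * (A%:E + B%:E + h%:E * G%:E) = ((3 * K1 + K2 + 1) * E)%:E)%E by [].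
apply: (@le_trans _ _ ((h ^+ 2)%:E * (2 * (K1 * E / h ^+ 2))%:E + (h / 2)%:E * (2 * (K2 * E / h))%:E
  + h%:E * (K1 * E / h)%:E)%E).
  by rewrite !leeD// lee_wpmul2l// lee_fin ?divr_ge0// ltW.
rewrite -!EFinM -!EFinD lee_fin.
have -> : h ^+ 2 * (2 * (K1 * E / h ^+ 2)) + h / 2 * (2 * (K2 * E / h)) + h * (K1 * E / h) =
  (3 * K1 + K2) * E by field; rewrite gt_eqF.
by rewrite ler_wpM2r// lerDl.
Qed.
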